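(* Suppose $k=\dim W$ is even and $k\le\dim X$. 1. $\mathbf N_r$ is nonempty and (Zariski) open in $\mathbf N$. 2. $N_r$ is the union of the sets $N^S$, as $S$ runs over the $k$-maximal tori $S$ of $H$ (defined over $F$). 3. We have a decomposition $$N_r=\bigcup_S\{\mathrm{Ad}(m)n_S(\gamma)\mid m\in M,\ \gamma\in S_r\},$$ the union being over the $k$-maximal tori $S$ of $H$.
   Context: $F$ is a field of characteristic not two. $V$ is a finite-dimensional $F$-vector space with nondegenerate symmetric or antisymmetric bilinear form $\Phi$. $W\subset V$ is totally isotropic of dimension $k$; $W'\subset V$ is totally isotropic of dimension $k$ with $W+W'$ direct and nondegenerate; $X=(W+W')^\perp$. $G=\mathrm{GL}(W)$, $H=\mathrm{Isom}(X,\Phi|_X)$ (linear isometries). $M$ is the subgroup of $\mathrm{Isom}(V,\Phi)$ preserving $W,X,W'$; $m(g,h)\in M$ restricts to $g$ on $W$, $h$ on $X$. Adjoints $(\cdot)^*$ are with respect to $\Phi$: for $\xi:X\to W$, $\xi^*:W'\to X$ with $\Phi(\xi^*w',x)=\Phi(w',\xi x)$; for $\eta:W'\to W$, $\eta^*:W'\to W$ with $\Phi(\eta^*w_1',w_2')=\Phi(w_1',\eta w_2')$; for $g\in\mathrm{End}(W)$, $g^*\in\mathrm{End}(W')$. $N$ is the unipotent radical of the stabilizer of $W$; it consists of the $n(\xi,\eta)$ ($\xi:X\to W$, $\eta:W'\to W$, $\eta+\eta^*+\xi\xi^*=0$), where $n(\xi,\eta)$ is the identity on $W$, $x\mapsto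 x+\xi x$ on $X$, $w'\mapsto w'-\xi^*w'+\eta w'$ on $W'$. $\mathrm{Ad}(m(g,h))n(\xi,\eta)=n(g\xi h^{-1},g\eta g^* )$. $N'=\{n(\xi,\eta):\eta\text{ invertible}\}$ and $\mathrm{Norm}:N'\to H$, $\mathrm{Norm}(n(\xi,\eta))=1+\xi^*\eta^{-1}\xi$. Bold letters denote $\overline F$-points. $\mathbf H_k=\{h\in\mathbf H:\mathrm{rank}(h-1;X)\le k\}$. A $k$-maximal torus is a torus $\mathbf S\subseteq\mathbf H_k$ of the greatest possible dimension $k/2$, defined over $F$; $S$ denotes its $F$-points. $E\subset X$ is the space of vectors fixed by $\mathbf S$ ($F$-points of $\mathbf X^{\mathbf S}$), $E^\circ$ its orthogonal complement in $X$, $\mathbf H^{\mathbf E}$ the subgroup of $\mathbf H$ fixing $\mathbf E$ pointwise ($\mathbf S$ is a maximal torus in it). $\mathbf S_r$ is the set of $\gamma\in\mathbf S$ with $\alpha(\gamma)\neq1$ for every root $\alpha$ of $\mathbf S$ in $\mathbf H^{\mathbf E}$ and $(\gamma-1)|_{\mathbf E^\circ}$ invertible; $S_r$ denotes its $F$-points. $\mathbf H^{\mathbf S}$ is the union of the $\mathbf H$-conjugates of $\mathbf S_r$ (all $k$-maximal tori are $\mathbf H$-conjugate, so it does not depend on $\mathbf S$). $\mathbf N_r=\{n\in\mathbf N':\mathrm{Norm}(n)\in\mathbf H^{\mathbf S}\}$, and $N_r$ is its set of $F$-points. $N^S=\{n\in N':\mathrm{Norm}(n)\text{ is }H\text{-conjugate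 to an element of }S_r\}$. For each $S$ fix a linear map $\xi:X\to W$ with $\ker\xi=E$ (it is surjective and $\xi\xi^*$ is invertible); put $\upsilon=(\xi\xi^* )^{-1}$, $\xi^+=\xi^*\upsilon$; for $\gamma\in S_r$ put $\gamma_G=(\xi(\gamma-1)\xi^+)^{-1}\in G$ and $n_S(\gamma)=n(\xi,\gamma_G\upsilon^{-1})$. *)

(* Defs.v *)
(* MathComp, with sets from mathcomp.classical and polynomials from multinomials. *)
From HB Require Import structures.
From mathcomp Require Import all_boot all_order all_algebra.
From mathcomp Require Import boolp classical_sets.
From mathcomp Require Import mpoly.

Set Implicit Arguments.
Unset Strict Implicit.
Unset Printing Implicit Defensive.

Import GRing.Theory.
Local Open Scope ring_scope.
Local Open Scope classical_set_scope.

Section LinearMaps.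

Variables (F : fieldType) (V : vectType F).

Definition incv (U : {vspace V}) : 'Hom(subvs_of U, V) := linfun vsval.

(* The projection onto U along C, with values in the vectType of U. *)
Definition prjv (U C : {vspace V}) : 'Hom(V, subvs_of U) :=
  (linfun (vsproj U) \o daddv_pi U C)%VF.

Definition conj_lfun (g f : 'End(V)) : 'End(V) := (g \o f \o g^-1)%VF.

Definition conjugates (H A : set 'End(V)) : set 'End(V) :=
  [set conj_lfun h f | h in H & f in A].

End LinearMaps.

(* Everything here is used twice: over the base field, and over its algebraic
   closure for the extended spaces and form. *)
Section Isotropic.

Variables (F : fieldType) (V : vectType F) (Phi : V -> V -> F).

(* Invertibility need not be required where Phi is nondegenerate on U. *)
Definition isom (U : {vspace V}) : set 'End(subvs_of U) :=
  [set h | forall x y, Phi (vsval (h x)) (vsval (h y)) = Phi (vsval x) (vsval y)].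

(* The adjoint of f : A -> B, where Phi pairs C with B and D with A: it is the
   unique map C -> D satisfying the stated identity when Phi is nondegenerate
   as a pairing of D and A.  The instances used are xi : X -> W with
   xi^* : W' -> X, and eta : W' -> W with eta^* : W' -> W. *)
Definition adj (A B C D : {vspace V}) (f : 'Hom(subvs_of A, subvs_of B)) :
    'Hom(subvs_of C, subvs_of D) :=
  xget 0 [set g : 'Hom(subvs_of C, subvs_of D) |
           forall c a, Phi (vsval (g c)) (vsval a) = Phi (vsval c) (vsval (f a))].

Variables W X W' : {vspace V}.

Local Notation HomXW := 'Hom(subvs_of X, subvs_of W).
Local Notation HomW'W := 'Hom(subvs_of W', subvs_of W).

Definition adj_xi (xi : HomXW) : 'Hom(subvs_of W', subvs_of X) := adj W' X xi.
Definition adj_eta (eta : HomW'W) : HomW'W := adj W' W eta.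

(* w |-> w, x |-> x + xi x, w' |-> w' - xi^* w' + eta w' on V = W + X + W'. *)
Definition nmap (xi : HomXW) (eta : HomW'W) : 'End(V) :=
  (\1 + (incv W \o xi \o prjv X (W + W'))
      + (((incv W \o eta) - (incv X \o adj_xi xi)) \o prjv W' (W + X)))%VF.

Definition Nrel (xi : HomXW) (eta : HomW'W) : Prop :=
  eta + adj_eta eta + (xi \o adj_xi xi)%VF = 0.

Definition Nset : set 'End(V) :=
  [set n | exists xi eta, Nrel xi eta /\ n = nmap xi eta].

Definition Norm (xi : HomXW) (eta : HomW'W) : 'End(subvs_of X) :=
  (\1 + (adj_xi xi \o eta^-1 \o xi))%VF.

(* The n in N' with Norm(n) in A. *)
Definition Norm_preim (A : set 'End(subvs_of X)) : set 'End(V) :=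
  [set n | exists xi eta, [/\ Nrel xi eta, bijective eta,
                              n = nmap xi eta & A (Norm xi eta)]].

Definition Mset : set 'End(V) :=
  [set m : 'End(V) | [/\ forall u v, Phi (m u) (m v) = Phi u v,
               (m @: W = W)%VS, (m @: X = X)%VS & (m @: W' = W')%VS]].

Definition upsilon (xi : HomXW) : 'Hom(subvs_of W, subvs_of W') :=
  ((xi \o adj_xi xi)^-1)%VF.

Definition xi_plus (xi : HomXW) : 'Hom(subvs_of W, subvs_of X) :=
  (adj_xi xi \o upsilon xi)%VF.

Definition gammaG (xi : HomXW) (gamma : 'End(subvs_of X)) : 'End(subvs_of W) :=
  ((xi \o (gamma - \1) \o xi_plus xi)^-1)%VF.

Definition nS (xi : HomXW) (gamma : 'End(subvs_of X)) : 'End(V) :=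
  nmap xi (gammaG xi gamma \o (upsilon xi)^-1)%VF.

End Isotropic.

Arguments isom {F V} Phi U _.

(* Affine algebraic sets in a type T whose points have coordinates c. *)
Section Zariski.

Variables (F K : fieldType) (iota : {rmorphism F -> K}).
Variables (T : Type) (N : nat) (c : T -> 'I_N -> K).

Definition zeros (P : set {mpoly K[N]}) : set T :=
  [set x | forall p, P p -> p.@[c x] = 0].

Definition zclosed (A : set T) : Prop := exists P, A = zeros P.

Definition zopen_in (B A : set T) : Prop := exists P, A = B `\` zeros P.

Definition ideal_of (A : set T) : set {mpoly K[N]} :=
  [set p | forall x, A x -> p.@[c x] = 0].

(* The vanishing ideal is generated by polynomials over F (for an imperfect F
   this is stronger than being the zero locus of polynomials over F).  For an
   ideal, being generated by and being K-spanned by its elements with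
   coefficients in F are the same. *)
Definition defined_over (A : set T) : Prop :=
  zclosed A /\
  forall p, ideal_of A p ->
    exists s : seq (K * {mpoly F[N]}),
      (forall u, u \in s -> ideal_of A (map_mpoly iota u.2)) /\
      p = \sum_(u <- s) u.1 *: map_mpoly iota u.2.

End Zariski.

Section Torus.

Variables (K : fieldType) (U : vectType K) (N : nat) (c : 'End(U) -> 'I_N -> K).

Definition Gm (r : nat) : set ('I_r -> K) := [set t | forall i, t i != 0].

(* S is the image of an isomorphism phi of algebraic groups from GL_1^r onto a
   closed subgroup of a group of isometries of U.  Regular functions on GL_1^r
   are polynomials divided by powers of the product of the coordinates.  The
   isometry group of a nondegenerate form is closed in End(U), so the regular
   functions on S are the polynomials in the coordinates. *)
Definition is_torus (r : nat) (S : set 'End(U)) : Prop :=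
  zclosed c S /\
  exists phi : ('I_r -> K) -> 'End(U),
    [/\ phi @` @Gm r = S,
        forall s t, Gm s -> Gm t -> phi (fun i => s i * t i) = (phi s \o phi t)%VF,
        exists (P : 'I_N -> {mpoly K[r]}) (e : nat), forall t, Gm t ->
          forall l, c (phi t) l = (P l).@[t] / (\prod_i t i) ^+ e
      & exists Q : 'I_r -> {mpoly K[N]}, forall t, Gm t ->
          forall i, (Q i).@[c (phi t)] = t i].

End Torus.

Section BaseChange.

Variables (F K : fieldType) (iota : {rmorphism F -> K}) (V : vectType F).

(* K \otimes_F V is modelled by coordinates on the basis vbasis {:V}. *)
Definition ext (v : V) : 'rV[K]_(\dim {:V}) :=
  \row_i iota (coord (vbasis {:V}) i v).

Definition ext_form (Phi : V -> V -> F) (u v : 'rV[K]_(\dim {:V})) : K :=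
  form idfun (\matrix_(i, j) iota (Phi (vbasis {:V})`_i (vbasis {:V})`_j)) u v.

Definition ext_space (U : {vspace V}) : {vspace 'rV[K]_(\dim {:V})} :=
  <<map ext (vbasis U)>>%VS.

Definition ext_sub (U : {vspace V}) (x : subvs_of U) : subvs_of (ext_space U) :=
  vsproj (ext_space U) (ext (vsval x)).

End BaseChange.

Arguments ext {F K} iota {V} v.
Arguments ext_sub {F K} iota {V} U x.

Section Points.

Variables (F K : fieldType) (U : vectType F) (UK : vectType K) (j : U -> UK).

(* Entries of the matrix of f : UK -> UK in the image of an F-basis of U. *)
Definition coords (f : 'End(UK)) :
    'I_(\dim {:U} * \dim {:U}) -> K :=
  let e := map_tuple j (vbasis {:U}) in
  fun l => mxvec (\matrix_(i, i') coord e i' (f e`_i)) 0 l.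

Definition Fpoints (A : set 'End(UK)) : set 'End(U) :=
  [set f | exists2 g, A g & forall u, g (j u) = j (f u)].

End Points.

Section KMaximalTori.

Variables (F : fieldType) (K : fieldType) (iota : {rmorphism F -> K}).
Variables (V : vectType F) (Phi : V -> V -> F) (W X W' : {vspace V}).

Local Notation XK := (ext_space iota X).
Local Notation PhiK := (ext_form iota Phi).
Local Notation extX := (ext_sub iota X).

Definition HK : set 'End(subvs_of XK) := isom PhiK XK.

Definition HKle (k : nat) : set 'End(subvs_of XK) :=
  [set h | HK h /\ (\dim (limg (h - \1)%VF%R) <= k)%N].

Definition kmax_torus (S : set 'End(subvs_of XK)) : Prop :=
  [/\ is_torus (coords extX) (\dim W)./2 S, S `<=` HKle (\dim W)
    & defined_over iota (coords extX) S].

Section OneTorus.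

Variable S : set 'End(subvs_of XK).

Definition EK : set (subvs_of XK) := [set x | forall s, S s -> s x = x].

Definition E : set (subvs_of X) := [set x | EK (extX x)].

Definition EKperp : set (subvs_of XK) :=
  [set y | forall x, EK x -> PhiK (vsval y) (vsval x) = 0].

(* The Lie algebra of the group of isometries fixing EK pointwise: the Y such
   that 1 + eps Y satisfies, over the dual numbers, the equations of this group. *)
Definition lieHE : set 'End(subvs_of XK) :=
  [set Y | (forall x y, PhiK (vsval (Y x)) (vsval y) +
                        PhiK (vsval x) (vsval (Y y)) = 0) /\
           (forall x, EK x -> Y x = 0)].

(* Only the values of alpha on S matter; that alpha is an algebraic character
   of S is forced by the existence of Y. *)
Definition is_root (alpha : 'End(subvs_of XK) -> K) : Prop :=
  (exists2 s, S s & alpha s != 1) /\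
  exists Y, [/\ lieHE Y, Y != 0 & forall s, S s -> conj_lfun s Y = alpha s *: Y].

Definition SrK : set 'End(subvs_of XK) :=
  [set g | [/\ S g, forall alpha, is_root alpha -> alpha g != 1
             & forall y, EKperp y -> exists! x, EKperp x /\ (g - \1)%VF x = y]].

Definition Sr : set 'End(subvs_of X) := Fpoints extX SrK.

Definition HSK : set 'End(subvs_of XK) := conjugates HK SrK.

Definition NrK : set 'End('rV[K]_(\dim {:V})) :=
  Norm_preim PhiK (ext_space iota W) (ext_space iota W') HSK.

Definition Nr : set 'End(V) := Fpoints (ext iota) NrK.

Definition NS : set 'End(V) :=
  Norm_preim Phi W W' (conjugates (isom Phi X) Sr).

End OneTorus.

Definition NK : set 'End('rV[K]_(\dim {:V})) :=
  Nset PhiK (ext_space iota W) XK (ext_space iota W').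

End KMaximalTori.

Arguments kmax_torus {F K} iota {V} Phi W X S.
Arguments E {F K} iota {V} X S _.
Arguments Sr {F K} iota {V} Phi X S _.
Arguments NrK {F K} iota {V} Phi W X W' S _.
Arguments Nr {F K} iota {V} Phi W X W' S _.
Arguments NS {F K} iota {V} Phi W X W' S _.
Arguments NK {F K} iota {V} Phi W X W' _.

(* Main.v *)
Require Import Defs.
From HB Require Import structures.
From mathcomp Require Import all_boot all_order all_algebra.
From mathcomp Require Import boolp classical_sets.
From mathcomp Require Import mpoly.
From mathcomp Require Import ring zify.

(** Write k = 2 r for the dimension of W, and a subscript K for an extension of scalars.

A frame of X_K is a family e_i, f_i (i < r) in which the only nonzero pairings
are B (e_i) (f_i) = 1 (and those forced by symmetry).  It defines the frame
torus of the isometries e_i |-> t_i e_i, f_i |-> t_i^-1 f_i that fix the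
orthogonal complement of the frame.  Everything rests on the fact that the
k-maximal tori are the frame tori of r-frames which happen to be defined over F.
Indeed, the entries of an isomorphism phi of GL_1^r onto a torus are Laurent
polynomials, and independence of characters turns their coefficients into the
projections on weight spaces.  The form pairs the weights x and - x, the rank
bound allows only 2 r nonzero weights counted with multiplicity, and the
regularity of phi^-1 says that these weights generate Z^r, whence r opposite
pairs of lines (torus_is_frame_torus).  The roots of a frame torus can be read
off, so that S_r becomes an explicit set of inequalities on t (SrK_regular,
regular_SrK); by Witt's theorem (witt) all r-frames are conjugate, so H^S is the
set of all tor e f t with (e, f) any r-frame and t regular (HSK_frameP).

Part 1.  Pairing W' with the W-component of n(xi, eta) on W' gives a matrix M
whose entries are linear in n.  The relation eta + eta^* + xi xi^* = 0 says that
- (M + M^T), or - (M - M^T) in the antisymmetric case, is the Gram matrix of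
xi^* on W', and Norm acts on the image of xi^* by 1 - A^-1, for an operator A
built from M.  Hence Norm(n) lies in H^S exactly when a certain polynomial in M does not vanish: it expresses that
eta and the Gram matrix are invertible, and that the eigenvalues of A are as
distinct as the form permits (crit_Norm, Norm_crit).

Part 2.  The point is to find a torus over F through h = Norm(n), for n in N_r.
Over K, h = tor e f t with t regular.  The ideal of the torus of (e, f) is
descended to F without Galois theory: if the endomorphisms of X that become
diagonal in the frame span over K all diagonal operators, then the torus is
parametrized by b |-> b c^-1, c the adjoint of b, where b runs over a K-linear
space with an F-structure; this is a rational map over F, and the vanishing
ideal of its image is generated by polynomials over F (rational_frame_def).  The span condition holds for the
frame of h (isometry_span): polynomials in h separate all eigenvalues, except
that t_i = -1 takes the same value on e_i and f_i; there the plane ker (h + 1)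
carries one more rational operator.  The span condition also produces
k-maximal tori, from r orthogonal planes of X (exists_rational_frame).

Part 3.  For a given xi with kernel E, the equation Norm(n(xi, eta)) = gamma
determines eta, and any two surjections X -> W with the same kernel differ by
GL(W); so the n with Norm(n) conjugate to gamma form one M-orbit (NS_eq). *)

Set Implicit Arguments.
Unset Strict Implicit.
Unset Printing Implicit Defensive.

Import GRing.Theory.
Local Open Scope ring_scope.
Local Open Scope classical_set_scope.

(** * Preliminaries of linear algebra *)

(** For functions whose linearity is a hypothesis and not a canonical structure. *)
Lemma linfun_linE (F : fieldType) (U V : vectType F) (f : U -> V) :
  linear f -> forall x, linfun f x = f x.
Proof.
move=> lf x.
pose g : {linear U -> V} := HB.pack f (GRing.isLinear.Build _ _ _ _ f lf).
exact: (lfunE g).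
Qed.

Lemma free_dual (F : fieldType) (U : vectType F) (I : finType) (w : I -> U)
    (phi : I -> U -> F) :
  (forall i, linear_for *%R (phi i)) ->
  (forall i j, phi i (w j) = (i == j)%:R) -> free (map w (enum I)).
Proof.
move=> lphi phiw.
have -> : map w (enum I) = [tuple of map w (enum_tuple I)] by [].
apply/freeP => k.
have E (i : 'I_(#|I|)) : [tuple of map w (enum_tuple I)]`_i = w (enum_val i).
  by rewrite /= (nth_map (enum_val i)) -?cardE ?ltn_ord // [in RHS](enum_val_nth (enum_val i)).
move=> s0 i.
have [g gE] : exists g : {linear U -> F^o}, forall x, g x = phi (enum_val i) x.
  pose g0 : {linear U -> F^o} := HB.pack (phi (enum_val i) : U -> F^o)
    (GRing.isLinear.Build _ _ _ _ (phi (enum_val i) : U -> F^o) (lphi _)).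
  by exists g0.
have := congr1 g s0; rewrite linear0 linear_sum (bigD1 i) //= big1 ?addr0.
  by rewrite linearZ E gE phiw eqxx => <-; rewrite -[LHS]mulr1.
move=> j ne; rewrite linearZ E gE phiw (inj_eq enum_val_inj) eq_sym (negbTE ne).
exact: mulr0.
Qed.

(** * Bilinear forms, frames and frame tori *)

(** The sign eps covers symmetric (eps = false) and antisymmetric (eps = true) forms at
    once. *)
Record isform (F : fieldType) (U : vectType F) (eps : bool) (B : U -> U -> F) : Prop :=
  IsForm {
    form_linl : forall a x y z, B (a *: x + y) z = a * B x z + B y z;
    form_sym : forall x y, B x y = (-1) ^+ eps * B y x;
    form_nondeg : forall x, (forall y, B x y = 0) -> x = 0 }.

Record frame (F : fieldType) (U : vectType F) (B : U -> U -> F) (I : finType)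
    (e f : I -> U) : Prop := IsFrame {
  fr_ee : forall i j, B (e i) (e j) = 0;
  fr_ff : forall i j, B (f i) (f j) = 0;
  fr_ef : forall i j, B (e i) (f j) = (i == j)%:R }.

(** Orthogonality to the frame; pairing with e on the left and with f on the right is
    the order in which both occur as coordinates. *)
Definition perp (F : fieldType) (U : vectType F) (B : U -> U -> F) (I : finType)
    (e f : I -> U) (x : U) := forall i, B (e i) x = 0 /\ B x (f i) = 0.

(** The operator with eigenvalue a i on e i, b i on f i, and 0 on the complement: x |->
    B x (f i) and x |-> B (e i) x are the coordinates dual to e i and f i. *)
Definition dgf (F : fieldType) (U : vectType F) (B : U -> U -> F) (I : finType)
    (e f : I -> U) (a b : I -> F) : 'End(U) :=
  linfun (fun x => \sum_i (a i * B x (f i)) *: e i + \sum_i (b i * B (e i) x) *: f i).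

Definition tor (F : fieldType) (U : vectType F) (B : U -> U -> F) (I : finType)
    (e f : I -> U) (t : I -> F) : 'End(U) :=
  (\1 + dgf B e f (fun i => t i - 1) (fun i => (t i)^-1 - 1))%VF.

Section Form.
Variables (F : fieldType) (U : vectType F) (eps : bool) (B : U -> U -> F).
Hypothesis HB : isform eps B.
Hypothesis two : 2%:R != 0 :> F.
Local Notation sg := ((-1) ^+ eps : F).

Lemma sgK : sg * sg = 1.
Proof. by rewrite -expr2 sqrr_sign. Qed.
Lemma sgMK x : sg * (sg * x) = x.
Proof. by rewrite mulrA sgK mul1r. Qed.
Lemma fC x y : B x y = sg * B y x.
Proof. exact: (form_sym HB). Qed.
Lemma fDl x y z : B (x + y) z = B x z + B y z.
Proof. by rewrite -{1}[x]scale1r (form_linl HB) mul1r. Qed.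
Lemma f0l z : B 0 z = 0.
Proof. by apply: (addrI (B 0 z)); rewrite -fDl !addr0. Qed.
Lemma fZl a x z : B (a *: x) z = a * B x z.
Proof. by rewrite -{1}[a *: x]addr0 (form_linl HB) f0l addr0. Qed.
Lemma fDr x y z : B z (x + y) = B z x + B z y.
Proof. by rewrite fC fDl mulrDr -!fC. Qed.
Lemma fZr a x z : B z (a *: x) = a * B z x.
Proof. by rewrite fC fZl mulrCA -fC. Qed.
Lemma f0r z : B z 0 = 0.
Proof. by rewrite fC f0l mulr0. Qed.
Lemma fNl x z : B (- x) z = - B x z.
Proof. by rewrite -scaleN1r fZl mulN1r. Qed.
Lemma fNr x z : B z (- x) = - B z x.
Proof. by rewrite -scaleN1r fZr mulN1r. Qed.
Lemma fBl x y z : B (x - y) z = B x z - B y z.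
Proof. by rewrite fDl fNl. Qed.
Lemma fBr x y z : B z (x - y) = B z x - B z y.
Proof. by rewrite fDr fNr. Qed.
Lemma fsuml (I : Type) (r : seq I) (P : pred I) (v : I -> U) z :
  B (\sum_(i <- r | P i) v i) z = \sum_(i <- r | P i) B (v i) z.
Proof. by apply: (big_morph (B^~ z)) => [x y|]; rewrite ?fDl ?f0l. Qed.
Lemma fsumr (I : Type) (r : seq I) (P : pred I) (v : I -> U) z :
  B z (\sum_(i <- r | P i) v i) = \sum_(i <- r | P i) B z (v i).
Proof. by apply: (big_morph (B z)) => [x y|]; rewrite ?fDr ?f0r. Qed.
Lemma f_eq0C x y : B x y = 0 -> B y x = 0.
Proof. by move=> h; rewrite fC h mulr0. Qed.
Lemma form_inj x y : (forall z, B x z = B y z) -> x = y.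
Proof.
by move=> h; apply/subr0_eq/(form_nondeg HB) => z; rewrite fBl h subrr.
Qed.
Lemma alt0 x : eps -> B x x = 0.
Proof.
move=> he; have := fC x x; rewrite he expr1 mulN1r => h.
by apply/eqP; rewrite -(mulrI_eq0 _ (mulfI two)) mulr_natl mulr2n {1}h addNr.
Qed.

Lemma isometry_bij (h : 'End(U)) : (forall x y, B (h x) (h y) = B x y) ->
  lker h == 0%VS.
Proof.
move=> ih; apply/lker0P => x y hxy; apply: form_inj => z.
by rewrite -ih hxy ih.
Qed.

Section Frame.
Variables (I : finType) (e f : I -> U).
Hypothesis He : frame B e f.
Local Notation dg := (dgf B e f).

Lemma fr_fe i j : B (f i) (e j) = sg * (j == i)%:R.
Proof. by rewrite fC (fr_ef He). Qed.

Lemma dgE a b x : dg a b x =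
  \sum_i (a i * B x (f i)) *: e i + \sum_i (b i * B (e i) x) *: f i.
Proof.
apply: linfun_linE => {x} c u v /=; rewrite scalerDr !scaler_sumr addrACA -!big_split /=.
apply: eq_bigr => i _; rewrite fDl fDr fZl fZr !mulrDr !scalerDl !scalerA.
by congr (_ + _ + (_ + _)); congr (_ *: _); ring.
Qed.
Lemma dg_e a b i : dg a b (e i) = a i *: e i.
Proof.
rewrite dgE (bigD1 i) //= [X in _ + X]big1 ?addr0 => [|j _]; last first.
  by rewrite (fr_ee He) mulr0 scale0r.
rewrite big1 ?addr0 => [|j ne]; first by rewrite (fr_ef He) eqxx mulr1.
by rewrite (fr_ef He) eq_sym (negbTE ne) mulr0 scale0r.
Qed.
Lemma dg_f a b i : dg a b (f i) = b i *: f i.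
Proof.
rewrite dgE [X in _ + X](bigD1 i) //= big1 ?add0r => [|j _]; last first.
  by rewrite (fr_ff He) mulr0 scale0r.
rewrite big1 ?addr0 => [|j ne]; first by rewrite (fr_ef He) eqxx mulr1.
by rewrite (fr_ef He) (negbTE ne) mulr0 scale0r.
Qed.
Lemma dg_perp a b x : perp B e f x -> dg a b x = 0.
Proof.
move=> px; rewrite dgE !big1 ?addr0 // => i _; have [h1 h2] := px i.
  by rewrite h1 mulr0 scale0r.
by rewrite h2 mulr0 scale0r.
Qed.
Lemma fe_dg a b x i : B (e i) (dg a b x) = b i * B (e i) x.
Proof.
rewrite dgE fDr !fsumr big1 ?add0r => [|j _]; last by rewrite fZr (fr_ee He) mulr0.
rewrite (bigD1 i) //= big1 ?addr0 => [|j ne].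
  by rewrite fZr (fr_ef He) eqxx mulr1.
by rewrite fZr (fr_ef He) eq_sym (negbTE ne) mulr0.
Qed.
Lemma f_dg_f a b x i : B (dg a b x) (f i) = a i * B x (f i).
Proof.
rewrite dgE fDl !fsuml addrC big1 ?add0r => [|j _]; last by rewrite fZl (fr_ff He) mulr0.
rewrite (bigD1 i) //= big1 ?addr0 => [|j ne].
  by rewrite fZl (fr_ef He) eqxx mulr1.
by rewrite fZl (fr_ef He) (negbTE ne) mulr0.
Qed.
Lemma perp_sub x : perp B e f (x - dg (fun=> 1) (fun=> 1) x).
Proof. by move=> i; rewrite fBl fBr fe_dg f_dg_f !mul1r !subrr. Qed.

(** The frame and its orthogonal complement span the space. *)
Lemma frame_ext (V : vectType F) (g1 g2 : 'Hom(U, V)) :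
  (forall i, g1 (e i) = g2 (e i)) -> (forall i, g1 (f i) = g2 (f i)) ->
  (forall x, perp B e f x -> g1 x = g2 x) -> g1 = g2.
Proof.
move=> h1 h2 h3; apply/lfunP => x.
rewrite -[x](subrK (dg (fun=> 1) (fun=> 1) x)) [LHS]linearD [RHS]linearD /=.
rewrite h3; last exact: perp_sub.
congr (_ + _); rewrite dgE !linearD !linear_sum /=.
by congr (_ + _); apply: eq_bigr => i _; rewrite [LHS]linearZ [RHS]linearZ /= ?h1 ?h2.
Qed.

Lemma perpC x : perp B e f x ->
  forall i, [/\ B (e i) x = 0, B x (e i) = 0, B (f i) x = 0 & B x (f i) = 0].
Proof. by move=> px i; have [h1 h2] := px i; split=> //; apply: f_eq0C. Qed.

(** Nondegeneracy, tested on the frame and on its complement separately. *)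
Lemma frame_eq0 x : (forall i, B x (e i) = 0) -> (forall i, B x (f i) = 0) ->
  (forall y, perp B e f y -> B x y = 0) -> x = 0.
Proof.
move=> h1 h2 h3; apply: (form_nondeg HB) => y.
rewrite -[y](subrK (dg (fun=> 1) (fun=> 1) y)) fDr h3; last exact: perp_sub.
rewrite add0r dgE fDr !fsumr !big1 ?addr0 // => i _; rewrite fZr.
  by rewrite h2 mulr0.
by rewrite h1 mulr0.
Qed.

Lemma tor_e t i : tor B e f t (e i) = t i *: e i.
Proof. by rewrite /tor add_lfunE id_lfunE dg_e scalerBl scale1r addrC subrK. Qed.
Lemma tor_f t i : tor B e f t (f i) = (t i)^-1 *: f i.
Proof. by rewrite /tor add_lfunE id_lfunE dg_f scalerBl scale1r addrC subrK. Qed.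
Lemma tor_perp t x : perp B e f x -> tor B e f t x = x.
Proof. by move=> px; rewrite /tor add_lfunE id_lfunE dg_perp // addr0. Qed.

Lemma dg_comp a b a' b' : (dg a b \o dg a' b')%VF =
  dg (fun i => a i * a' i) (fun i => b i * b' i).
Proof.
apply: frame_ext => [i|i|x px]; rewrite comp_lfunE.
- by rewrite !dg_e linearZ /= dg_e scalerA mulrC.
- by rewrite !dg_f linearZ /= dg_f scalerA mulrC.
by rewrite ![dg _ _ x]dg_perp // linear0.
Qed.

Lemma torM s t : tor B e f (fun i => s i * t i) = (tor B e f s \o tor B e f t)%VF.
Proof.
apply: frame_ext => [i|i|x px]; rewrite comp_lfunE.
- by rewrite !tor_e linearZ /= tor_e scalerA mulrC.
- by rewrite !tor_f linearZ /= tor_f scalerA invfM mulrC.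
by rewrite !tor_perp.
Qed.

(** The adjoint of tor t is tor t^-1: passing to the adjoint exchanges the eigenvalues
    on e i and f i. *)
Lemma tor_isom t : (forall i, t i != 0) ->
  forall x y, B (tor B e f t x) (tor B e f t y) = B x y.
Proof.
move=> t0.
have adj x y : B (tor B e f t x) y = B x (tor B e f (fun i => (t i)^-1) y).
  rewrite /tor !add_lfunE !id_lfunE !dgE !fDl !fDr; congr (_ + _).
  rewrite addrC !fsuml !fsumr; congr (_ + _); apply: eq_bigr => i _; rewrite fZl fZr.
    by rewrite -!mulrA (mulrC (B (e i) x)) [B (f i) y]fC [B x (e i)]fC; ring.
  by rewrite invrK; ring.
move=> x y; rewrite adj -comp_lfunE -torM; congr (B _ _).
rewrite (_ : tor _ _ _ _ = \1%VF) ?id_lfunE //.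
apply: frame_ext => [i|i|z pz]; rewrite id_lfunE.
- by rewrite tor_e /= mulVf // scale1r.
- by rewrite tor_f /= mulVf // invr1 scale1r.
by rewrite tor_perp.
Qed.

Definition frseq := [seq (if u.2 then e u.1 else f u.1) | u <- enum {: I * bool}].

Lemma frseq_free : free frseq.
Proof.
apply: (free_dual (phi := fun (u : I * bool) x => if u.2 then B x (f u.1) else B (e u.1) x)).
  by move=> [i []] c x y /=; rewrite ?fDl ?fDr ?fZl ?fZr.
move=> [i []] [j []] /=; rewrite ?(fr_ee He) ?(fr_ff He) ?(fr_ef He) xpair_eqE /= ?andbT ?andbF //.
by rewrite eq_sym.
Qed.

Lemma size_frseq : size frseq = (#|I|.*2)%N.
Proof. by rewrite size_map -cardE card_prod card_bool muln2. Qed.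

Lemma mem_frseq_e i : e i \in frseq.
Proof. by apply/mapP; exists (i, true); rewrite ?mem_enum. Qed.
Lemma mem_frseq_f i : f i \in frseq.
Proof. by apply/mapP; exists (i, false); rewrite ?mem_enum. Qed.

Lemma dim_span_frseq : \dim <<frseq>>%VS = (#|I|.*2)%N.
Proof. by rewrite (eqP frseq_free) size_frseq. Qed.

Lemma dg_span a b x : dg a b x \in <<frseq>>%VS.
Proof.
rewrite dgE rpredD // rpred_sum // => i _; rewrite rpredZ // memv_span //.
  exact: mem_frseq_e.
exact: mem_frseq_f.
Qed.

Lemma tor_sub1 t : (tor B e f t - \1)%VF =
  dg (fun i => t i - 1) (fun i => (t i)^-1 - 1).
Proof. by rewrite /tor addrC addKr. Qed.

Lemma tor_rank t : (\dim (limg (tor B e f t - \1)%VF%R) <= #|I|.*2)%N.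
Proof.
rewrite -dim_span_frseq dimvS //; apply/subvP => _ /memv_imgP [x _ ->].
by rewrite tor_sub1 dg_span.
Qed.

Lemma tor_limg t : (forall i, t i != 1) ->
  limg (tor B e f t - \1)%VF = <<frseq>>%VS.
Proof.
move=> t1; apply/eqP; rewrite eqEsubv; apply/andP; split.
  apply/subvP => _ /memv_imgP [x _ ->].
  by rewrite tor_sub1 dg_span.
apply/span_subvP => _ /mapP [[i []] _ ->] /=.
  apply/memv_imgP; exists ((t i - 1)^-1 *: e i); first exact: memvf.
  by rewrite tor_sub1 linearZ /= dg_e scalerA mulVf ?scale1r // subr_eq0.
apply/memv_imgP; exists (((t i)^-1 - 1)^-1 *: f i); first exact: memvf.
rewrite tor_sub1 linearZ /= dg_f scalerA mulVf ?scale1r // subr_eq0.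
by rewrite invr_eq1.
Qed.

(** With no t i equal to 1, the coordinates of x - tor t x on the frame vanish only if
    those of x do. *)
Lemma perp_fixed t x : (forall i, t i != 1) -> tor B e f t x = x -> perp B e f x.
Proof.
move=> t1 tx i.
have h : dg (fun i => t i - 1) (fun i => (t i)^-1 - 1) x = 0.
  by rewrite -tor_sub1 add_lfunE opp_lfunE id_lfunE tx subrr.
split.
  have := congr1 (B (e i)) h; rewrite f0r fe_dg => /eqP.
  by rewrite mulf_eq0 subr_eq0 invr_eq1 (negbTE (t1 i)) => /eqP.
have := congr1 (B^~ (f i)) h; rewrite f0l f_dg_f => /eqP.
by rewrite mulf_eq0 subr_eq0 (negbTE (t1 i)) => /eqP.
Qed.

End Frame.
End Form.

(** * Adjoints, and Witt's theorem for frames *)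

(** The Riesz representation: a pairing that is nondegenerate on one side, between
    spaces of equal dimension, identifies U1 with the dual of U2. All adjoints below
    come from this. *)
Lemma pairing_adj (F : fieldType) (C U1 U2 : vectType F)
    (p : U1 -> U2 -> F) (q : C -> U2 -> F) :
  (forall y, linear_for *%R (p^~ y)) -> (forall x, linear_for *%R (p x)) ->
  (forall y, linear_for *%R (q^~ y)) -> (forall x, linear_for *%R (q x)) ->
  (forall x, (forall y, p x y = 0) -> x = 0) -> \dim {:U1} = \dim {:U2} ->
  exists g : 'Hom(C, U1), forall c y, p (g c) y = q c y.
Proof.
move=> pl pr ql qr pnd dimE.
have mkE (D : vectType F) (s : D -> U2 -> F) : (forall y, linear_for *%R (s^~ y)) ->
    (forall x, linear_for *%R (s x)) ->
  exists L : 'Hom(D, 'Hom(U2, F^o)), forall x y, L x y = s x y.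
  move=> sl sr.
  have sE x y : (linfun (s x : U2 -> F^o)) y = s x y by apply: linfun_linE; apply: sr.
  exists (linfun (fun x => linfun (s x : U2 -> F^o))) => x y.
  rewrite linfun_linE ?sE // => a u v; apply/lfunP => z.
  by rewrite add_lfunE scale_lfunE !sE sl.
have [L LE] := mkE U1 p pl pr; have [M ME] := mkE C q ql qr.
have Linj : lker L == 0%VS.
  apply/lker0P => x x' /lfunP Lxx'; apply/subr0_eq/pnd => y.
  have [g gE] : exists g : {linear U1 -> F^o}, forall x, g x = p x y.
    pose g0 : {linear U1 -> F^o} := HB.pack (p^~ y : U1 -> F^o)
      (GRing.isLinear.Build _ _ _ _ (p^~ y : U1 -> F^o) (pl y)).
    by exists g0.
  by rewrite -gE linearB /= !gE -!LE Lxx' subrr.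
have Lfull : limg L = fullv.
  apply/eqP; rewrite eqEdim subvf /= limg_dim_eq ?(eqP Linj) ?capv0 //.
  by rewrite dimE !dimvf /= /dim /= muln1.
exists (L^-1 \o M)%VF => c y; rewrite comp_lfunE -LE limg_lfunVK ?ME // Lfull.
exact: memvf.
Qed.

Section Witt.
Variables (K : closedFieldType) (U : vectType K) (eps : bool) (B : U -> U -> K).
Hypothesis HB : isform eps B.
Hypothesis two : 2%:R != 0 :> K.
Local Notation sg := ((-1) ^+ eps : K).

Lemma closed_sqrt (a : K) : exists z, z * z = a.
Proof.
have [z] := @solve_monicpoly K 2 (fun i => if i == 0%N then a else 0) isT.
by rewrite big_ord_recl big_ord1 /= mulr1 mul0r addr0 expr2 => <-; exists z.
Qed.

Definition pspace (I : finType) (e f : I -> U) : {vspace U} :=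
  lker (dgf B e f (fun=> 1) (fun=> 1)).

Section OneFrame.
Variables (I : finType) (e f : I -> U).
Hypothesis He : frame B e f.

Lemma mem_pspace x : reflect (perp B e f x) (x \in pspace e f).
Proof.
rewrite memv_ker; apply: (iffP eqP) => [h|px]; last by rewrite (dg_perp HB).
by move: (perp_sub HB He x); rewrite h subr0.
Qed.

Lemma limg_dg1 : limg (dgf B e f (fun=> 1) (fun=> 1)) = <<frseq e f>>%VS.
Proof.
apply/eqP; rewrite eqEsubv; apply/andP; split.
  by apply/subvP => _ /memv_imgP [x _ ->]; apply: (dg_span HB).
apply/span_subvP => _ /mapP [[i []] _ ->] /=; apply/memv_imgP.
  by exists (e i); rewrite ?memvf // (dg_e HB He) scale1r.
by exists (f i); rewrite ?memvf // (dg_f HB He) scale1r.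
Qed.

Lemma dim_pspace : (\dim (pspace e f) + #|I|.*2 = \dim {:U})%N.
Proof.
rewrite -(dim_span_frseq HB He) -limg_dg1.
by have := limg_ker_dim (dgf B e f (fun=> 1) (fun=> 1)) fullv; rewrite capfv.
Qed.

Lemma perp_nondeg x : perp B e f x -> (forall y, perp B e f y -> B x y = 0) -> x = 0.
Proof.
by move=> px h; apply: (frame_eq0 HB He) => // i; have [] := perpC HB px i.
Qed.

Lemma perp_nz x : perp B e f x -> x != 0 -> exists2 y, perp B e f y & B x y = 1.
Proof.
move=> px x0.
have [h|h] := pselect (exists2 y, perp B e f y & B x y != 0).
  have [y py xy] := h; exists ((B x y)^-1 *: y); last by rewrite (fZr HB) mulVf.
  by move=> i; have [h1 h2] := py i; rewrite (fZr HB) (fZl HB) h1 h2 !mulr0.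
exfalso; move/eqP: x0; apply; apply: perp_nondeg => // y py.
by apply/eqP; apply: contrapT => /negP xy; apply: h; exists y.
Qed.

Lemma perp_lin a x y : perp B e f x -> perp B e f y -> perp B e f (a *: x + y).
Proof.
move=> px py i; have [h1 h2] := px i; have [h3 h4] := py i.
by rewrite (fDl HB) (fDr HB) (fZl HB) (fZr HB) h1 h2 h3 h4 mulr0 addr0.
Qed.

(** Over an algebraically closed field a form on a plane has an isotropic vector: solve
    a quadratic equation. A vector pairing to 1 with it is then made isotropic. *)
Lemma hyperbolic_pair : (#|I|.*2 + 2 <= \dim {:U})%N ->
  exists u v, [/\ perp B e f u, perp B e f v, B u u = 0, B v v = 0 & B u v = 1].
Proof.
rewrite -dim_pspace addnC leq_add2r => d2.
have : exists u, [/\ perp B e f u, u != 0 & B u u = 0].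
  have fr := basis_free (vbasisP (pspace e f)).
  have inb0 : {subset (vbasis (pspace e f) : seq U) <= pspace e f}.
    by move=> v; apply: vbasis_mem.
  move: fr inb0 (size_tuple (vbasis (pspace e f))).
  case: (tval (vbasis _)) => [|x [|y s]] /= fr inb sz; try by rewrite -sz in d2.
  have px : perp B e f x by apply/mem_pspace/inb; rewrite mem_head.
  have py : perp B e f y by apply/mem_pspace/inb; rewrite !inE eqxx orbT.
  have y0 : y != 0 by apply: (free_not0 fr); rewrite !inE eqxx orbT.
  have [yy|yy] := eqVneq (B y y) 0; first by exists y.
  have ne : eps = false by apply/negbTE/negP => /(alt0 HB two y)/eqP; rewrite (negbTE yy).
  (* The discriminant of s |-> B (s y + x) (s y + x). *)
  have [z zz] := closed_sqrt (B x y * B x y - B x x * B y y).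
  exists (((z - B x y) / B y y) *: y + x); split; first exact: perp_lin.
    apply/eqP => /eqP; rewrite addrC addr_eq0 => /eqP xy.
    move: fr; rewrite free_cons => /andP [] /negP h _; apply: h.
    by rewrite xy -scaleNr memvZ // memv_span // mem_head.
  have yx : B y x = B x y by rewrite (fC HB) ne mul1r.
  rewrite (fDl HB) !(fDr HB) !(fZl HB) !(fZr HB) yx.
  apply: (mulIf yy); rewrite mul0r.
  have -> : ((z - B x y) / B y y * ((z - B x y) / B y y * B y y) +
     (z - B x y) / B y y * B x y + ((z - B x y) / B y y * B x y + B x x)) * B y y =
     z * z - (B x y * B x y - B x x * B y y) by field.
  by rewrite zz subrr.
move=> [u [pu u0 uu]]; have [y py uy] := perp_nz pu u0.
(* In the symmetric case this choice makes the second vector isotropic; in the antisymmetric case B y y = 0. *)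
exists u, (- (B y y / 2%:R) *: u + y); split=> //; first exact: perp_lin.
  rewrite (fDl HB) !(fDr HB) !(fZl HB) !(fZr HB) uu uy (fC HB y u) uy.
  case: (boolP eps) => he; last by rewrite /= expr0; field.
  by rewrite (alt0 HB two) // !mul0r oppr0 !mul0r !addr0.
by rewrite (fDr HB) (fZr HB) uu uy mulr0 add0r.
Qed.

(** One more index, so that frames can be extended without arithmetic on ordinals. *)
Definition oext (u : U) (w : I -> U) (o : option I) := if o is Some i then w i else u.

Lemma frame_oext u v : perp B e f u -> perp B e f v -> B u u = 0 -> B v v = 0 ->
  B u v = 1 -> frame B (oext u e) (oext v f).
Proof.
move=> pu pv uu vv uv.
split=> [] [i|] [j|] //=; rewrite ?(fr_ee He) ?(fr_ff He) ?(fr_ef He) //.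
- by have [] := perpC HB pu i.
- by have [] := perpC HB pu j.
- by have [] := perpC HB pv i.
- by have [] := perpC HB pv j.
- by have [] := perpC HB pv i.
by have [] := perpC HB pu j.
Qed.

(** When no further hyperbolic pair exists the complement has dimension at most 1; the
    square roots in K normalize a generator z. In dimension 0 the witness is z = 0. *)
Lemma frame_last : (\dim {:U} <= #|I|.*2 + 1)%N ->
  exists z, [/\ perp B e f z, B z z = (\dim (pspace e f))%:R &
    forall x, perp B e f x -> x = B x z *: z].
Proof.
rewrite -dim_pspace addnC leq_add2l => d1.
have [d0|dn0] := eqVneq (\dim (pspace e f)) 0%N.
  have z0 x : perp B e f x -> x = 0.
    move/mem_pspace; have/eqP := d0; rewrite dimv_eq0 => /eqP ->.
    by rewrite memv0 => /eqP.
  exists 0; split; first by move=> i; rewrite (f0l HB) (f0r HB).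
    by rewrite (f0l HB) d0.
  by move=> x /z0 ->; rewrite scaler0.
have dE : \dim (pspace e f) = 1%N by case: (\dim _) d1 dn0 => [|[]].
have : exists2 z, z \in pspace e f & z != 0.
  exists (vpick (pspace e f)); first exact: memv_pick.
  by rewrite vpick0 -dimv_eq0 dE.
move=> [z /mem_pspace pz z0].
have sp x : perp B e f x -> exists c, x = c *: z.
  move/mem_pspace => xE; apply/vlineP; rewrite (_ : <[z]>%VS = pspace e f) //.
  by apply/eqP; rewrite eqEdim dim_vline z0 dE andbT -memvE; apply/mem_pspace.
have zz : B z z != 0.
  have [y py zy] := perp_nz pz z0; have [c yE] := sp _ py.
  by apply/eqP => zz0; move/eqP: zy; rewrite yE (fZr HB) zz0 mulr0 eq_sym oner_eq0.
have [s ss] := closed_sqrt (B z z)^-1.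
have s0 : s != 0 by apply/eqP => s0; move/eqP: ss; rewrite s0 mul0r eq_sym invr_eq0 (negbTE zz).
exists (s *: z); split.
- by rewrite -[s *: z]addr0; apply: perp_lin => // i; rewrite (f0l HB) (f0r HB).
- by rewrite (fZl HB) (fZr HB) mulrA ss mulVf // dE.
move=> x /sp [c ->]; rewrite (fZr HB) (fZl HB) !scalerA; congr (_ *: _).
transitivity (s * s * B z z * c); last by ring.
by rewrite ss mulVf // mul1r.
Qed.

Lemma form_expand (a b a' b' : I -> K) z c c' : perp B e f z ->
  B (\sum_i a i *: e i + \sum_i b i *: f i + c *: z)
    (\sum_i a' i *: e i + \sum_i b' i *: f i + c' *: z) =
  \sum_i a i * b' i + sg * (\sum_i b i * a' i) + c * c' * B z z.
Proof.
move=> pz.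
have E d d' i : B (\sum_j d j *: e j + \sum_j d' j *: f j) (e i) = sg * d' i.
  rewrite (fDl HB) !(fsuml HB) big1 ?add0r => [|j _]; last by rewrite (fZl HB) (fr_ee He) mulr0.
  rewrite (bigD1 i) //= big1 ?addr0 => [|j ne]; rewrite (fZl HB) (fr_fe HB He).
    by rewrite eqxx mulr1 mulrC.
  by rewrite eq_sym (negbTE ne) !mulr0.
have E' d d' i : B (\sum_j d j *: e j + \sum_j d' j *: f j) (f i) = d i.
  rewrite (fDl HB) !(fsuml HB) addrC big1 ?add0r => [|j _]; last by rewrite (fZl HB) (fr_ff He) mulr0.
  rewrite (bigD1 i) //= big1 ?addr0 => [|j ne]; rewrite (fZl HB) (fr_ef He).
    by rewrite eqxx mulr1.
  by rewrite (negbTE ne) mulr0.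
have P d d' : B (\sum_j d j *: e j + \sum_j d' j *: f j) z = 0.
  rewrite (fDl HB) !(fsuml HB) !big1 ?addr0 // => i _; rewrite (fZl HB); have [h1 h2 h3 h4] := perpC HB pz i.
    by rewrite h3 mulr0.
  by rewrite h1 mulr0.
rewrite (fDr HB) (fZr HB) (fDl HB _ _ z) P (fZl HB) add0r mulrCA mulrA; congr (_ + _).
rewrite (fDl HB) (fZl HB) [B z _](fC HB) P !mulr0 addr0.
rewrite (fDr HB) !(fsumr HB) addrC mulr_sumr; congr (_ + _); apply: eq_bigr => i _; rewrite (fZr HB).
  by rewrite E' mulrC.
by rewrite E mulrC mulrA.
Qed.

End OneFrame.

(** Both frames are extended by hyperbolic pairs until the complements have dimension at
    most 1; there the isometry is given by coordinates. *)
Theorem witt (I : finType) (e f e' f' : I -> U) : frame B e f -> frame B e' f' ->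
  exists g : 'End(U), [/\ forall x y, B (g x) (g y) = B x y,
    forall i, g (e i) = e' i & forall i, g (f i) = f' i].
Proof.
have [m] := ubnP (\dim {:U} - #|I|.*2)%N.
elim: m I e f e' f' => [//|m IHm] I e f e' f' dm He He'.
have [d|d] := leqP (\dim {:U}) (#|I|.*2 + 1); last first.
  have d2 : (#|I|.*2 + 2 <= \dim {:U})%N by rewrite addn2 -addn1.
  have [u [v [pu pv uu vv uv]]] := hyperbolic_pair He d2.
  have [u' [v' [pu' pv' uu' vv' uv']]] := hyperbolic_pair He' d2.
  have [|g [ig ge gf]] := IHm _ _ _ _ _ _ (frame_oext He pu pv uu vv uv)
    (frame_oext He' pu' pv' uu' vv' uv').
    rewrite card_option doubleS; apply: leq_trans (_ : _ <= (\dim {:U} - #|I|.*2))%N _ => //.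
    by rewrite -[X in (_ - X)%N]addn2 subnDA ltn_subrL /= subn_gt0 (leq_trans _ d2) // addn2.
  by exists g; split=> // i; [apply: (ge (Some i))|apply: (gf (Some i))].
have [z [pz zz zx]] := frame_last He d.
have [z' [pz' zz' _]] := frame_last He' d.
have lg (w w' : I -> U) y : linear (fun x => \sum_i B x (f i) *: w i + \sum_i B (e i) x *: w' i + B x z *: y).
  move=> c u v /=; rewrite scalerDr scalerDr !scaler_sumr addrACA; congr (_ + _); last first.
    by rewrite (form_linl HB) scalerDl scalerA.
  rewrite addrACA -!big_split /=; apply: eq_bigr => i _.
  by rewrite (form_linl HB) (fDr HB) (fZr HB) !scalerDl !scalerA.
have idE x : x = \sum_i B x (f i) *: e i + \sum_i B (e i) x *: f i + B x z *: z.
  rewrite -{1}[x](subrK (dgf B e f (fun=> 1) (fun=> 1) x)) addrC; congr (_ + _).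
    by rewrite (dgE HB); congr (_ + _); apply: eq_bigr => i _; rewrite mul1r.
  rewrite [LHS]zx; last exact: (perp_sub HB He).
  rewrite (fBl HB) (dgE HB) (fDl HB) !(fsuml HB) !big1 ?addr0 ?subr0 // => i _; rewrite (fZl HB);
    have [h1 h2 h3 h4] := perpC HB pz i.
    by rewrite h3 mulr0.
  by rewrite h1 mulr0.
exists (linfun (fun x => \sum_i B x (f i) *: e' i + \sum_i B (e i) x *: f' i + B x z *: z')); split.
- move=> x y; rewrite !linfun_linE; [|exact: lg..].
  rewrite (form_expand He' _ _ _ _ _ _ pz') [X in _ = B X _]idE [X in _ = B _ X]idE (form_expand He _ _ _ _ _ _ pz).
  rewrite zz zz'; congr (_ + _ * _%:R).
  by apply/eqP; rewrite -(eqn_add2r #|I|.*2) !(dim_pspace He, dim_pspace He').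
- move=> i; rewrite linfun_linE; last exact: lg.
  have [h1 h2 h3 h4] := perpC HB pz i.
  rewrite h1 scale0r addr0 (bigD1 i) //= [X in _ + X]big1 ?addr0 => [|j _]; last first.
    by rewrite (fr_ee He) scale0r.
  rewrite (fr_ef He) eqxx scale1r big1 ?addr0 // => j ne.
  by rewrite (fr_ef He) eq_sym (negbTE ne) scale0r.
move=> i; rewrite linfun_linE; last exact: lg.
have [h1 h2 h3 h4] := perpC HB pz i.
rewrite h3 scale0r addr0 big1 ?add0r => [|j _]; last first.
  by rewrite (fr_ff He) scale0r.
rewrite (bigD1 i) //= (fr_ef He) eqxx scale1r big1 ?addr0 // => j ne.
by rewrite (fr_ef He) (negbTE ne) scale0r.
Qed.

End Witt.

(** * Characters of GL_1^r *)

Section Characters.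
Variables (K : closedFieldType) (r : nat).
Implicit Types (x y : 'rV[int]_r) (s t : 'I_r -> K).

Definition chi x t : K := \prod_i t i ^ x 0 i.

Lemma chiD x y t : Gm t -> chi (x + y) t = chi x t * chi y t.
Proof. by move=> t0; rewrite /chi -big_split; apply: eq_bigr => i _; rewrite mxE expfzDr. Qed.
Lemma chi0 t : chi 0 t = 1.
Proof. by rewrite /chi big1 // => i _; rewrite mxE expr0z. Qed.
Lemma chiM x s t : chi x (fun i => s i * t i) = chi x s * chi x t.
Proof. by rewrite /chi -big_split; apply: eq_bigr => i _; rewrite expfzMl. Qed.
Lemma chi_neq0 x t : Gm t -> chi x t != 0.
Proof. by move=> t0; apply/prodf_neq0 => i _; rewrite expfz_neq0. Qed.
Lemma chiN x t : Gm t -> chi (- x) t = (chi x t)^-1.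
Proof.
move=> t0; apply: (mulfI (chi_neq0 x t0)).
by rewrite -chiD // subrr chi0 mulfV // chi_neq0.
Qed.
Lemma GmM s t : Gm s -> Gm t -> @Gm K r (fun i => s i * t i).
Proof. by move=> s0 t0 i; rewrite mulf_neq0. Qed.
Lemma Gm1 : @Gm K r (fun=> 1).
Proof. by move=> i; rewrite oner_neq0. Qed.
Lemma chi_one x : chi x (fun=> 1) = 1.
Proof. by rewrite /chi big1 // => i _; rewrite exp1rz. Qed.

End Characters.

Section Infinite.
Variable K : closedFieldType.

(** An algebraically closed field is infinite, so X (X^n - 1) has a nonroot. *)
Lemma nonroot_unity (a : int) : a != 0 -> exists2 z : K, z != 0 & z ^ a != 1.
Proof.
move=> a0.
have n0 : (0 < `|a|)%N by rewrite absz_gt0.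
have p0 : ('X * ('X^`|a| - 1) : {poly K}) != 0.
  by rewrite mulf_neq0 ?polyX_eq0 // -size_poly_eq0 size_XnsubC.
have /closed_nonrootP [z] := p0; rewrite /root hornerM hornerX hornerD hornerXn hornerN hornerC.
rewrite mulf_eq0 negb_or subr_eq0 => /andP [z0 z1]; exists z => //.
by case: a z1 {a0 n0 p0} => n; rewrite ?NegzE ?absz_nat ?abszN //= -exprnN invr_eq1.
Qed.
End Infinite.

Section Independence.
Variables (K : closedFieldType) (r : nat).
Implicit Types (x y : 'rV[int]_r) (s t : 'I_r -> K).

Lemma chi_sep x : x != 0 -> exists2 t : 'I_r -> K, Gm t & chi x t != 1.
Proof.
case/rV0Pn => i xi; have [z z0 z1] := nonroot_unity K xi.
exists (fun j => if j == i then z else 1) => [j|].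
  by case: ifP => _ //; rewrite oner_neq0.
rewrite /chi (bigD1 i) //= eqxx big1 ?mulr1 // => j /negbTE ->.
by rewrite exp1rz.
Qed.

(** Independence of characters, for coefficients in any vector space: Artin's argument,
    comparing the relation with its translate by s. *)
Lemma chi_indep (V : lmodType K) (L : seq 'rV[int]_r) (a : 'rV[int]_r -> V) :
  uniq L -> (forall t : 'I_r -> K, Gm t -> \sum_(x <- L) chi x t *: a x = 0) ->
  forall x, x \in L -> a x = 0.
Proof.
elim: L a => [//|y L IH] a /= /andP [yL uL] h.
have aL x : x \in L -> a x = 0.
  move=> xL; have xy : x - y != 0 by rewrite subr_eq0; apply: contraNneq yL => <-.
  have [s s0 sxy] := chi_sep xy.
  have := IH (fun z => (chi z s - chi y s) *: a z) uL _ x xL.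
  case/(_ _)/Wrap => [t t0|].
    have := h _ (GmM s0 t0); have := h _ t0.
    rewrite !big_cons => /eqP; rewrite addr_eq0 => /eqP h1 /eqP.
    rewrite chiM -scalerA h1 scalerN addrC subr_eq0 => /eqP h2.
    under eq_bigr do rewrite scalerA mulrC mulrBl scalerBl.
    rewrite sumrB -[X in _ = X](subrr (chi y s *: \sum_(j <- L) chi j t *: a j)); congr (_ - _).
      by rewrite -h2; apply: eq_bigr => z _; rewrite chiM.
    by rewrite scaler_sumr; apply: eq_bigr => z _; rewrite scalerA.
  move/eqP; rewrite scaler_eq0 subr_eq0 => /orP [/eqP e|/eqP //].
  move: sxy; rewrite chiD // chiN // e mulfV ?eqxx //.
  exact: chi_neq0.
move=> x; rewrite inE => /orP [/eqP ->|/aL //].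
have := h _ (@Gm1 K r); rewrite big_cons chi_one scale1r big_seq big1 ?addr0 // => z zL.
by rewrite aL // scaler0.
Qed.

(** Monomials are distinct characters. *)
Lemma mpoly_nonroot (p : {mpoly K[r]}) : p != 0 -> exists2 v, Gm v & p.@[v] != 0.
Proof.
move=> p0; apply: contrapT => h.
pose ch (m : 'X_{1..r}) : 'rV[int]_r := \row_i (m i : int).
have chI : injective ch.
  by move=> m m' /rowP e; apply/mnmP => i; have := e i; rewrite !mxE => -[].
pose a (x : 'rV[int]_r) : K^o := p@_[multinom `|x 0%R i|%N | i < r].
have aE m : a (ch m) = p@_m.
  by congr (p@_ _); apply/mnmP => i; rewrite mnmE mxE.
have uL : uniq (map ch (msupp p)) by rewrite (map_inj_uniq chI) msupp_uniq.
case/negP: p0; apply/eqP/mpolyP => m; rewrite mcoeff0.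
have [mp|/memN_msupp_eq0 //] := boolP (m \in msupp p).
rewrite -aE; apply: (@chi_indep K^o _ a uL); last exact: map_f.
move=> t t0.
apply/eqP/negP => /negP pt; apply: h; exists t => //; apply: contraNneq pt => pt.
rewrite big_map -[X in _ == X]pt mevalE; apply/eqP; apply: eq_bigr => m' _.
rewrite aE mulrC; congr (_ * _); apply: eq_bigr => i _.
by rewrite mxE.
Qed.

(** A product of nonzero differences of monomials is a nonzero polynomial. *)
Lemma chi_generic (L : seq 'rV[int]_r) : 0 \notin L ->
  exists2 t : 'I_r -> K, Gm t & forall x, x \in L -> chi x t != 1.
Proof.
move=> L0.
pose q (x : 'rV[int]_r) : {mpoly K[r]} :=
  'X_[ [multinom (if (0 <= x 0%R i)%R then `|x 0%R i|%N else 0%N) | i < r]] -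
  'X_[ [multinom (if (0 <= x 0%R i)%R then 0%N else `|x 0%R i|%N) | i < r]].
have q0 x : x \in L -> q x != 0.
  move=> xL; apply/eqP => e; have x0 : x != 0 by apply: contraNneq L0 => <-.
  case/rV0Pn: x0 => i xi.
  move/eqP: e; rewrite subr_eq0 => /eqP /(congr1 (mcoeff [multinom (if (0 <= x 0%R j)%R then `|x 0%R j|%N else 0%N) | j < r])).
  rewrite !mcoeffX eqxx; case: eqP => [/mnmP /(_ i)|_ /eqP]; last by rewrite oner_eq0.
  by rewrite !mnmE; case: ifP => _ /eqP; rewrite ?[0%N == _]eq_sym absz_eq0 (negbTE xi).
have p0 : \prod_(x <- L) q x != 0.
  by rewrite prodf_seq_neq0; apply/allP => x /q0 ->.
have [t t0 pt] := mpoly_nonroot p0; exists t => // x xL.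
apply: contraNneq pt => cx.
rewrite (big_rem x xL) /= mevalM mevalB !mevalX -[X in _ == X](mul0r (\prod_(y <- rem x L) q y).@[t]).
apply/eqP; congr (_ * _); apply/eqP; rewrite subr_eq0; apply/eqP.
have n0 : \prod_i t i ^+ [multinom (if (0 <= x 0%R i)%R then 0%N else `|x 0%R i|%N) | i < r] i != 0.
  by apply/prodf_neq0 => i _; rewrite expf_neq0.
apply: (mulIf (invr_neq0 n0)); rewrite mulfV // -[RHS]cx /chi -prodfV -big_split /=.
apply: eq_bigr => i _; rewrite !mnmE; case: (x 0 i) => n.
  by rewrite /= expr0 invr1 mulr1.
by rewrite NegzE /= expr0 mul1r exprnN.
Qed.

End Independence.

(** * Tori of small rank are frame tori *)

Section Laurent.
Variables (K : closedFieldType) (r : nat).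

(** Vector-valued Laurent polynomials on GL_1^r with exponents in M. Keeping track of M
    is what later shows that the weights generate the lattice. *)
Definition laurent (M : 'rV[int]_r -> Prop) (V : lmodType K) (g : ('I_r -> K) -> V) :=
  exists2 s : seq ('rV[int]_r * V), (forall u, u \in s -> M u.1) &
    forall t, Gm t -> g t = \sum_(u <- s) chi u.1 t *: u.2.

Variable M : 'rV[int]_r -> Prop.
Hypothesis M0 : M 0.
Hypothesis MD : forall x y, M x -> M y -> M (x + y).

Lemma eq_laurent (V : lmodType K) (g h : _ -> V) :
  (forall t, Gm t -> g t = h t) -> laurent M g -> laurent M h.
Proof. by move=> e [s sM sE]; exists s => // t t0; rewrite -e // sE. Qed.

Lemma laurent_sum (V : lmodType K) (J : Type) (l : seq J) (g : J -> ('I_r -> K) -> V) :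
  (forall j, laurent M (g j)) -> laurent M (fun t => \sum_(j <- l) g j t).
Proof.
move=> gM; elim: l => [|j l [s sM sE]].
  by exists [::] => // t _; rewrite !big_nil.
have [s' sM' sE'] := gM j; exists (s' ++ s) => [u|t t0].
  by rewrite mem_cat => /orP [/sM'|/sM].
by rewrite big_cons big_cat sE' // sE.
Qed.

Lemma laurentZ (V : lmodType K) (g : ('I_r -> K) -> K^o) (v : V) :
  laurent M g -> laurent M (fun t => (g t : K) *: v).
Proof.
move=> [s sM sE]; exists [seq (u.1, (u.2 : K) *: v) | u <- s].
  by move=> _ /mapP [u us ->]; apply: sM.
move=> t t0; rewrite sE // big_map scaler_suml; apply: eq_bigr => u _ /=.
by rewrite scalerA.
Qed.

Lemma laurentM (g h : ('I_r -> K) -> K^o) :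
  laurent M g -> laurent M h -> laurent M (fun t => (g t * h t : K) : K^o).
Proof.
move=> [s sM sE] [s' sM' sE'].
apply: (@eq_laurent _ (fun t => \sum_(u <- s) \sum_(v <- s') chi (u.1 + v.1) t *: ((u.2 * v.2 : K) : K^o))).
  move=> t t0; rewrite sE // sE' // mulr_suml; apply: eq_bigr => u _.
  rewrite mulr_sumr; apply: eq_bigr => v _; rewrite chiD // /GRing.scale /=.
  by ring.
exists [seq (u.1 + v.1, (u.2 * v.2 : K) : K^o) | u <- s, v <- s'].
  by move=> _ /allpairsP [[u v] /= [us vs ->]]; apply: MD; [apply: sM|apply: sM'].
by move=> t t0; rewrite big_allpairs_dep.
Qed.

Lemma laurentC (c : K) : laurent M (fun=> c : K^o).
Proof.
exists [:: (0, c : K^o)] => [u|t t0]; first by rewrite inE => /eqP ->.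
by rewrite big_seq1 chi0 scale1r.
Qed.

Lemma laurent_chi x : M x -> laurent M (@chi K r x : _ -> K^o).
Proof.
move=> Mx; exists [:: (x, 1 : K^o)] => [u|t t0]; first by rewrite inE => /eqP ->.
by rewrite big_seq1 /GRing.scale /= mulr1.
Qed.

Lemma laurent_prod (J : Type) (l : seq J) (g : J -> ('I_r -> K) -> K) :
  (forall j, laurent M (g j : _ -> K^o)) ->
  laurent M (fun t => (\prod_(j <- l) g j t) : K^o).
Proof.
move=> gM; elim: l => [|j l IH].
  by apply: eq_laurent (laurentC 1) => t _; rewrite big_nil.
by apply: eq_laurent (laurentM (gM j) IH) => t _; rewrite big_cons.
Qed.

Lemma laurentX (g : ('I_r -> K) -> K) n :
  laurent M (g : _ -> K^o) -> laurent M (fun t => (g t ^+ n) : K^o).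
Proof.
move=> gM; elim: n => [|n IH]; first by apply: laurentC.
by apply: eq_laurent (laurentM gM IH) => t _; rewrite exprS.
Qed.

Lemma laurent_meval n (p : {mpoly K[n]}) (g : 'I_n -> ('I_r -> K) -> K) :
  (forall i, laurent M (g i : _ -> K^o)) ->
  laurent M (fun t => p.@[fun i => g i t] : K^o).
Proof.
move=> gM; apply: (@eq_laurent _ (fun t => \sum_(m <- msupp p) (p@_m * \prod_i g i t ^+ m i : K) : K^o)).
  by move=> t _; rewrite mevalE.
apply: laurent_sum => m; apply: laurentM; first exact: laurentC.
by apply: laurent_prod => i; apply: laurentX.
Qed.

(** Terms with equal exponents are collected and zero coefficients dropped, as
    independence of characters requires. *)
Lemma laurent_canon (V : lmodType K) (g : _ -> V) : laurent M g ->
  exists (L : seq 'rV[int]_r) (a : 'rV[int]_r -> V),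
    [/\ uniq L, forall x, x \in L -> M x /\ a x != 0 &
     forall t, Gm t -> g t = \sum_(x <- L) chi x t *: a x].
Proof.
move=> [s sM sE].
pose a x := \sum_(u <- s | u.1 == x) u.2.
exists [seq x <- undup (map fst s) | a x != 0], a; split.
- by rewrite filter_uniq // undup_uniq.
- move=> x; rewrite mem_filter => /andP [ax]; rewrite mem_undup => /mapP [u us e].
  by split=> //; rewrite e; apply: sM.
move=> t t0; rewrite sE // big_filter [RHS]big_mkcond /=.
rewrite [RHS](eq_bigr (fun x => \sum_(u <- s | u.1 == x) chi x t *: u.2)) => [|x _]; last first.
  by rewrite -scaler_sumr -/(a x); have [->|] //= := eqVneq (a x) 0; rewrite scaler0.
rewrite (exchange_big_dep xpredT) //= [LHS]big_seq [RHS]big_seq; apply: eq_bigr => u us.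
have uX : u.1 \in undup (map fst s) by rewrite mem_undup map_f.
rewrite (eq_bigl (pred1 u.1)) => [|x]; last exact: eq_sym.
by rewrite -big_filter (filter_pred1_uniq (undup_uniq _) uX) big_seq1.
Qed.
End Laurent.

Lemma square_inv (m n : nat) (A : 'M[int]_(n, m)) (C : 'M[int]_(m, n)) :
  m = n -> A *m C = 1%:M -> C *m A = 1%:M.
Proof. by move=> e; move: A C; rewrite e => A C /mulmx1C. Qed.

Lemma delta_chi (K : closedFieldType) r i (t : 'I_r -> K) : Gm t -> chi (delta_mx 0 i) t = t i.
Proof.
move=> t0; rewrite /chi (bigD1 i) //= mxE !eqxx expr1z big1 ?mulr1 // => j /negbTE ne.
by rewrite mxE ne andbF expr0z.
Qed.

Lemma chi_comp (K : closedFieldType) m n (x : 'rV[int]_m) (A : 'M[int]_(m, n)) (t : 'I_n -> K) :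
  Gm t -> chi x (fun j => chi (row j A) t) = chi (x *m A) t.
Proof.
move=> tm; rewrite mulmx_sum_row.
rewrite (big_morph (fun y => chi y t) (fun y z => chiD y z tm) (chi0 t)).
apply: eq_bigr => j _; rewrite /chi.
rewrite (big_morph (fun z => z ^ x 0 j) (fun y z => expfzMl y z (x 0 j)) (exp1rz K (x 0 j))).
by apply: eq_bigr => i _; rewrite !mxE exprz_exp mulrC.
Qed.

Section TorusStructure.
Variables (K : closedFieldType) (U : vectType K) (eps : bool) (B : U -> U -> K).
Hypothesis HB : isform eps B.
Hypothesis two : 2%:R != 0 :> K.
Variables (N : nat) (c : 'End(U) -> 'I_N -> K) (cE : 'I_N -> 'End(U)).
Hypothesis c_lin : forall l, linear_for *%R (c^~ l).
Hypothesis c_rec : forall f, f = \sum_l c f l *: cE l.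
Variables (r : nat) (phi : ('I_r -> K) -> 'End(U)).
Hypothesis phiM : forall s t, Gm s -> Gm t -> phi (fun i => s i * t i) = (phi s \o phi t)%VF.
Hypothesis phiP : exists (P : 'I_N -> {mpoly K[r]}) (e : nat), forall t, Gm t ->
          forall l, c (phi t) l = (P l).@[t] / (\prod_i t i) ^+ e.
Hypothesis phiQ : exists Q : 'I_r -> {mpoly K[N]}, forall t, Gm t ->
          forall i, (Q i).@[c (phi t)] = t i.
Hypothesis phi_iso : forall t, Gm t -> forall x y, B (phi t x) (phi t y) = B x y.
Hypothesis phi_rank : forall t, Gm t -> (\dim (limg (phi t - \1)%VF%R) <= r.*2)%N.

Local Notation X := 'rV[int]_r.

(** The matrix entries of phi are polynomials over a power of the product of the
    coordinates. *)
Lemma laurent_phi : exists (L : seq X) (A : X -> 'End(U)), 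
  [/\ uniq L, forall x, x \in L -> A x != 0 & forall t, Gm t -> phi t = \sum_(x <- L) chi x t *: A x].
Proof.
have [P [e PE]] := phiP.
have lau : laurent (fun=> True) phi.
  apply: (@eq_laurent _ _ _ _ (fun t => \sum_l ((P l).@[t] * chi (\row_i (- e%:Z)) t) *: cE l)).
    move=> t t0; rewrite [RHS]c_rec; apply: eq_bigr => l _; rewrite PE //; congr (_ * _ *: _).
    by rewrite -prodrXl -prodfV; apply: eq_bigr => i _; rewrite mxE exprnN.
  apply: laurent_sum => l; apply: laurentZ; apply: laurentM => //.
    apply: (@laurent_meval _ _ _ _ _ _ _ (fun i t => t i)) => // i; apply: (@eq_laurent _ _ _ _ (@chi K r (delta_mx 0 i) : _ -> K^o)).
      by move=> t t0; rewrite delta_chi.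
    exact: laurent_chi.
  exact: laurent_chi.
have [L [A [uL LA phiE]]] := laurent_canon lau.
by exists L, A; split=> // x /LA [].
Qed.

Lemma phi1 : phi (fun=> 1) = \1%VF.
Proof.
have p1 := @Gm1 K r.
have := phiM p1 p1; rewrite (_ : (fun _ : 'I_r => 1 * 1) = fun=> 1); last first.
  by apply/funext => i; rewrite mulr1.
move/lfunP => e; apply/lfunP => x; rewrite id_lfunE.
apply: (form_inj HB) => z; rewrite -(phi_iso p1) -(phi_iso p1 x).
by rewrite -comp_lfunE -e.
Qed.

Section Weights.
Variables (L : seq X) (A : X -> 'End(U)).
Hypothesis uL : uniq L.
Hypothesis LA : forall x, x \in L -> A x != 0.
Hypothesis phiE : forall t, Gm t -> phi t = \sum_(x <- L) chi x t *: A x.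

(** Comparing coefficients, first in s and then in t, in phi (s t) = phi s phi t shows
    that the coefficients of phi are orthogonal idempotents. *)
Lemma wt_comp x y : x \in L -> y \in L -> (A x \o A y)%VF = if x == y then A x else 0.
Proof.
move=> xL yL.
have h1 t : Gm t -> \sum_(y <- L) chi y t *: (A x \o A y)%VF = chi x t *: A x.
  move=> t0; apply/eqP; rewrite -subr_eq0; apply/eqP.
  apply: (chi_indep (a := fun x => \sum_(y <- L) chi y t *: (A x \o A y)%VF - chi x t *: A x) uL) => // s s0.
  have := phiM s0 t0; rewrite !phiE //; last exact: GmM.
  move/eqP; rewrite eq_sym -subr_eq0 => /eqP e; rewrite -[RHS]e /=.
  under [LHS]eq_bigr => z _ do rewrite scalerBr.
  rewrite sumrB; congr (_ - _); last first.
    by apply: eq_bigr => z _; rewrite chiM scalerA.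
  apply/lfunP => u; rewrite comp_lfunE !sum_lfunE; apply: eq_bigr => z _.
  rewrite [LHS]scale_lfunE [in LHS]sum_lfunE scaler_sumr linear_sum /=; apply: eq_bigr => w _.
  by rewrite !scale_lfunE comp_lfunE [A z (_ *: _)]linearZ.
apply/eqP; rewrite -subr_eq0; apply/eqP.
apply: (chi_indep (a := fun y => (A x \o A y)%VF - if x == y then A x else 0) uL) => // t t0.
rewrite /=; under [LHS]eq_bigr => z _ do rewrite scalerBr.
rewrite sumrB h1 //.
rewrite (bigD1_seq x) //= eqxx big1 ?addr0 ?subrr // => z /negbTE.
by rewrite eq_sym => ->; rewrite scaler0.
Qed.

Lemma wt_comp2 x y u : x \in L -> y \in L -> A x (A y u) = if x == y then A x u else 0.
Proof.
by move=> xL yL; rewrite -comp_lfunE wt_comp //; case: eqP => // _; rewrite zero_lfunE.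
Qed.

Lemma wt_sum u : u = \sum_(x <- L) A x u.
Proof.
have := phiE (@Gm1 K r); rewrite phi1 => /lfunP /(_ u); rewrite id_lfunE sum_lfunE => e.
by rewrite [LHS]e; apply: eq_bigr => x _; rewrite chi_one scale1r.
Qed.

Lemma wt_phi t x u : Gm t -> x \in L -> phi t (A x u) = chi x t *: A x u.
Proof.
move=> t0 xL; rewrite phiE // sum_lfunE (bigD1_seq x) //= scale_lfunE wt_comp2 // eqxx.
rewrite big_seq_cond big1 ?addr0 // => y /andP [yL /negbTE ne].
by rewrite scale_lfunE wt_comp2 // ne scaler0.
Qed.

(** B (phi t u) (phi t v) = B u v, while the left side is multiplied by chi (x + y) t.
    *)
Lemma wt_orth x y u v : x \in L -> y \in L -> x + y != 0 -> B (A x u) (A y v) = 0.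
Proof.
move=> xL yL /(chi_sep K) [t t0 xy].
have := phi_iso t0 (A x u) (A y v); rewrite !wt_phi // (fZl HB) (fZr HB) mulrA -chiD // => /eqP.
rewrite -subr_eq0 -[X in _ - X]mul1r -mulrBl mulf_eq0 subr_eq0 (negbTE xy) => /eqP //.
Qed.

(** By nondegeneracy the weight space of x pairs nontrivially with that of some weight,
    which can only be - x. *)
Lemma wt_pair x u : x \in L -> A x u != 0 -> - x \in L /\
  exists v, B (A x u) (A (- x) v) = 1.
Proof.
move=> xL xu.
have [h|h] := pselect (exists2 y, y \in L & exists v, B (A x u) (A y v) != 0).
  have [y yL [v xy]] := h.
  have e : y = - x.
    by apply/eqP; rewrite -addr_eq0 addrC; apply: contraNT xy => ne; rewrite wt_orth.
  rewrite -e; split=> //; exists ((B (A x u) (A y v))^-1 *: v).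
  by rewrite linearZ (fZr HB) mulVf.
case/negP: xu; apply/eqP/(form_nondeg HB) => v; rewrite [v]wt_sum (fsumr HB) big_seq big1 // => y yL.
by apply: contrapT => /eqP yv; apply: h; exists y => //; exists v.
Qed.

Definition nzw := [seq x <- L | x != 0].
(** One weight out of each pair x, - x, chosen by position in the list. *)
Definition posw := [seq x <- nzw | (index x nzw < index (- x) nzw)%N].

Lemma mem_nzw x : (x \in nzw) = (x != 0) && (x \in L).
Proof. by rewrite mem_filter. Qed.
Lemma wt_ex x : x \in L -> exists u, A x u != 0.
Proof.
move=> /LA; apply: contra_neqP => h; apply/lfunP => u; rewrite zero_lfunE.
by apply/eqP/negPn/negP => xu; apply: h; exists u.
Qed.
Lemma nzwN x : x \in nzw -> - x \in nzw.
Proof.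
rewrite !mem_nzw oppr_eq0 => /andP [-> /= xL].
by have [u xu] := wt_ex xL; have [] := wt_pair xL xu.
Qed.
Lemma mem_posw x : x \in posw -> x \in nzw.
Proof. by rewrite mem_filter => /andP []. Qed.
Lemma poswN x : x \in posw -> - x \notin posw.
Proof.
rewrite !mem_filter opprK => /andP [lt _]; rewrite negb_and -leqNgt (ltnW lt) //.
Qed.
Lemma nzw_neqN x : x \in nzw -> x != - x.
Proof.
rewrite mem_nzw => /andP [x0 _]; apply: contra_neq x0 => e.
apply/rowP => i; have /rowP/(_ i) := e; rewrite !mxE.
have intN (a : int) : a = - a -> a = 0 by lia.
exact: intN.
Qed.
Lemma posw_or x : x \in nzw -> x \in posw \/ - x \in posw.
Proof.
move=> xn; have nn := nzwN xn.
case: (ltngtP (index x nzw) (index (- x) nzw)) => h.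
- by left; rewrite mem_filter h.
- by right; rewrite mem_filter opprK h.
by have := nzw_neqN xn; have := congr1 (nth 0 nzw) h; rewrite !nth_index // => <-; rewrite eqxx.
Qed.
Lemma posw_uniq : uniq posw.
Proof. by rewrite !filter_uniq. Qed.

Local Notation r' := (size posw).
Local Notation px := (fun i : 'I_r' => posw`_i).

Lemma px_mem i : px i \in posw. Proof. exact: mem_nth. Qed.
Lemma px_L i : px i \in L.
Proof. by have := mem_posw (px_mem i); rewrite mem_nzw => /andP []. Qed.
Lemma px_NL i : - px i \in L.
Proof. by have := nzwN (mem_posw (px_mem i)); rewrite mem_nzw => /andP []. Qed.
Lemma px_sum i j : px i + px j != 0.
Proof.
apply/negP => /eqP e; have := poswN (px_mem i); rewrite (_ : - px i = px j) ?px_mem //.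
by apply/eqP; rewrite eq_sym -addr_eq0 addrC e.
Qed.

(** One vector from each weight space is enough; the rank bound shows afterwards that
    the weight spaces are lines. *)
Lemma wt_frame : exists e f : 'I_r' -> U, [/\ frame B e f,
  forall i, A (px i) (e i) = e i & forall i, A (- px i) (f i) = f i].
Proof.
have /choice [ef efP] : forall i : 'I_r', exists uv : U * U, 
    [/\ A (px i) uv.1 = uv.1, A (- px i) uv.2 = uv.2 & B uv.1 uv.2 = 1].
  move=> i; have [u xu] := wt_ex (px_L i); have [_ [v uv]] := wt_pair (px_L i) xu.
  exists (A (px i) u, A (- px i) v); split=> //=.
    by rewrite wt_comp2 ?px_L // eqxx.
  by rewrite wt_comp2 ?px_NL // eqxx.
exists (fun i => (ef i).1), (fun i => (ef i).2); split=> [|i|i]; try by have [] := efP i.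
split=> i j; have [ei fi efi] := efP i; have [ej fj efj] := efP j.
- by rewrite -ei -ej wt_orth ?px_L // px_sum.
- by rewrite -fi -fj wt_orth ?px_NL // -opprD oppr_eq0 px_sum.
case: eqP => [<- //|/eqP ne]; rewrite -ei -fj wt_orth ?px_L ?px_NL //.
rewrite subr_eq0 nth_uniq ?posw_uniq //.
Qed.

(** Each coordinate t i is a polynomial in the entries of phi t, so its exponent is a
    sum of weights; by independence of characters a Laurent polynomial determines its
    exponents. *)
Lemma wt_span : exists Nm : 'M[int]_(r, r'), Nm *m (\matrix_(i < r') px i) = 1%:M.
Proof.
pose M (x : X) := exists w : 'rV[int]_r', x = w *m (\matrix_(i < r') px i).
have M0 : M 0 by exists 0; rewrite mul0mx.
have MD x y : M x -> M y -> M (x + y) by move=> [w ->] [w' ->]; exists (w + w'); rewrite mulmxDl.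
have MN x : M x -> M (- x) by move=> [w ->]; exists (- w); rewrite mulNmx.
have Mpos x : x \in posw -> M x.
  move=> xp; have ix : (index x posw < r')%N by rewrite index_mem.
  exists (delta_mx 0 (Ordinal ix)); rewrite -rowE; apply/rowP => j.
  by rewrite !mxE /= nth_index.
have ML x : x \in L -> M x.
  move=> xL; have [->//|x0] := eqVneq x 0.
  have [|/Mpos|/Mpos/MN] := @posw_or x; rewrite ?opprK //.
  by rewrite mem_nzw x0.
have [Q QE] := phiQ.
have Mdelta i : M (delta_mx 0 i).
  have lau : laurent M (fun t => t i : K^o).
    apply: (@eq_laurent K r M K^o (fun t => (Q i).@[fun l => \sum_(x <- L) (if x \in L then chi x t else 0) * c (A x) l])).
      move=> t t0; rewrite -[RHS](QE _ t0 i); apply: meval_eq => l; rewrite phiE //.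
      have cD f g : c (f + g) l = c f l + c g l by rewrite -{1}[f]scale1r c_lin mul1r.
      have c0 : c 0 l = 0 by apply: (addrI (c 0 l)); rewrite -cD !addr0.
      rewrite (big_morph (c^~ l) cD c0) big_seq [RHS]big_seq; apply: eq_bigr => x ->.
      by rewrite -[in RHS](addr0 (_ *: _)) c_lin c0 addr0.
    apply: (@laurent_meval _ _ _ M0 MD _ _ (fun l t => \sum_(x <- L) (if x \in L then chi x t else 0) * c (A x) l)) => l.
    apply: (@laurent_sum _ _ M K^o _ L (fun x t => (if x \in L then chi x t else 0) * c (A x) l)) => x.
    apply: (@laurentM _ _ M MD (fun t => if x \in L then chi x t else 0)); last exact: laurentC.
    by case: (boolP (x \in L)) => [/ML|_]; [apply: laurent_chi|apply: laurentC].
  have [L' [a [uL' La tE]]] := laurent_canon lau.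
  have [dL|dL] := boolP (delta_mx 0 i \in L'); first by have [] := La _ dL.
  exfalso; pose a' x : K^o := if x == delta_mx 0 i then -1 else a x.
  have : a' (delta_mx 0 i) = 0.
    apply: (@chi_indep K r K^o (delta_mx 0 i :: L')); rewrite /= ?dL ?mem_head // => t t0.
    rewrite big_cons {1}/a' eqxx delta_chi // big_seq.
    rewrite (eq_bigr (fun x => chi x t *: a x)) => [|x xL']; last first.
      by rewrite /a'; case: eqP xL' => // ->; rewrite (negbTE dL).
    by rewrite -big_seq -tE // scalerN /GRing.scale /= mulr1 addNr.
  by rewrite /a' eqxx => /eqP; rewrite oppr_eq0 oner_eq0.
have /choice [w wE] := Mdelta.
exists (\matrix_(i, j) w i 0 j); apply/row_matrixP => i.
rewrite row_mul row1 wE; congr (_ *m _); apply/rowP => j; by rewrite !mxE.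
Qed.

(** For generic t, the image of phi t - 1 is the sum of the nonzero weight spaces, of
    dimension at most 2 r; it contains the frame just found, whose size is at least r
    because its weights generate Z^r. So the frame spans it, and the weights form a
    basis of Z^r. *)
Lemma torus_frame_of_weights : exists e f : 'I_r -> U, frame B e f /\
  phi @` @Gm K r = tor B e f @` @Gm K r.
Proof.
have [e [f [He eA fA]]] := wt_frame.
have [Nm NL] := wt_span.
have nzL x : x \in nzw -> x \in L by rewrite mem_nzw => /andP [].
(* A generic t0: it fixes only the vectors of weight 0. *)
have [t0 t0m t0n] : exists2 t : 'I_r -> K, Gm t & forall x, x \in nzw -> chi x t != 1.
  by apply: chi_generic; rewrite mem_nzw eqxx.
have im_wt x u : x \in nzw -> A x u \in limg (phi t0 - \1)%VF.
  move=> xn; apply/memv_imgP; exists ((chi x t0 - 1)^-1 *: A x u); first exact: memvf.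
  rewrite linearZ /= add_lfunE opp_lfunE id_lfunE wt_phi ?nzL //.
  have -> : chi x t0 *: A x u - A x u = (chi x t0 - 1) *: A x u by rewrite scalerBl scale1r.
  by rewrite scalerA mulVf ?scale1r // subr_eq0 t0n.
have spanS : (<<frseq e f>> <= limg (phi t0 - \1)%VF)%VS.
  apply/span_subvP => _ /mapP [[i []] _ ->] /=.
    by rewrite -eA im_wt // mem_posw // px_mem.
  by rewrite -fA im_wt // nzwN // mem_posw // px_mem.
(* r <= r' because the weights generate Z^r, and 2 r' <= 2 r by the rank bound. *)
have r'r : r' = r.
  apply/eqP; rewrite eqn_leq (mulmx1_min NL) andbT -leq_double -(card_ord r').
  by rewrite -(dim_span_frseq HB He) (leq_trans (dimvS spanS)) // phi_rank.
have spanE : limg (phi t0 - \1)%VF = <<frseq e f>>%VS.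
  apply/eqP; rewrite eq_sym eqEdim spanS (dim_span_frseq HB He) card_ord r'r.
  exact: phi_rank.
have span_perp v : v \in <<frseq e f>>%VS -> perp B e f v -> v = 0.
  rewrite -(limg_dg1 HB He) => /memv_imgP [u _ ->] pu.
  have := dg_perp HB (fun=> 1) (fun=> 1) pu.
  by rewrite -comp_lfunE (dg_comp HB He); under eq_fun do rewrite mulr1.
have BA y z w : y \in nzw -> B (A y z) (A (- y) w) = B z (A (- y) w).
  move=> yn; have yL := nzL _ yn; have nyL := nzL _ (nzwN yn).
  rewrite [in RHS](wt_sum z) (fsuml HB) (bigD1_seq y) //= big_seq_cond big1 ?addr0 // => v /andP [vL ne].
  by rewrite wt_orth // subr_eq0.
have perpA u x : perp B e f u -> x \in nzw -> A x u = 0.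
  move=> pu xn; apply: span_perp => [|i]; first by rewrite -spanE im_wt.
  have [h1 h2 h3 h4] := perpC HB pu i; split.
    apply: (f_eq0C HB); rewrite -eA.
    have [xi|xi] := eqVneq posw`_i (- x); last first.
      by rewrite wt_orth ?px_L ?nzL // addrC addr_eq0.
    by rewrite xi BA // -xi eA.
  rewrite -fA.
  have [xi|xi] := eqVneq x posw`_i; last by rewrite wt_orth ?px_NL ?nzL // subr_eq0.
  by rewrite -xi BA // xi fA.
have phi_tor t : Gm t -> phi t = tor B e f (fun i => chi (px i) t).
  move=> tm; apply: (frame_ext HB He) => [i|i|u pu].
  - by rewrite (tor_e HB He) -{1}eA wt_phi ?px_L // eA.
  - by rewrite (tor_f HB He) -{1}fA wt_phi ?px_NL // fA chiN.
  rewrite (tor_perp HB _ pu) {1}[u]wt_sum linear_sum [RHS]wt_sum /= big_seq [RHS]big_seq.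
  apply: eq_bigr => x xL; rewrite wt_phi //.
  have [->|x0] := eqVneq x 0; first by rewrite chi0 scale1r.
  by rewrite perpA ?scaler0 // mem_nzw x0.
have LN := square_inv r'r NL.
suff h : exists e f : 'I_r' -> U, frame B e f /\ phi @` @Gm K r = tor B e f @` @Gm K r'.
  by move: r'r h; move: r' => n ->.
exists e, f; split=> //; apply/seteqP; split=> [_ [t tm <-]|_ [tau taum <-]].
  by exists (fun i => chi (px i) t); rewrite ?phi_tor // => i; apply: chi_neq0.
have tm : @Gm K r (fun j => chi (row j Nm) tau) by move=> j; apply: chi_neq0.
(* Nm inverts the matrix of weights, so these monomials in tau solve chi (px i) t = tau i. *)
exists (fun j => chi (row j Nm) tau) => //; rewrite phi_tor //; congr tor; apply/funext => i.
rewrite chi_comp // (_ : px i *m Nm = delta_mx 0 i) ?delta_chi //.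
have /row_matrixP/(_ i) := LN; rewrite row_mul row1 => <-; congr (_ *m _).
by apply/rowP => j; rewrite !mxE.
Qed.

End Weights.

(** The structure theorem for tori of isometries whose elements h satisfy rank (h - 1)
    <= 2 r. *)
Theorem torus_is_frame_torus : exists e f : 'I_r -> U, frame B e f /\
  phi @` @Gm K r = tor B e f @` @Gm K r.
Proof.
have [L [A [uL LA phiE]]] := laurent_phi.
exact: torus_frame_of_weights uL LA phiE.
Qed.

End TorusStructure.

(** * Frame tori are closed, and are tori *)

Section PolyFun.
Variables (F K : fieldType) (iota : {rmorphism F -> K}).
Variables (T : Type) (N : nat) (c : T -> 'I_N -> K).

Definition polyfn (g : T -> K) :=
  exists p : {mpoly F[N]}, forall x, g x = (map_mpoly iota p).@[c x].

Lemma eq_polyfn g h : g =1 h -> polyfn g -> polyfn h.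
Proof. by move=> e [p pE]; exists p => x; rewrite -e pE. Qed.
Lemma polyfn_coord l : polyfn (c^~ l).
Proof. by exists 'X_l => x; rewrite map_mpolyX mevalX (bigD1 l) //= big1 ?mulr1 ?mnm1E ?eqxx // => i /negbTE; rewrite mnm1E eq_sym => ->. Qed.
Lemma polyfnC a : polyfn (fun=> iota a).
Proof. by exists a%:MP => x; rewrite map_mpolyC mevalC. Qed.
Lemma polyfnD g h : polyfn g -> polyfn h -> polyfn (fun x => g x + h x).
Proof. by move=> [p pE] [q qE]; exists (p + q) => x; rewrite rmorphD mevalD -pE -qE. Qed.
Lemma polyfnM g h : polyfn g -> polyfn h -> polyfn (fun x => g x * h x).
Proof. by move=> [p pE] [q qE]; exists (p * q) => x; rewrite rmorphM mevalM -pE -qE. Qed.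
Lemma polyfnN g : polyfn g -> polyfn (fun x => - g x).
Proof. by move=> [p pE]; exists (- p) => x; rewrite rmorphN mevalN -pE. Qed.
Lemma polyfnB g h : polyfn g -> polyfn h -> polyfn (fun x => g x - h x).
Proof. by move=> pg ph; apply: polyfnD => //; apply: polyfnN. Qed.
Lemma polyfn_sum (J : Type) (s : seq J) (P : pred J) (g : J -> T -> K) :
  (forall j, polyfn (g j)) -> polyfn (fun x => \sum_(j <- s | P j) g j x).
Proof.
move=> pg; elim: s => [|j s IH].
  by apply: eq_polyfn (polyfnC 0) => x; rewrite big_nil rmorph0.
apply: (@eq_polyfn (fun x => if P j then g j x + \sum_(j <- s | P j) g j x else \sum_(j <- s | P j) g j x)).
  by move=> x; rewrite big_cons.
by case: (P j) => //; apply: polyfnD.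
Qed.
Lemma polyfnX g n : polyfn g -> polyfn (fun x => g x ^+ n).
Proof.
move=> pg; elim: n => [|n IH].
  by apply: eq_polyfn (polyfnC 1) => x; rewrite rmorph1 expr0.
by apply: eq_polyfn (polyfnM pg IH) => x; rewrite exprS.
Qed.
Lemma polyfn_prod (J : Type) (s : seq J) (g : J -> T -> K) :
  (forall j, polyfn (g j)) -> polyfn (fun x => \prod_(j <- s) g j x).
Proof.
move=> pg; elim: s => [|j s IH].
  by apply: eq_polyfn (polyfnC 1) => x; rewrite big_nil rmorph1.
by apply: eq_polyfn (polyfnM (pg j) IH) => x; rewrite big_cons.
Qed.
Lemma polyfn_det n (M : T -> 'M[K]_n) : (forall i j, polyfn (fun x => M x i j)) ->
  polyfn (fun x => \det (M x)).
Proof.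
move=> pM; apply: polyfn_sum => s; apply: polyfnM; last exact: polyfn_prod.
by apply: eq_polyfn (polyfnC ((-1) ^+ perm.odd_perm s)) => x; rewrite rmorphXn rmorphN1.
Qed.
Lemma polyfn_mulmx m n p (M : T -> 'M[K]_(m, n)) (M' : T -> 'M[K]_(n, p)) :
  (forall i j, polyfn (fun x => M x i j)) -> (forall i j, polyfn (fun x => M' x i j)) ->
  forall i j, polyfn (fun x => (M x *m M' x) i j).
Proof.
move=> pM pM' i j; apply: (@eq_polyfn (fun x => \sum_k M x i k * M' x k j)).
  by move=> x; rewrite mxE.
by apply: polyfn_sum => k; apply: polyfnM.
Qed.
Lemma polyfn_adj n (M : T -> 'M[K]_n) : (forall i j, polyfn (fun x => M x i j)) ->
  forall i j, polyfn (fun x => (\adj (M x)) i j).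
Proof.
move=> pM i j; apply: (@eq_polyfn (fun x => iota ((-1) ^+ (j + i)) * \det (row' j (col' i (M x))))).
  by move=> x; rewrite mxE rmorphXn rmorphN1.
apply: polyfnM; first exact: polyfnC.
by apply: polyfn_det => k l; apply: eq_polyfn (pM (lift j k) (lift i l)) => x; rewrite !mxE.
Qed.
End PolyFun.

Lemma zeros_ideal_polyfn (K : fieldType) (T : Type) (N : nat) (c : T -> 'I_N -> K)
    (S : set T) (x : T) (g : T -> K) : zeros c (ideal_of c S) x ->
  polyfn idfun c g -> (forall s, S s -> g s = 0) -> g x = 0.
Proof. by move=> Zx [p pE] gS; rewrite pE; apply: Zx => s /gS; rewrite pE. Qed.

Section FrameTorus.
Variables (K : closedFieldType) (U : vectType K) (eps : bool) (B : U -> U -> K).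
Hypothesis HB : isform eps B.
Hypothesis two : 2%:R != 0 :> K.
Variables (N : nat) (c : 'End(U) -> 'I_N -> K) (cE : 'I_N -> 'End(U)).
Hypothesis c_lin : forall l, linear_for *%R (c^~ l).
Hypothesis c_rec : forall f, f = \sum_l c f l *: cE l.
Variables (r : nat) (e f : 'I_r -> U).
Hypothesis He : frame B e f.
Local Notation S := (tor B e f @` @Gm K r).

(** A form is linear in the coordinates of g; hence equations between pairings are
    polynomial equations on g. *)
Lemma polyfn_form x v : polyfn idfun c (fun g => B (g x) v).
Proof.
apply: (@eq_polyfn K K idfun _ _ c (fun g : 'End(U) => \sum_l c g l * B (cE l x) v)).
  move=> g; rewrite {2}[g]c_rec sum_lfunE (fsuml HB); apply: eq_bigr => l _.
  by rewrite scale_lfunE (fZl HB).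
apply: polyfn_sum => l; apply: polyfnM; first exact: polyfn_coord.
exact: (polyfnC idfun c).
Qed.

Lemma polyfn_formr x v : polyfn idfun c (fun g => B x (g v)).
Proof.
apply: (@eq_polyfn K K idfun _ _ c (fun g : 'End(U) => (-1) ^+ eps * B (g v) x)).
  by move=> g; rewrite -(fC HB).
apply: polyfnM; last exact: polyfn_form.
exact: (polyfnC idfun c).
Qed.

(** The pairings that characterize the elements of the torus are polynomial in g, and so
    hold on the Zariski closure. *)
Lemma frame_torus_zclosed : zclosed c S.
Proof.
exists (ideal_of c S); apply/seteqP; split=> [g Sg p|g Zg]; first exact.
have Z := zeros_ideal_polyfn Zg.
have cst a : polyfn idfun c (fun=> a) by exact: (polyfnC idfun c).
pose a i := B (g (e i)) (f i); pose b i := B (e i) (g (f i)).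
have ge i : g (e i) = a i *: e i.
  apply: (form_inj HB) => v; rewrite (fZl HB).
  apply/eqP; rewrite -subr_eq0; apply/eqP.
  apply: (Z (fun g => B (g (e i)) v - B (g (e i)) (f i) * B (e i) v)).
    apply: polyfnB; first exact: polyfn_form.
    by apply: polyfnM => //; exact: polyfn_form.
  move=> _ [t tm <-]; rewrite (tor_e HB He) !(fZl HB) (fr_ef He) eqxx mulr1.
  by rewrite subrr.
have gf i : g (f i) = b i *: f i.
  apply: (form_inj HB) => v; rewrite (fZl HB).
  apply/eqP; rewrite -subr_eq0; apply/eqP.
  apply: (Z (fun g => B (g (f i)) v - B (e i) (g (f i)) * B (f i) v)).
    apply: polyfnB; first exact: polyfn_form.
    by apply: polyfnM => //; exact: polyfn_formr.
  move=> _ [t tm <-]; rewrite (tor_f HB He) (fZl HB) (fZr HB) (fr_ef He) eqxx mulr1.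
  by rewrite subrr.
have ab i : a i * b i = 1.
  apply/eqP; rewrite -subr_eq0; apply/eqP.
  apply: (Z (fun g => B (g (e i)) (f i) * B (e i) (g (f i)) - 1)).
    by apply: polyfnB => //; apply: polyfnM; [exact: polyfn_form|exact: polyfn_formr].
  move=> _ [t tm <-]; rewrite (tor_f HB He) (tor_e HB He) (fZl HB) (fZr HB) (fr_ef He) eqxx !mulr1.
  by rewrite mulfV ?subrr.
have gp x : perp B e f x -> g x = x.
  move=> px; apply: (form_inj HB) => v.
  apply/eqP; rewrite -subr_eq0; apply/eqP.
  apply: (Z (fun g => B (g x) v - B x v)); first by apply: polyfnB => //; exact: polyfn_form.
  by move=> _ [t tm <-]; rewrite (tor_perp HB _ px) subrr.
have a0 i : a i != 0 by apply/eqP => a0; move/eqP: (ab i); rewrite a0 mul0r eq_sym oner_eq0.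
exists a => //; apply: (frame_ext HB He) => [i|i|x px].
- by rewrite (tor_e HB He) ge.
- by rewrite (tor_f HB He) gf; congr (_ *: _); apply: (mulfI (a0 i)); rewrite ab mulfV.
by rewrite (tor_perp HB _ px) gp.
Qed.

Lemma dg_delta_e i x : dgf B e f (fun j => (i == j)%:R) (fun=> 0) x = B x (f i) *: e i.
Proof.
rewrite (dgE HB) addrC big1 ?add0r => [|j _]; last by rewrite mul0r scale0r.
rewrite (bigD1 i) //= big1 ?addr0 => [|j ne]; first by rewrite eqxx mul1r.
by rewrite eq_sym (negbTE ne) mul0r scale0r.
Qed.

Lemma dg_delta_f i x : dgf B e f (fun=> 0) (fun j => (i == j)%:R) x = B (e i) x *: f i.
Proof.
rewrite (dgE HB) big1 ?add0r => [|j _]; last by rewrite mul0r scale0r.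
rewrite (bigD1 i) //= big1 ?addr0 => [|j ne]; first by rewrite eqxx mul1r.
by rewrite eq_sym (negbTE ne) mul0r scale0r.
Qed.

(** The coordinates of tor e f t are affine in the t i and their inverses, and t i = B
    (tor e f t (e i)) (f i) is polynomial in the coordinates. *)
Lemma frame_torus_is_torus : is_torus c r S.
Proof.
split; first exact: frame_torus_zclosed.
exists (tor B e f); split=> //.
- by move=> s t _ _; rewrite (torM HB He).
- pose d (i j : 'I_r) : K := (i == j)%:R.
  have cD f1 f2 l : c (f1 + f2) l = c f1 l + c f2 l by rewrite -{1}[f1]scale1r c_lin mul1r.
  have c0 l : c 0 l = 0 by apply: (addrI (c 0 l)); rewrite -cD !addr0.
  have cZ a f1 l : c (a *: f1) l = a * c f1 l by rewrite -[_ *: _]addr0 c_lin c0 addr0.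
  have csum (g : 'I_r -> 'End(U)) l : c (\sum_i g i) l = \sum_i c (g i) l.
    exact: (big_morph (c^~ l) (fun x y => cD x y l) (c0 l)).
  exists (fun l => (\prod_i 'X_i) * ((c \1%VF l)%:MP +
      \sum_i ('X_i - 1) * (c (dgf B e f (d i) (fun=> 0)) l)%:MP -
      \sum_i (c (dgf B e f (fun=> 0) (d i)) l)%:MP)
    + \sum_i (\prod_(j | j != i) 'X_j) * (c (dgf B e f (fun=> 0) (d i)) l)%:MP), 1%N.
  move=> t tm l.
  have p0 : \prod_i t i != 0 by apply/prodf_neq0.
  have tE : tor B e f t = \1%VF + \sum_i (t i - 1) *: dgf B e f (d i) (fun=> 0)
     + \sum_i ((t i)^-1 - 1) *: dgf B e f (fun=> 0) (d i).
    rewrite /tor -addrA; congr (_ + _); apply/lfunP => x; rewrite add_lfunE !sum_lfunE (dgE HB).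
    congr (_ + _); apply: eq_bigr => i _; rewrite scale_lfunE.
      by rewrite dg_delta_e scalerA.
    by rewrite dg_delta_f scalerA.
  rewrite expr1 tE !cD !csum; apply: (mulIf p0); rewrite divfK //.
  have mX i : ('X_i : {mpoly K[r]}).@[t] = t i by rewrite mevalXU.
  have mprod P : (\prod_(j | P j) 'X_j : {mpoly K[r]}).@[t] = \prod_(j | P j) t j.
    by rewrite (big_morph (meval t) (mevalM t) (meval1 t)); apply: eq_bigr => j _.
  have msum (g : 'I_r -> {mpoly K[r]}) : (\sum_i g i).@[t] = \sum_i (g i).@[t].
    exact: (big_morph (meval t) (mevalD t) (meval0 t)).
  rewrite mevalD mevalM mprod mevalB mevalD mevalC !msum mulrC mulrDr mulrBr -addrA; congr (_ + _).
    congr (_ * (_ + _)); apply: eq_bigr => i _.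
    by rewrite mevalM mevalB mX meval1 mevalC cZ.
  rewrite !mulr_sumr -sumrN -big_split /=; apply: eq_bigr => i _.
  rewrite mevalM mprod !mevalC cZ [in RHS](bigD1 i) //= [in LHS](bigD1 i) //= addrC.
  rewrite mulrA mulrBr mulrAC mulfV // mul1r mulr1.
  by ring.
- exists (fun i => \sum_l (B (cE l (e i)) (f i)) *: 'X_l) => t tm i.
  rewrite (big_morph (meval _) (mevalD _) (meval0 _)).
  transitivity (B (tor B e f t (e i)) (f i)); last first.
    by rewrite (tor_e HB He) (fZl HB) (fr_ef He) eqxx mulr1.
  rewrite [in RHS](c_rec (tor B e f t)) sum_lfunE (fsuml HB); apply: eq_bigr => l _.
  by rewrite mevalZ mevalXU scale_lfunE (fZl HB) mulrC.
Qed.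

End FrameTorus.

(** * Roots of a frame torus *)

(** No root takes the value 1 at t, and tor t fixes no vector of the frame. The roots of
    the isometry group of the span of the frame are t i / t j and t i t j (i <> j) with
    their inverses, and t i ^ 2 in the antisymmetric case; as t i <> 1 is required
    separately, t i ^ 2 <> 1 amounts to t i <> -1. *)
Definition regular (K : fieldType) (eps : bool) (I : Type) (t : I -> K) :=
  [/\ forall i, t i != 1,
      forall i j, i <> j -> t i != t j /\ t i * t j != 1 &
      eps -> forall i, t i != -1].

Section Wedge.
Variables (F : fieldType) (U : vectType F) (eps : bool) (B : U -> U -> F).
Hypothesis HB : isform eps B.
Local Notation sg := ((-1) ^+ eps : F).

(** The skew-adjoint operator of rank at most 2 attached to u and v; these span the Lie
    algebra of the isometry group. *)
Definition wedge (u v : U) : 'End(U) :=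
  linfun (fun x => B x u *: v - (sg * B x v) *: u).

Lemma wedgeE u v x : wedge u v x = B x u *: v - (sg * B x v) *: u.
Proof.
apply: linfun_linE => {x} a x y /=; rewrite !(form_linl HB) mulrDr !scalerDl opprD addrACA.
by rewrite scalerBr !scalerA mulrCA.
Qed.

Lemma wedge_skew u v x y : B (wedge u v x) y + B x (wedge u v y) = 0.
Proof.
rewrite !wedgeE (fBl HB) (fBr HB) !(fZl HB) !(fZr HB) (fC HB y u) (fC HB y v) sgMK.
by ring.
Qed.
End Wedge.

Section Regular.
Variables (F : fieldType) (K : closedFieldType) (iota : {rmorphism F -> K}).
Variables (V : vectType F) (Phi : V -> V -> F) (X : {vspace V}) (eps : bool).
Local Notation XK := (ext_space iota X).
Local Notation PhiK := (ext_form iota Phi).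
Local Notation U := (subvs_of XK).
Variable B : U -> U -> K.
Hypothesis BE : forall x y, B x y = PhiK (vsval x) (vsval y).
Hypothesis HB : isform eps B.
Hypothesis two : 2%:R != 0 :> K.
Local Notation sg := ((-1) ^+ eps : K).

Lemma ex_big_scalar : exists z : K, [/\ z != 0, z != 1 & z * z != 1].
Proof.
have [z z0 z1] := @nonroot_unity K 2%:Z isT.
exists z; rewrite z0 -expr2 z1; split=> //.
by apply: contraNneq z1 => ->; rewrite exp1rz.
Qed.

Section OneFrame.
Variables (r : nat) (e f : 'I_r -> U).
Hypothesis He : frame B e f.
Local Notation S := (tor B e f @` @Gm K r).

Lemma EK_frame x : EK S x <-> perp B e f x.
Proof.
split=> [h|px _ [t tm <-]]; last exact: (tor_perp HB).
have [z [z0 z1 _]] := ex_big_scalar.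
apply: (perp_fixed HB He (t := fun=> z)) => //; apply: h.
by exists (fun=> z) => // i.
Qed.

Lemma EKperpB x y : EKperp Phi S x -> EK S y -> B x y = 0.
Proof. by move=> px Ey; rewrite BE px. Qed.

Lemma EKperp_e i : EKperp Phi S (e i).
Proof. by move=> x /EK_frame px; rewrite -BE; have [] := perpC HB px i. Qed.
Lemma EKperp_f i : EKperp Phi S (f i).
Proof. by move=> x /EK_frame px; rewrite -BE; have [] := perpC HB px i. Qed.

Lemma EKperp_dg a b x : EKperp Phi S (dgf B e f a b x).
Proof.
move=> y /EK_frame py; rewrite -BE (dgE HB) (fDl HB) !(fsuml HB) !big1 ?addr0 // => i _; rewrite (fZl HB);
  have [h1 h2 h3 h4] := perpC HB py i.
  by rewrite h3 mulr0.
by rewrite h1 mulr0.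
Qed.

(** The complement of the fixed space is the span of the frame. *)
Lemma EKperp_E x : EKperp Phi S x -> x = dgf B e f (fun=> 1) (fun=> 1) x.
Proof.
move=> h; apply/eqP; rewrite -subr_eq0; apply/eqP.
apply: (perp_nondeg HB He); first exact: (perp_sub HB He).
by move=> y /EK_frame py; rewrite (fBl HB) (EKperpB h py) (EKperpB (EKperp_dg _ _ _) py) subr0.
Qed.

(** Conjugation by an isometry s carries wedge u v to wedge (s u) (s v). So two weight
    vectors give a root vector. *)
Lemma wedge_root u v (a b : 'End(U) -> K) : EKperp Phi S u -> EKperp Phi S v ->
  (forall s, S s -> s u = a s *: u) -> (forall s, S s -> s v = b s *: v) ->
  wedge eps B u v != 0 -> (exists2 s, S s & a s * b s != 1) ->
  is_root Phi S (fun s => a s * b s).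
Proof.
move=> pu pv au bv Y0 ex; split=> //; exists (wedge eps B u v); split=> //.
  split; first by move=> x y; rewrite -!BE (wedge_skew HB).
  move=> x Ex; rewrite (wedgeE HB) [B x u](fC HB) [B x v](fC HB) (EKperpB pu Ex) (EKperpB pv Ex) !mulr0.
  by rewrite !scale0r subr0.
move=> s Ss; have Ss' := Ss; case: Ss => t tm sE.
have is_ : forall x y, B (s x) (s y) = B x y by move=> x y; rewrite -sE (tor_isom HB He).
have k0 := isometry_bij HB is_.
have limgs : limg s = fullv by apply/eqP; rewrite eqEdim subvf /= limg_dim_eq // (eqP k0) capv0.
apply/lfunP => x; rewrite /conj_lfun !comp_lfunE scale_lfunE !(wedgeE HB).
have sV y : s ((s^-1)%VF y) = y by rewrite limg_lfunVK // limgs memvf.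
have Bs y : B ((s^-1)%VF x) y = B x (s y) by rewrite -is_ sV.
rewrite !Bs [LHS]linearB [X in X - _ = _]linearZ [X in _ - X = _]linearZ /= au // bv // !(fZr HB) scalerBr !scalerA.
have E (p q w z : K) : p * (q * w) * z = z * q * (p * w) by ring.
by rewrite E [a s * B x u * b s]mulrAC.
Qed.

Lemma tor_eigen_e i s : S s -> s (e i) = B (s (e i)) (f i) *: e i.
Proof. by move=> [t tm <-]; rewrite (tor_e HB He) (fZl HB) (fr_ef He) eqxx mulr1. Qed.
Lemma tor_eigen_f i s : S s -> s (f i) = B (e i) (s (f i)) *: f i.
Proof. by move=> [t tm <-]; rewrite (tor_f HB He) (fZr HB) (fr_ef He) eqxx mulr1. Qed.

(** Roots are produced as wedges of frame vectors: e i with f j, e i with e j, and e i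
    with itself in the antisymmetric case. *)
Lemma SrK_regular g : SrK Phi S g -> exists2 t, Gm t /\ regular eps t & g = tor B e f t.
Proof.
case=> Sg ng bij; have Sg' := Sg; case: Sg => t tm gE; exists t => //; split=> //.
have ne0 (u v : U) : B u v = 1 -> u != 0.
  by move=> uv; apply/eqP => u0; move/eqP: uv; rewrite u0 (f0l HB) eq_sym oner_eq0.
have e0 i : e i != 0 by apply: (ne0 _ (f i)); rewrite (fr_ef He) eqxx.
have ge i : B (g (e i)) (f i) = t i by rewrite -gE (tor_e HB He) (fZl HB) (fr_ef He) eqxx mulr1.
have gf i : B (e i) (g (f i)) = (t i)^-1 by rewrite -gE (tor_f HB He) (fZr HB) (fr_ef He) eqxx mulr1.
have [z [z0 z1 z2]] := ex_big_scalar.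
have St i : S (tor B e f (fun j => if j == i then z else 1)).
  by exists (fun j => if j == i then z else 1) => // j; case: ifP; rewrite ?oner_eq0.
split.
- move=> i; apply/eqP => t1.
  have [|x [_ xu]] := bij 0; first by move=> x _; rewrite -BE (f0l HB).
  have x0 : x = 0 by apply: xu; split; [move=> y _; rewrite -BE (f0l HB)|rewrite linear0].
  move/eqP: (e0 i); apply; rewrite -x0; apply/esym/xu; split; first exact: EKperp_e.
  by rewrite add_lfunE opp_lfunE id_lfunE -gE (tor_e HB He) t1 scale1r subrr.
- move=> i j /eqP ij; split.
    have := ng (fun s => B (s (e i)) (f i) * B (e j) (s (f j))).
    rewrite ge gf; suff rt : is_root Phi S (fun s => B (s (e i)) (f i) * B (e j) (s (f j))).
      by move=> /(_ rt); apply: contraNneq => ->; rewrite mulfV.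
    apply: (wedge_root (EKperp_e i) (EKperp_f j)).
    + exact: tor_eigen_e.
    + exact: tor_eigen_f.
    + apply/eqP => /lfunP /(_ (e j)); rewrite (wedgeE HB) zero_lfunE (fr_ee He) scale0r add0r (fr_ef He) eqxx mulr1.
      by move/eqP; rewrite oppr_eq0 scaler_eq0 signr_eq0 (negbTE (e0 i)).
    exists (tor B e f (fun j => if j == i then z else 1)) => //.
    rewrite (tor_e HB He) (tor_f HB He) (fZl HB) (fZr HB) !(fr_ef He) !eqxx !mulr1.
    by rewrite [j == i]eq_sym (negbTE ij) invr1 mulr1.
  have := ng (fun s => B (s (e i)) (f i) * B (s (e j)) (f j)).
  rewrite !ge; apply; apply: (wedge_root (EKperp_e i) (EKperp_e j)).
  + exact: tor_eigen_e.
  + exact: tor_eigen_e.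
  + apply/eqP => /lfunP /(_ (f j)); rewrite (wedgeE HB) zero_lfunE !(fr_fe HB He) (negbTE ij) eqxx.
    rewrite mulr0 scale0r add0r mulr1 sgK.
    by move/eqP; rewrite oppr_eq0 scaler_eq0 oner_eq0 (negbTE (e0 i)).
  exists (tor B e f (fun j => if j == i then z else 1)) => //.
  rewrite !(tor_e HB He) !(fZl HB) !(fr_ef He) !eqxx !mulr1.
  by rewrite [j == i]eq_sym (negbTE ij) mulr1.
move=> he i; apply/eqP => tN.
have := ng (fun s => B (s (e i)) (f i) * B (s (e i)) (f i)).
rewrite !ge tN mulrNN mulr1 eqxx; suff rt : is_root Phi S (fun s => B (s (e i)) (f i) * B (s (e i)) (f i)).
  by move=> /(_ rt).
apply: (wedge_root (EKperp_e i) (EKperp_e i)).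
- exact: tor_eigen_e.
- exact: tor_eigen_e.
- apply/eqP => /lfunP /(_ (f i)); rewrite (wedgeE HB) zero_lfunE !(fr_fe HB He) eqxx he expr1.
  rewrite mulr1 mulrNN mulr1 scaleN1r scale1r -opprD => /eqP; rewrite oppr_eq0 -mulr2n -scaler_nat.
  by rewrite scaler_eq0 (negbTE two) (negbTE (e0 i)).
exists (tor B e f (fun j => if j == i then z else 1)) => //.
by rewrite (tor_e HB He) (fZl HB) (fr_ef He) eqxx mulr1.
Qed.

(** If a root alpha took the value 1 at t, its root vector Y would commute with tor t.
    Since the eigenvalues of tor t on the frame are distinct, Y would preserve each line
    of the frame, hence commute with the whole torus, and alpha would be trivial. A
    coincidence t i = t i ^ -1 = -1, possible in the symmetric case, is harmless because
    B (Y u) u = 0 for skew-adjoint Y. *)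
Lemma regular_SrK t : Gm t -> regular eps t -> SrK Phi S (tor B e f t).
Proof.
move=> tm [t1 tij teps]; split; first by exists t.
- move=> al [[s0 Ss0 al0] [Y [[Ysk YE] Y0 Yal]]]; apply/eqP => alt.
  have YskB x y : B (Y x) y + B x (Y y) = 0 by rewrite !BE.
  have Yt : conj_lfun (tor B e f t) Y = Y by rewrite Yal ?alt ?scale1r //; exists t.
  have inv s x : Gm s -> tor B e f s ((tor B e f s)^-1%VF x) = x.
    move=> sm; rewrite limg_lfunVK //; have k0 := isometry_bij HB (tor_isom HB He sm).
    suff -> : limg (tor B e f s) = fullv by apply: memvf.
    by apply/eqP; rewrite eqEdim subvf /= limg_dim_eq // (eqP k0) capv0.
  have inv' s x : Gm s -> (tor B e f s)^-1%VF (tor B e f s x) = x.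
    by move=> sm; rewrite lker0_lfunK // (isometry_bij HB (tor_isom HB He sm)).
  have comm x : tor B e f t (Y x) = Y (tor B e f t x).
    by rewrite -{2}Yt /conj_lfun !comp_lfunE inv'.
  have BY u v a b : tor B e f t u = a *: u -> tor B e f t v = b *: v -> a * b != 1 -> B (Y u) v = 0.
    move=> ua vb ab; have := tor_isom HB He tm (Y u) v.
    rewrite comm ua vb linearZ (fZl HB) (fZr HB) mulrA => /eqP.
    by rewrite -subr_eq0 -[X in _ - X]mul1r -mulrBl mulf_eq0 subr_eq0 (negbTE ab) => /eqP.
  have te i := tor_e HB He t i; have tf i := tor_f HB He t i.
  have BYp x y : perp B e f x -> B (Y y) x = 0.
    by move=> /EK_frame px; have := YskB y x; rewrite (YE _ px) (f0r HB) addr0.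
  have BYd u a : tor B e f t u = a *: u -> (a = -1 -> ~~ eps) -> a != 1 -> B (Y u) u = 0.
    move=> ua aeps a1; have [a2|a2] := eqVneq (a * a) 1; last exact: (BY _ _ a a).
    have aN : a = -1.
      by move/eqP: a2; rewrite -expr2 sqrf_eq1 (negbTE a1) => /eqP.
    have := YskB u u; rewrite [B u _](fC HB) (negbTE (aeps aN)) expr0 mul1r -mulr2n -mulr_natl => /eqP.
    by rewrite mulf_eq0 (negbTE two) => /eqP.
  have Ye i : Y (e i) = B (Y (e i)) (f i) *: e i.
    apply/eqP; rewrite -subr_eq0; apply/eqP.
    apply: (frame_eq0 HB He) => [j|j|x px]; rewrite (fBl HB) (fZl HB) ?(fr_ee He) ?(fr_ef He) ?mulr0 ?subr0.
    + have [<-|/eqP ne] := eqVneq i j.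
        by apply: (BYd _ (t i)) => // tN; apply: contraT => /negPn /teps /(_ i); rewrite tN eqxx.
      by apply: (BY _ _ (t i) (t j)) => //; have [] := tij i j ne.
    + have [<-|/eqP ne] := eqVneq i j; first by rewrite mulr1 subrr.
      rewrite mulr0 subr0; apply: (BY _ _ (t i) (t j)^-1) => //; have [h _] := tij i j ne.
      by apply: contra h => /eqP h; apply/eqP/(mulIf (invr_neq0 (tm j))); rewrite h mulfV.
    by have [h1 h2 h3 h4] := perpC HB px i; rewrite BYp // h1 mulr0 subrr.
  have Yf i : Y (f i) = (sg * B (Y (f i)) (e i)) *: f i.
    apply/eqP; rewrite -subr_eq0; apply/eqP.
    apply: (frame_eq0 HB He) => [j|j|x px]; rewrite (fBl HB) (fZl HB) ?(fr_fe HB He) ?(fr_ff He) ?mulr0 ?subr0.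
    + have [<-|/eqP ne] := eqVneq i j; first by rewrite mulr1 mulrAC sgK mul1r subrr.
      rewrite !mulr0 subr0.
      apply: (BY _ _ (t i)^-1 (t j)) => //; have [h _] := tij i j ne.
      by apply: contra h => /eqP h; rewrite eq_sym; apply/eqP/(mulfI (invr_neq0 (tm i))); rewrite h mulVf.
    + have [<-|/eqP ne] := eqVneq i j.
        apply: (BYd _ (t i)^-1) => //; last by rewrite invr_eq1.
        move=> tN; apply: contraT => /negPn /teps /(_ i).
        by rewrite -[t i]invrK tN invrN invr1 eqxx.
      apply: (BY _ _ (t i)^-1 (t j)^-1) => //; have [_ h] := tij i j ne.
      by rewrite -invfM invr_eq1.
    by have [h1 h2 h3 h4] := perpC HB px i; rewrite BYp // h3 mulr0 subrr.
  move: al0; apply/negP/negPn/eqP.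
  have Ys : conj_lfun s0 Y = Y.
    case: Ss0 => s sm <-.
    apply/lfunP => x; rewrite /conj_lfun !comp_lfunE.
    suff cs : (tor B e f s \o Y)%VF = (Y \o tor B e f s)%VF.
      by rewrite -[tor _ _ _ _ (Y _)]comp_lfunE cs comp_lfunE inv.
    apply: (frame_ext HB He) => [i|i|y py]; rewrite !comp_lfunE.
    + move: (Ye i); set y := B _ _ => Yei.
      by rewrite (tor_e HB He) Yei !linearZ /= (tor_e HB He) Yei !scalerA mulrC.
    + move: (Yf i); set y := sg * B _ _ => Yfi.
      by rewrite (tor_f HB He) Yfi !linearZ /= (tor_f HB He) Yfi !scalerA mulrC.
    by rewrite (tor_perp HB _ py) YE ?linear0 //; apply/EK_frame.
  move: (Yal _ Ss0); rewrite Ys => /eqP; rewrite -subr_eq0 -{1}[Y]scale1r -scalerBl scaler_eq0 (negbTE Y0) orbF.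
  by rewrite subr_eq0 eq_sym => /eqP.
move=> y py.
pose a i := (t i - 1)^-1; pose b i := ((t i)^-1 - 1)^-1.
have a1 i : (t i - 1) * a i = 1 by rewrite mulfV // subr_eq0.
have b1 i : ((t i)^-1 - 1) * b i = 1 by rewrite mulfV // subr_eq0 invr_eq1.
exists (dgf B e f a b y); split; first split.
- exact: EKperp_dg.
- rewrite (tor_sub1 B e f) -comp_lfunE (dg_comp HB He) [RHS]EKperp_E //; congr (dgf B e f _ _ y).
    exact/funext.
  exact/funext.
move=> x [px tx]; apply/esym/eqP; rewrite -subr_eq0; apply/eqP.
have Ex : (tor B e f t - \1)%VF (x - dgf B e f a b y) = 0.
  rewrite linearB /= tx (tor_sub1 B e f) -comp_lfunE (dg_comp HB He) [X in X - _]EKperp_E //.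
  apply/eqP; rewrite subr_eq0; apply/eqP; congr (dgf B e f _ _ y); apply/esym/funext => i.
    exact: a1.
  exact: b1.
apply: (perp_nondeg HB He).
  apply: (perp_fixed HB He t1); apply/eqP; rewrite -subr_eq0; apply/eqP.
  by rewrite -[RHS]Ex add_lfunE opp_lfunE id_lfunE.
by move=> z /EK_frame pz; rewrite (fBl HB) (EKperpB px pz) (EKperpB (EKperp_dg _ _ _) pz) subrr.
Qed.

End OneFrame.
End Regular.

(** * Extension of scalars *)

(** A model of K tensor U: an iota-semilinear map taking a basis to a basis. *)
Record bchange (F K : fieldType) (iota : {rmorphism F -> K})
    (U : vectType F) (UK : vectType K) (j : U -> UK) : Prop := IsBChange {
  bchangeD : forall u v, j (u + v) = j u + j v;
  bchangeZ : forall a u, j (a *: u) = iota a *: j u;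
  bchange_basis : basis_of fullv [seq j u | u <- vbasis {:U}] }.

Section BChange.
Variables (F K : fieldType) (iota : {rmorphism F -> K}).

Section One.
Variables (U : vectType F) (UK : vectType K) (j : U -> UK).
Hypothesis Hj : bchange iota j.
Local Notation b := (vbasis {:U}).
Local Notation bK := (map_tuple j (vbasis {:U})).

Lemma bc0 : j 0 = 0.
Proof. by rewrite -[0](scale0r 0) (bchangeZ Hj) rmorph0 scale0r. Qed.
Lemma bcN u : j (- u) = - j u.
Proof. by rewrite -scaleN1r (bchangeZ Hj) rmorphN1 scaleN1r. Qed.
Lemma bcB u v : j (u - v) = j u - j v.
Proof. by rewrite (bchangeD Hj) bcN. Qed.
Lemma bc_sum (I : Type) (s : seq I) (P : pred I) (u : I -> U) :
  j (\sum_(i <- s | P i) u i) = \sum_(i <- s | P i) j (u i).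
Proof. exact: (big_morph j (bchangeD Hj) bc0). Qed.

Lemma bc_nth i : bK`_i = j b`_i.
Proof.
have [h|h] := ltnP i (size b); first exact: nth_map.
by rewrite /= !nth_default ?size_map // bc0.
Qed.

Lemma basis_expand (x : UK) : x = \sum_i coord bK i x *: j b`_i.
Proof.
rewrite {1}(coord_basis (bchange_basis Hj) (memvf x)).
by apply: eq_bigr => i _; rewrite bc_nth.
Qed.

Lemma bc_expand u : j u = \sum_i iota (coord b i u) *: j b`_i.
Proof.
rewrite {1}(coord_basis (vbasisP fullv) (memvf u)) bc_sum.
by apply: eq_bigr => i _; rewrite (bchangeZ Hj).
Qed.

Lemma bc_coord i u : coord bK i (j u) = iota (coord b i u).
Proof.
rewrite bc_expand; under eq_bigr do rewrite -bc_nth.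
exact: (coord_sum_free _ _ (basis_free (bchange_basis Hj))).
Qed.

Lemma bc_inj : injective j.
Proof.
move=> u v uv; rewrite (coord_basis (vbasisP fullv) (memvf u)).
rewrite [RHS](coord_basis (vbasisP fullv) (memvf v)); apply: eq_bigr => i _.
by congr (_ *: _); apply: (fmorph_inj iota); rewrite -!bc_coord uv.
Qed.

(** Linear independence is the rank of a matrix of coordinates, and ranks do not change
    under field extension. *)
Lemma bc_free (s : seq U) : free (map j s) = free s.
Proof.
pose A := \matrix_(i < size s, k < \dim {:U}) coord b k s`_i.
have comb m (t : m.-tuple U) (AA := \matrix_(i < m, k < \dim {:U}) coord b k t`_i) :
  (free t = row_free AA) * (free (map j t) = row_free (map_mx iota AA)).
  have E (G : fieldType) (T : vectType G) n (e : n.-tuple T) (w : m.-tuple T) :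
     basis_of fullv e -> free w = row_free (\matrix_(i < m, k < n) coord e k w`_i).
    move=> be; set M := \matrix_(_, _) _.
    have wE (k : 'I_m -> G) : \sum_i k i *: w`_i = \sum_l (\row_i k i *m M) 0 l *: e`_l.
      under eq_bigr => i _ do rewrite (coord_basis be (memvf w`_i)) scaler_sumr.
      rewrite exchange_big; apply: eq_bigr => l _; rewrite mxE scaler_suml.
      by apply: eq_bigr => i _; rewrite !mxE scalerA.
    apply/freeP/idP => [fr|rf k].
      apply/inj_row_free => v vM; apply/rowP => i; rewrite mxE; apply: (fr (fun i => v 0 i)).
      rewrite wE (_ : (\row_i0 v 0 i0) = v); last by apply/rowP => l; rewrite mxE.
      by rewrite vM big1 // => l _; rewrite mxE scale0r.
    rewrite wE => h i.
    have kM : \row_i k i *m M = 0 *m M.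
      rewrite mul0mx; apply/rowP => l; rewrite [RHS]mxE.
      by move/freeP: (basis_free be) => /(_ (fun l => (\row_i k i *m M) 0 l) h l).
    by have /rowP/(_ i) := row_free_inj rf kM; rewrite !mxE.
  split; first exact: (E _ _ _ _ _ (vbasisP fullv)).
  have := E _ _ _ bK (map_tuple j t) (bchange_basis Hj) => /= ->; congr row_free.
  apply/matrixP => i k; rewrite !mxE -bc_coord; congr (coord _ _ _).
  by rewrite (nth_map 0) // size_tuple.
have := comb _ (in_tuple s) => /= -[-> ->].
by rewrite /row_free mxrank_map.
Qed.

End One.

Section Two.
Variables (U1 U2 : vectType F) (UK1 UK2 : vectType K) (j1 : U1 -> UK1) (j2 : U2 -> UK2).
Hypotheses (H1 : bchange iota j1) (H2 : bchange iota j2).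

Definition bcf (f : 'Hom(U1, U2)) : 'Hom(UK1, UK2) :=
  linfun (fun x => \sum_i coord (map_tuple j1 (vbasis {:U1})) i x *: j2 (f (vbasis {:U1})`_i)).

Lemma bcfE f u : bcf f (j1 u) = j2 (f u).
Proof.
rewrite linfun_linE; last first.
  move=> a x y; rewrite scaler_sumr -big_split; apply: eq_bigr => i _.
  by rewrite linearP scalerDl scalerA.
under eq_bigr do rewrite (bc_coord H1) -(bchangeZ H2) -linearZ.
rewrite -(bc_sum H2) -linear_sum; congr (j2 (f _)).
by rewrite -(coord_basis (vbasisP fullv) (memvf u)).
Qed.

Lemma bc_eq (T : vectType K) (g g' : 'Hom(UK1, T)) : (forall u, g (j1 u) = g' (j1 u)) -> g = g'.
Proof.
move=> h; apply/lfunP => x; rewrite (basis_expand H1 x) !linear_sum; apply: eq_bigr => i _.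
by rewrite !linearZ /= h.
Qed.

Lemma bcf_dim f : \dim (limg (bcf f)) = \dim (limg f).
Proof.
have bas := vbasisP (limg f).
have fr : free (map j2 (vbasis (limg f))) by rewrite (bc_free H2) (basis_free bas).
rewrite -(size_tuple (vbasis (limg f))) -(size_map j2) -(eqP fr); congr (\dim _).
apply/eqP; rewrite eqEsubv; apply/andP; split; last first.
  apply/span_subvP => _ /mapP [u /vbasis_mem /memv_imgP [x _ ->] ->].
  by rewrite -bcfE memv_img ?memvf.
apply/subvP => _ /memv_imgP [x _ ->]; rewrite (basis_expand H1 x) linear_sum rpred_sum // => i _.
rewrite linearZ /= rpredZ // bcfE.
rewrite (coord_basis bas (memv_img f (memvf (vbasis fullv)`_i))) (bc_sum H2) rpred_sum // => k _.
by rewrite (bchangeZ H2) rpredZ // memv_span // map_f // mem_nth // size_tuple.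
Qed.
End Two.

Lemma bcf_comp (U1 U2 U3 : vectType F) (UK1 UK2 UK3 : vectType K)
    (j1 : U1 -> UK1) (j2 : U2 -> UK2) (j3 : U3 -> UK3) (g : 'Hom(U2, U3)) (f : 'Hom(U1, U2)) :
  bchange iota j1 -> bchange iota j2 -> bchange iota j3 ->
  bcf j1 j3 (g \o f)%VF = (bcf j2 j3 g \o bcf j1 j2 f)%VF.
Proof.
by move=> H1 H2 H3; apply: (bc_eq H1) => u; rewrite comp_lfunE !bcfE // comp_lfunE.
Qed.

Lemma bcf1 (U : vectType F) (UK : vectType K) (j : U -> UK) :
  bchange iota j -> bcf j j \1%VF = \1%VF.
Proof. by move=> H; apply: (bc_eq H) => u; rewrite bcfE // !id_lfunE. Qed.

Lemma bcfD (U1 U2 : vectType F) (UK1 UK2 : vectType K) (j1 : U1 -> UK1) (j2 : U2 -> UK2)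
    (f g : 'Hom(U1, U2)) : bchange iota j1 -> bchange iota j2 ->
  bcf j1 j2 (f + g) = bcf j1 j2 f + bcf j1 j2 g.
Proof.
by move=> H1 H2; apply: (bc_eq H1) => u; rewrite add_lfunE !bcfE // add_lfunE (bchangeD H2).
Qed.

Section Coords.
Variables (U : vectType F) (UK : vectType K) (j : U -> UK).
Hypothesis Hj : bchange iota j.
Local Notation c := (coords j).
Local Notation bK := (map_tuple j (vbasis {:U})).

Lemma coords_lin l : linear_for *%R (c^~ l).
Proof.
move=> a f g; rewrite /coords.
pose M (h : 'End(UK)) : 'M[K]_(\dim {:U}) := \matrix_(i, i') coord bK i' (h bK`_i).
rewrite -/(M _) -/(M f) -/(M g); have -> : M (a *: f + g) = a *: M f + M g.
  by apply/matrixP => i i'; rewrite !mxE add_lfunE scale_lfunE linearP.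
by rewrite linearP !mxE.
Qed.

(** An endomorphism is determined linearly by its matrix. *)
Lemma coords_rec : exists E : 'I_(\dim {:U} * \dim {:U}) -> 'End(UK),
  forall f, f = \sum_l c f l *: E l.
Proof.
pose T (M : 'M[K]_(\dim {:U})) : 'End(UK) :=
  \sum_i \sum_i' M i i' *: linfun (fun x => coord bK i x *: j (vbasis fullv)`_i').
have TE i i' x : (linfun (fun x => coord bK i x *: j (vbasis fullv)`_i')) x = coord bK i x *: j (vbasis fullv)`_i'.
  by apply: linfun_linE => a u v; rewrite linearP scalerDl scalerA.
exists (fun l => T (vec_mx (delta_mx 0 l))) => f.
pose M : 'M[K]_(\dim {:U}) := \matrix_(i, i') coord bK i' (f bK`_i).
have fT : f = T M.
  apply: (bc_eq Hj) => u; rewrite {1}(bc_expand Hj u) linear_sum sum_lfunE; apply: eq_bigr => i _.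
  rewrite linearZ /= [f _](basis_expand Hj) scaler_sumr sum_lfunE; apply: eq_bigr => i' _.
  by rewrite scale_lfunE TE mxE (bc_coord Hj) (bc_nth Hj) !scalerA mulrC.
rewrite {1}fT -[M]mxvecK {1}[mxvec M]row_sum_delta linear_sum /T.
under [RHS]eq_bigr => l _.
  rewrite scaler_sumr; under eq_bigr => i _ do rewrite scaler_sumr.
  over.
rewrite [RHS]exchange_big; apply: eq_bigr => i _.
rewrite [RHS]exchange_big; apply: eq_bigr => i' _.
rewrite summxE scaler_suml; apply: eq_bigr => l _.
by rewrite linearZ mxE scalerA.
Qed.
End Coords.
End BChange.

(** Nondegeneracy over K is tested with the F-vectors dual to a basis of U. *)
Lemma isform_bc (F K : fieldType) (iota : {rmorphism F -> K}) (U : vectType F) (UK : vectType K)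
    (j : U -> UK) (eps : bool) (B : U -> U -> F) (BK : UK -> UK -> K) :
  bchange iota j -> isform eps B -> (forall y, linear_for *%R (BK^~ y)) ->
  (forall x, linear_for *%R (BK x)) -> (forall u v, BK (j u) (j v) = iota (B u v)) ->
  isform eps BK.
Proof.
move=> Hj HB ll lr jB.
have D1 x y z : BK (x + y) z = BK x z + BK y z by rewrite -{1}[x]scale1r ll mul1r.
have D2 x y z : BK z (x + y) = BK z x + BK z y by rewrite -{1}[x]scale1r lr mul1r.
have O1 z : BK 0 z = 0 by apply: (addrI (BK 0 z)); rewrite -D1 !addr0.
have O2 z : BK z 0 = 0 by apply: (addrI (BK z 0)); rewrite -D2 !addr0.
have Z1 a x z : BK (a *: x) z = a * BK x z by rewrite -[_ *: _]addr0 ll O1 addr0.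
have Z2 a x z : BK z (a *: x) = a * BK z x by rewrite -[_ *: _]addr0 lr O2 addr0.
have S1 (I : Type) (s : seq I) (v : I -> UK) z :
    BK (\sum_(i <- s) v i) z = \sum_(i <- s) BK (v i) z.
  by apply: (big_morph (BK^~ z)) => [x y|]; rewrite ?D1 ?O1.
have S2 (I : Type) (s : seq I) (v : I -> UK) z :
    BK z (\sum_(i <- s) v i) = \sum_(i <- s) BK z (v i).
  by apply: (big_morph (BK z)) => [x y|]; rewrite ?D2 ?O2.
split=> [a x y z|x y|x h]; first exact: ll.
- have E u v : BK u v = \sum_i \sum_k coord (map_tuple j (vbasis {:U})) i u *
      coord (map_tuple j (vbasis {:U})) k v * iota (B (vbasis fullv)`_i (vbasis fullv)`_k).
    rewrite {1}(basis_expand Hj u) S1; apply: eq_bigr => i _.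
    rewrite {1}(basis_expand Hj v) S2; apply: eq_bigr => k _.
    by rewrite Z1 Z2 jB mulrA.
  rewrite !E mulr_sumr exchange_big; apply: eq_bigr => i _.
  rewrite mulr_sumr; apply: eq_bigr => k _.
  by rewrite (fC HB) rmorphM rmorph_sign; ring.
rewrite (basis_expand Hj x) big1 // => i _.
have [g gE] : exists g : 'Hom(F^o, U), forall (c : F^o) y, B (g c) y = c * coord (vbasis fullv) i y.
  apply: pairing_adj => //.
  - by move=> y a u v; rewrite (form_linl HB).
  - by move=> u a y z; rewrite (fDr HB) (fZr HB).
  - by move=> y a u v; rewrite mulrDl -mulrA.
  - by move=> u a y z; rewrite linearP mulrDr mulrCA.
  exact: (form_nondeg HB).
suff -> : coord (map_tuple j (vbasis {:U})) i x = 0 by rewrite scale0r.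
have Bg y : B y (g 1) = (-1) ^+ eps * coord (vbasis fullv) i y.
  by rewrite (fC HB) gE mul1r.
have := h (j (g 1)); rewrite {1}(basis_expand Hj x) S1 (bigD1 i) //= big1 ?addr0 => [|k ne].
  rewrite Z1 jB Bg (coord_free _ _ (basis_free (vbasisP fullv))) eqxx mulr1 rmorph_sign => /eqP.
  by rewrite mulf_eq0 signr_eq0 orbF => /eqP.
rewrite Z1 jB Bg (coord_free _ _ (basis_free (vbasisP fullv))).
by rewrite (negbTE ne) mulr0 rmorph0 mulr0.
Qed.

Section ExtSpaces.
Variables (F K : fieldType) (iota : {rmorphism F -> K}) (V : vectType F).
Local Notation ext := (ext iota).
Local Notation bV := (vbasis {:V}).

Lemma ext_bchange : bchange iota (ext : V -> _).
Proof.
have extD u v : ext (u + v) = ext u + ext v :> 'rV[K]_(\dim {:V}).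
  by apply/rowP => i; rewrite !mxE linearD rmorphD.
have extZ a u : ext (a *: u) = iota a *: ext u :> 'rV[K]_(\dim {:V}).
  by apply/rowP => i; rewrite !mxE linearZ rmorphM.
split=> //.
have ext_b (i : 'I_(\dim {:V})) : ext bV`_i = delta_mx 0 i.
  by apply/rowP => k; rewrite !mxE (coord_free _ _ (basis_free (vbasisP fullv))) eq_sym rmorph_nat.
rewrite basisEdim; apply/andP; split; last first.
  rewrite size_map size_tuple [leqRHS]dimvf dim_matrix; apply: eq_leq.
  exact: (esym (mul1n _)).
apply/subvP => x _; rewrite [x]row_sum_delta rpred_sum // => i _.
rewrite rpredZ // -ext_b memv_span // map_f // mem_nth // size_tuple //.
Qed.

(** If v is not in U, then v together with a basis of U is free, and stays free over K.
    *)
Lemma mem_ext (U : {vspace V}) v : (ext v \in ext_space iota U) = (v \in U).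
Proof.
have Hj := ext_bchange.
apply/idP/idP => [h|vU].
  apply: contraLR h => vU.
  have : free (map ext (v :: vbasis U)).
    by rewrite (bc_free Hj) free_cons (span_basis (vbasisP U)) vU (basis_free (vbasisP U)).
  by rewrite /= free_cons => /andP [].
rewrite (coord_basis (vbasisP U) vU) (bc_sum Hj) rpred_sum // => i _.
by rewrite (bchangeZ Hj) rpredZ // memv_span // map_f // mem_nth // size_tuple.
Qed.

Lemma dim_ext (U : {vspace V}) : \dim (ext_space iota U) = \dim U.
Proof.
have fr : free (map ext (vbasis U)) by rewrite (bc_free ext_bchange) (basis_free (vbasisP U)).
by rewrite (eqP fr) size_map size_tuple.
Qed.

Lemma ext_subE (U : {vspace V}) (x : subvs_of U) : vsval (ext_sub iota U x) = ext (vsval x).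
Proof. by rewrite vsprojK // mem_ext subvsP. Qed.

Lemma ext_sub_bchange (U : {vspace V}) : bchange iota (ext_sub iota U).
Proof.
split=> [u v|a u|].
- by apply: val_inj; rewrite /= !ext_subE (bchangeD ext_bchange).
- by apply: val_inj; rewrite /= !ext_subE (bchangeZ ext_bchange).
have dimE (G : fieldType) (T : vectType G) (A : {vspace T}) : \dim {: subvs_of A} = \dim A by rewrite dimvf.
rewrite basisEfree; apply/and3P; split; first last.
  by rewrite size_map size_tuple [leqRHS]dimE [leqLHS]dimE dim_ext.
  exact: subvf.
have valI (G : fieldType) (T : vectType G) (A : {vspace T}) (s : seq (subvs_of A)) :
  free s = free (map vsval s).
  have -> : map vsval s = map (linfun (@vsval _ _ A)) s by apply: eq_map => x; rewrite lfunE.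
  rewrite /free -limg_span limg_dim_eq ?size_map //.
  suff /eqP -> : lker (linfun (@vsval _ _ A)) == 0%VS by rewrite capv0.
  by apply/lker0P => x y; rewrite !lfunE => /val_inj.
rewrite valI -map_comp (eq_map (g := ext \o vsval)); last by move=> x; apply: ext_subE.
by rewrite map_comp (bc_free ext_bchange) -valI (basis_free (vbasisP fullv)).
Qed.

Variables (eps : bool) (Phi : V -> V -> F).
Hypothesis HPhi : isform eps Phi.
Local Notation PhiK := (ext_form iota Phi).

Lemma ext_formE u v : PhiK (ext u) (ext v) = iota (Phi u v).
Proof.
rewrite {2}(coord_basis (vbasisP fullv) (memvf u)) {2}(coord_basis (vbasisP fullv) (memvf v)).
rewrite (fsuml HPhi) rmorph_sum /ext_form /form -mulmxA mxE; apply: eq_bigr => i _.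
rewrite (fsumr HPhi) rmorph_sum !mxE big_distrr; apply: eq_bigr => k _ /=.
by rewrite !mxE (fZl HPhi) (fZr HPhi) !rmorphM /=; ring.
Qed.

Lemma isform_ext : isform eps PhiK.
Proof.
apply: (isform_bc ext_bchange HPhi).
- by move=> y a u v; rewrite /ext_form formDl formZl.
- by move=> y a u v; rewrite /ext_form formDr formZr.
exact: ext_formE.
Qed.

End ExtSpaces.

(** * The polar decomposition V = W + X + W' *)

(** The consequences of the hypotheses on V, W, W' and X that the proof uses. They are
    insensitive to the field, so that one statement serves over F and over K. *)
Record polar (F : fieldType) (V : vectType F) (eps : bool) (Phi : V -> V -> F)
    (W X W' : {vspace V}) : Prop := IsPolar {
  pl_form : isform eps Phi;
  pl_WW : forall u v, u \in W -> v \in W -> Phi u v = 0;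
  pl_W'W' : forall u v, u \in W' -> v \in W' -> Phi u v = 0;
  pl_WX : forall u v, u \in W -> v \in X -> Phi u v = 0;
  pl_W'X : forall u v, u \in W' -> v \in X -> Phi u v = 0;
  pl_full : (W + X + W' = fullv)%VS }.

Lemma polar_ext (F K : fieldType) (iota : {rmorphism F -> K}) (V : vectType F) (eps : bool)
    (Phi : V -> V -> F) (W X W' : {vspace V}) : polar eps Phi W X W' ->
  polar eps (ext_form iota Phi) (ext_space iota W) (ext_space iota X) (ext_space iota W').
Proof.
case=> Hf WW W'W' WX W'X fl.
have HK := isform_ext iota Hf.
have orth (A C : {vspace V}) : (forall u v, u \in A -> v \in C -> Phi u v = 0) ->
   forall u v, u \in ext_space iota A -> v \in ext_space iota C -> ext_form iota Phi u v = 0.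
  move=> AC u v /(@coord_span _ _ _ (map_tuple (ext iota) (vbasis A))) -> /(@coord_span _ _ _ (map_tuple (ext iota) (vbasis C))) ->.
  rewrite (fsuml HK) big1 // => i _; rewrite (fsumr HK) big1 // => k _.
  rewrite (fZl HK) (fZr HK) !(nth_map 0) ?size_tuple ?ltn_ord // (ext_formE _ Hf).
  by rewrite AC ?rmorph0 ?mulr0 // vbasis_mem // mem_nth // size_tuple.
split=> //; try exact: orth.
apply/eqP; rewrite eqEsubv subvf /=; apply/subvP => x _.
rewrite (basis_expand (ext_bchange iota V) x) rpred_sum // => i _; rewrite rpredZ //.
have : (vbasis fullv)`_i \in (W + X + W')%VS by rewrite fl memvf.
move=> /memv_addP [_ /memv_addP [w wW [y yX ->]] [w' w'W' ->]].
by rewrite !(bchangeD (ext_bchange iota V)) !memv_add ?mem_ext.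
Qed.

Definition subform (F : fieldType) (V : vectType F) (Phi : V -> V -> F) (X : {vspace V})
    (x y : subvs_of X) : F := Phi (vsval x) (vsval y).
Arguments subform {F V} Phi X x y.

Section BijLfun.
Variables (F : fieldType) (A C : vectType F).
Implicit Types f : 'Hom(A, C).

Lemma bij_lker0 f : bijective f -> lker f == 0%VS.
Proof. by move=> bf; apply/lker0P/bij_inj. Qed.
Lemma bij_invl f : bijective f -> forall x, (f^-1)%VF (f x) = x.
Proof. by move=> bf x; rewrite lker0_lfunK // bij_lker0. Qed.
Lemma bij_invr f : bijective f -> forall y, f ((f^-1)%VF y) = y.
Proof.
move=> bf y; rewrite limg_lfunVK //; have [g fg gf] := bf.
by rewrite -[y]gf memv_img ?memvf.
Qed.
Lemma inj_bij f : \dim {:A} = \dim {:C} -> injective f -> bijective f.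
Proof.
move=> dE /lker0P k0; have lE : limg f = fullv.
  by apply/eqP; rewrite eqEdim subvf /= limg_dim_eq ?(eqP k0) ?capv0 // dE.
exists (f^-1)%VF => x; first by rewrite lker0_lfunK.
by rewrite limg_lfunVK // lE memvf.
Qed.
Lemma inv_bij f : bijective f -> bijective (f^-1)%VF.
Proof. by move=> bf; exists f; [exact: bij_invr|exact: bij_invl]. Qed.
End BijLfun.

Lemma bij_invK (F : fieldType) (A C : vectType F) (f : 'Hom(A, C)) :
  bijective f -> ((f^-1)^-1)%VF = f.
Proof.
move=> bf; apply/lfunP => x; apply: (bij_inj (inv_bij bf)).
by rewrite (bij_invr (inv_bij bf)) bij_invl.
Qed.

Section NCalc.
Variables (F : fieldType) (V : vectType F) (eps : bool) (Phi : V -> V -> F).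
Variables (W X W' : {vspace V}).
Hypothesis HP : polar eps Phi W X W'.
Hypothesis two : 2%:R != 0 :> F.
Let HV := pl_form HP.
Local Notation sg := ((-1) ^+ eps : F).
Local Notation "<< u , v >>" := (Phi (vsval u) (vsval v)).
Local Notation Wt := (subvs_of W).
Local Notation Xt := (subvs_of X).
Local Notation W't := (subvs_of W').

Lemma pairC (A C : {vspace V}) (u : subvs_of A) (v : subvs_of C) : <<u, v>> = sg * <<v, u>>.
Proof. exact: (fC HV). Qed.

Lemma polar_decomp v : exists (w : Wt) (x : Xt) (w' : W't), v = vsval w + vsval x + vsval w'.
Proof.
have : v \in (W + X + W')%VS by rewrite (pl_full HP) memvf.
move=> /memv_addP [_ /memv_addP [w wW [x xX ->]] [w' w'W' ->]].
exists (vsproj W w), (vsproj X x), (vsproj W' w'); by rewrite /= !vsprojK.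
Qed.

Lemma WW0 (u v : Wt) : <<u, v>> = 0. Proof. by apply: (pl_WW HP); apply: subvsP. Qed.
Lemma W'W'0 (u v : W't) : <<u, v>> = 0. Proof. by apply: (pl_W'W' HP); apply: subvsP. Qed.
Lemma WX0 (u : Wt) (v : Xt) : <<u, v>> = 0. Proof. by apply: (pl_WX HP); apply: subvsP. Qed.
Lemma W'X0 (u : W't) (v : Xt) : <<u, v>> = 0. Proof. by apply: (pl_W'X HP); apply: subvsP. Qed.
Lemma XW0 (u : Xt) (v : Wt) : <<u, v>> = 0. Proof. by rewrite pairC WX0 mulr0. Qed.
Lemma XW'0 (u : Xt) (v : W't) : <<u, v>> = 0. Proof. by rewrite pairC W'X0 mulr0. Qed.

Lemma W_nd (w : Wt) : (forall w' : W't, <<w, w'>> = 0) -> w = 0.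
Proof.
move=> h; apply: val_inj; apply: (form_nondeg HV) => v.
have [w1 [x [w' ->]]] := polar_decomp v.
by rewrite !(fDr HV) WW0 WX0 h !addr0.
Qed.
Lemma W'_nd (w : W't) : (forall w' : Wt, <<w, w'>> = 0) -> w = 0.
Proof.
move=> h; apply: val_inj; apply: (form_nondeg HV) => v.
have [w1 [x [w' ->]]] := polar_decomp v.
by rewrite !(fDr HV) W'W'0 W'X0 h !addr0.
Qed.
Lemma X_nd (x : Xt) : (forall y : Xt, <<x, y>> = 0) -> x = 0.
Proof.
move=> h; apply: val_inj; apply: (form_nondeg HV) => v.
have [w1 [y [w' ->]]] := polar_decomp v.
by rewrite !(fDr HV) XW0 XW'0 h !addr0.
Qed.

Lemma subform_isform : isform eps (subform Phi X).
Proof.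
split=> [a x y z|x y|x].
- by rewrite /subform linearP (form_linl HV).
- exact: pairC.
exact: X_nd.
Qed.

Lemma dim_subvs (A : {vspace V}) : \dim {: subvs_of A} = \dim A.
Proof. by rewrite dimvf. Qed.

Lemma pairing_linl (A C : {vspace V}) (v : subvs_of C) : linear_for *%R (fun u : subvs_of A => <<u, v>>).
Proof. by move=> a x y; rewrite linearP (form_linl HV). Qed.
Lemma pairing_linr (A C : {vspace V}) (u : subvs_of A) : linear_for *%R (fun v : subvs_of C => <<u, v>>).
Proof. by move=> a x y; rewrite linearP (fDr HV) (fZr HV). Qed.

Lemma dimWW' : \dim W = \dim W'.
Proof.
have le (A C : {vspace V}) : (forall u : subvs_of A, (forall v : subvs_of C, <<u, v>> = 0) -> u = 0) ->
    (\dim A <= \dim C)%N.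
  move=> nd; pose L := linfun (fun u : subvs_of A => linfun (fun v : subvs_of C => <<u, v>> : F^o)).
  have E1 u v : linfun (fun v : subvs_of C => <<u, v>> : F^o) v = <<(u : subvs_of A), v>>.
    by apply: linfun_linE; apply: pairing_linr.
  have E2 u : L u = linfun (fun v : subvs_of C => <<u, v>> : F^o).
    apply: linfun_linE => a x y; apply/lfunP => v; rewrite add_lfunE scale_lfunE !E1.
    exact: pairing_linl.
  have L0 : lker L == 0%VS.
    apply/lker0P => x y; rewrite !E2 => /lfunP Lxy; apply/subr0_eq/nd => v.
    by rewrite linearB (fBl HV) -!E1 Lxy subrr.
  have := limg_dim_eq (_ : (fullv :&: lker L = 0)%VS); rewrite (eqP L0) capv0 => /(_ erefl).
  rewrite dim_subvs => <-; apply: leq_trans (dimvS (subvf _)) _.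
  by rewrite dimvf /= /dim /= muln1.
by apply/eqP; rewrite eqn_leq !le //; [exact: W'_nd|exact: W_nd].
Qed.

(** W' and X are dual to W and X under the form, so the adjoint exists and the choice in
    its definition is not a default value. *)
Lemma adj_xiE (xi : 'Hom(Xt, Wt)) (c : W't) (a : Xt) : <<adj_xi Phi W' xi c, a>> = <<c, xi a>>.
Proof.
move: c a; apply: (@xgetPex _ 0 [set g : 'Hom(W't, Xt) | forall c a, <<g c, a>> = <<c, xi a>>]).
apply: (@pairing_adj F _ _ _ (fun u v : Xt => <<u, v>>) (fun (c : W't) (a : Xt) => <<c, xi a>>)) => //;
  try (by move=> ?; apply: pairing_linl); try (by move=> ?; apply: pairing_linr).
  by move=> c a x y; rewrite linearP pairing_linr.
exact: X_nd.
Qed.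

Lemma adj_etaE (eta : 'Hom(W't, Wt)) (c : W't) (a : W't) : <<adj_eta Phi eta c, a>> = <<c, eta a>>.
Proof.
move: c a; apply: (@xgetPex _ 0 [set g : 'Hom(W't, Wt) | forall c a, <<g c, a>> = <<c, eta a>>]).
apply: (@pairing_adj F _ _ _ (fun (u : Wt) (v : W't) => <<u, v>>) (fun (c a : W't) => <<c, eta a>>)) => //;
  try (by move=> ?; apply: pairing_linl); try (by move=> ?; apply: pairing_linr).
- by move=> c a x y; rewrite linearP pairing_linr.
- exact: W_nd.
by rewrite !dim_subvs dimWW'.
Qed.

Lemma X_inj (x y : Xt) : (forall z : Xt, <<x, z>> = <<y, z>>) -> x = y.
Proof. by move=> h; apply/subr0_eq/X_nd => z; rewrite linearB (fBl HV) h subrr. Qed.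
Lemma W_inj (x y : Wt) : (forall z : W't, <<x, z>> = <<y, z>>) -> x = y.
Proof. by move=> h; apply/subr0_eq/W_nd => z; rewrite linearB (fBl HV) h subrr. Qed.
Lemma W_injr (x y : Wt) : (forall z : W't, <<z, x>> = <<z, y>>) -> x = y.
Proof. by move=> h; apply: W_inj => z; rewrite pairC h -pairC. Qed.

Lemma adj_xi_uniq (xi : 'Hom(Xt, Wt)) (g : 'Hom(W't, Xt)) :
  (forall c a, <<g c, a>> = <<c, xi a>>) -> g = adj_xi Phi W' xi.
Proof. by move=> h; apply/lfunP => c; apply: X_inj => a; rewrite h adj_xiE. Qed.
Lemma adj_eta_uniq (eta : 'Hom(W't, Wt)) (g : 'Hom(W't, Wt)) :
  (forall c a, <<g c, a>> = <<c, eta a>>) -> g = adj_eta Phi eta.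
Proof. by move=> h; apply/lfunP => c; apply: W_inj => a; rewrite h adj_etaE. Qed.

Lemma polar_eq (T : vectType F) (g1 g2 : 'Hom(V, T)) :
  (forall w : Wt, g1 (vsval w) = g2 (vsval w)) -> (forall x : Xt, g1 (vsval x) = g2 (vsval x)) ->
  (forall w' : W't, g1 (vsval w') = g2 (vsval w')) -> g1 = g2.
Proof.
move=> h1 h2 h3; apply/lfunP => v; have [w [x [w' ->]]] := polar_decomp v.
by rewrite !linearD /= h1 h2 h3.
Qed.

Lemma prjv_id (A C : {vspace V}) (a : subvs_of A) : (A :&: C = 0)%VS -> prjv A C (vsval a) = a.
Proof.
move=> d; rewrite /prjv comp_lfunE lfunE /= daddv_pi_id ?subvsP //; exact: vsvalK.
Qed.
Lemma prjv_0 (A C : {vspace V}) (v : V) : (A :&: C = 0)%VS -> v \in C -> prjv A C v = 0.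
Proof.
move=> d vC; rewrite /prjv comp_lfunE lfunE /=.
have := daddv_pi_add d (_ : v \in (A + C)%VS); rewrite (subvP (addvSr _ _)) // => /(_ isT).
rewrite [daddv_pi C A v]daddv_pi_id // 1?capvC // => /(congr1 (fun z => z - v)).
by rewrite addrK subrr => ->; rewrite linear0.
Qed.

Lemma capXWW' : (X :&: (W + W') = 0)%VS.
Proof.
apply/eqP; rewrite -subv0; apply/subvP => v; rewrite memv_cap => /andP [vX /memv_addP [w wW [w' w'W' e]]].
rewrite memv0; apply/eqP; apply: (form_nondeg HV) => u.
have [w1 [x [w2 ->]]] := polar_decomp u.
have vx : Phi v (vsval x) = 0 by rewrite e (fDl HV) (pl_WX HP) ?(pl_W'X HP) ?addr0 //; apply: subvsP.
have -> : v = vsval (vsproj X v) by rewrite vsprojK.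
by rewrite !(fDr HV) XW0 XW'0 add0r addr0 vsprojK.
Qed.
Lemma capW'WX : (W' :&: (W + X) = 0)%VS.
Proof.
apply/eqP; rewrite -subv0; apply/subvP => v; rewrite memv_cap => /andP [vW' /memv_addP [w wW [x xX e]]].
have -> : v = vsval (vsproj W' v) by rewrite vsprojK.
rewrite memv0; apply/eqP; apply/(congr1 vsval (y := 0))/W'_nd => u; rewrite vsprojK // e (fDl HV).
rewrite (pl_WW HP) ?subvsP // add0r (fC HV) (pl_WX HP) ?mulr0 //; exact: subvsP.
Qed.

Section NMap.
Variables (xi : 'Hom(Xt, Wt)) (eta : 'Hom(W't, Wt)).
Local Notation xs := (adj_xi Phi W' xi).
Local Notation es := (adj_eta Phi eta).
Local Notation n := (nmap Phi xi eta).

Lemma nmapE v : n v = v + vsval (xi (prjv X (W + W') v)) +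
  (vsval (eta (prjv W' (W + X) v)) - vsval (xs (prjv W' (W + X) v))).
Proof.
by rewrite /nmap !add_lfunE id_lfunE !comp_lfunE add_lfunE opp_lfunE !comp_lfunE !lfunE.
Qed.
Lemma nmap_W (w : Wt) : n (vsval w) = vsval w.
Proof.
rewrite nmapE prjv_0 ?capXWW' ?(subvP (addvSl _ _)) ?subvsP //.
rewrite prjv_0 ?capW'WX ?(subvP (addvSl _ _)) ?subvsP //.
by rewrite !linear0 ?subrr !addr0.
Qed.
Lemma nmap_X (x : Xt) : n (vsval x) = vsval x + vsval (xi x).
Proof.
rewrite nmapE prjv_id ?capXWW' // prjv_0 ?capW'WX ?(subvP (addvSr _ _)) ?subvsP //.
by rewrite !linear0 ?subrr !addr0.
Qed.
Lemma nmap_W' (w : W't) : n (vsval w) = vsval w + (vsval (eta w) - vsval (xs w)).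
Proof.
rewrite nmapE prjv_0 ?capXWW' ?(subvP (addvSr _ _)) ?subvsP // prjv_id ?capW'WX //.
by rewrite !linear0 addr0.
Qed.

Hypothesis beta : bijective eta.
Local Notation h := (Norm Phi xi eta).

Lemma NormE x : h x = x + xs ((eta^-1)%VF (xi x)).
Proof. by rewrite /Norm add_lfunE id_lfunE !comp_lfunE. Qed.

(** Norm is an isometry exactly to the extent that eta + eta^* + xi xi^* vanishes. *)
Lemma Norm_form x y : <<h x, h y>> - <<x, y>> =
  <<(eta^-1)%VF (xi x), (eta + es + (xi \o xs)%VF) ((eta^-1)%VF (xi y))>>.
Proof.
rewrite !NormE !linearD /= !(fDl HV) !(fDr HV) !add_lfunE comp_lfunE !linearD /= !(fDr HV).
set a := (eta^-1)%VF (xi x); set b := (eta^-1)%VF (xi y).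
have xa : xi x = eta a by rewrite bij_invr.
have yb : xi y = eta b by rewrite bij_invr.
rewrite (pairC x (xs b)) !adj_xiE xa yb.
have -> : <<a, es b>> = sg * <<b, eta a>> by rewrite pairC adj_etaE.
by ring.
Qed.
End NMap.
End NCalc.

(** * The action of M, and the normal form of the elements over a torus *)

Section Adjoint.
Variables (F : fieldType) (V : vectType F) (eps : bool) (Phi : V -> V -> F).
Variables (W X W' : {vspace V}).
Hypothesis HP : polar eps Phi W X W'.
Hypothesis two : 2%:R != 0 :> F.
Let HV := pl_form HP.
Local Notation sg := ((-1) ^+ eps : F).
Local Notation "<< u , v >>" := (Phi (vsval u) (vsval v)).
Local Notation Wt := (subvs_of W).
Local Notation Xt := (subvs_of X).
Local Notation W't := (subvs_of W').

Lemma isom_bij (h : 'End(Xt)) : isom Phi X h -> bijective h.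
Proof.
move=> ih; apply: inj_bij => //; apply/lker0P.
by apply: (isometry_bij (subform_isform HP)) => x y; apply: ih.
Qed.

(** The three restrictions of an element of M to W, X and W'. *)
Record triple (m : 'End(V)) (g : 'End(Wt)) (h : 'End(Xt)) (g' : 'End(W't)) : Prop := IsTriple {
  tr_iso : forall u v, Phi (m u) (m v) = Phi u v;
  tr_g : forall w, m (vsval w) = vsval (g w);
  tr_h : forall x, m (vsval x) = vsval (h x);
  tr_g' : forall w', m (vsval w') = vsval (g' w');
  tr_gb : bijective g; tr_hb : bijective h; tr_g'b : bijective g' }.

Lemma capWXW' : (W :&: (X + W') = 0)%VS.
Proof.
apply/eqP; rewrite -subv0; apply/subvP => v; rewrite memv_cap => /andP [vW /memv_addP [x xX [w' w'W' e]]].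
have -> : v = vsval (vsproj W v) by rewrite vsprojK.
rewrite memv0; apply/eqP; apply/(congr1 vsval (y := 0))/(W_nd HP) => u; rewrite vsprojK // e (fDl HV).
have u1 := pl_W'X HP (subvsP u) xX; have u2 := pl_W'W' HP w'W' (subvsP u).
by rewrite u2 addr0 (fC HV) u1 mulr0.
Qed.

Lemma Mset_triple m : Mset Phi W X W' m -> exists g h g', triple m g h g'.
Proof.
case=> im mW mX mW'.
have m0 := isometry_bij HV im.
have res (A : {vspace V}) : (m @: A)%VS = A ->
    exists2 g : 'End(subvs_of A), (forall a, m (vsval a) = vsval (g a)) & bijective g.
  move=> mA; pose g := linfun (fun a : subvs_of A => vsproj A (m (vsval a))).
  have gE a : m (vsval a) = vsval (g a).
    rewrite linfun_linE; last by move=> c x y; rewrite !linearP.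
    by rewrite vsprojK // -{2}mA memv_img ?subvsP.
  exists g => //; apply: inj_bij => // x y gxy; apply: val_inj.
  by apply: (lker0P m0); rewrite /= !gE gxy.
have [g gE gb] := res _ mW; have [h hE hb] := res _ mX; have [g' g'E g'b] := res _ mW'.
by exists g, h, g'; split.
Qed.

Lemma triple_Mset m g h g' : triple m g h g' -> Mset Phi W X W' m.
Proof.
case=> im gE hE g'E gb hb g'b.
have im_ (A : {vspace V}) (k : 'End(subvs_of A)) : (forall a, m (vsval a) = vsval (k a)) ->
   bijective k -> (m @: A)%VS = A.
  move=> kE kb; apply/eqP; rewrite eqEsubv; apply/andP; split; apply/subvP => v.
    by move=> /memv_imgP [u uA ->]; rewrite -(vsprojK uA) kE subvsP.
  move=> vA; apply/memv_imgP; exists (vsval ((k^-1)%VF (vsproj A v))); first exact: subvsP.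
  by rewrite kE bij_invr // vsprojK.
by split=> //; [apply: im_ gE gb|apply: im_ hE hb|apply: im_ g'E g'b].
Qed.

(** The component on W' is forced to be the inverse adjoint of g. *)
Lemma triple_exists (g : 'End(Wt)) (h : 'End(Xt)) : bijective g -> isom Phi X h -> exists m g', triple m g h g'.
Proof.
move=> gb ih; have hb := isom_bij ih.
have [g' g'E] : exists g' : 'End(W't), forall (c : W't) (w : Wt), <<g' c, w>> = <<c, (g^-1)%VF w>>.
  apply: (@pairing_adj F _ _ _ (fun (u : W't) (v : Wt) => <<u, v>>) (fun (c : W't) (a : Wt) => <<c, (g^-1)%VF a>>)) => //;
  try (by move=> ?; apply: (pairing_linl HP)); try (by move=> ?; apply: (pairing_linr HP)).
  - by move=> c a x y; rewrite linearP (pairing_linr HP).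
  - exact: (W'_nd HP).
  by rewrite !dim_subvs (dimWW' HP).
have g'g c w : <<g' c, g w>> = <<c, w>> by rewrite g'E bij_invl.
pose m := ((incv W \o g \o prjv W (X + W')) + (incv X \o h \o prjv X (W + W')) +
  (incv W' \o g' \o prjv W' (W + X)))%VF.
have mE v : m v = vsval (g (prjv W (X + W') v)) + vsval (h (prjv X (W + W') v)) +
   vsval (g' (prjv W' (W + X) v)).
  by rewrite !add_lfunE !comp_lfunE !lfunE.
have c1 := capXWW' HP; have c2 := capW'WX HP; have c3 := capWXW'.
have mg w : m (vsval w) = vsval (g w).
  rewrite mE prjv_id // prjv_0 ?(subvP (addvSl _ _)) ?subvsP // prjv_0 ?(subvP (addvSl _ _)) ?subvsP //.
  by rewrite !linear0 !addr0.
have mh x : m (vsval x) = vsval (h x).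
  rewrite mE prjv_0 ?(subvP (addvSl _ _)) ?subvsP // prjv_id // prjv_0 ?(subvP (addvSr _ _)) ?subvsP //.
  by rewrite !linear0 add0r addr0.
have mg' w : m (vsval w) = vsval (g' w).
  rewrite mE prjv_0 ?(subvP (addvSr _ _)) ?subvsP // prjv_0 ?(subvP (addvSr _ _)) ?subvsP // prjv_id //.
  by rewrite !linear0 !add0r.
exists m, g'; split=> //; last first.
  apply: inj_bij => // x y gxy; apply/subr0_eq/(W'_nd HP) => w.
  by rewrite -g'g linearB /= gxy subrr (f0l HV).
move=> u v; have [a [x [b ->]]] := polar_decomp HP u; have [a' [x' [b' ->]]] := polar_decomp HP v.
rewrite !linearD /= !mg !mh !mg' !(fDl HV) !(fDr HV).
rewrite !(WW0 HP) !(WX0 HP) !(XW0 HP) !(XW'0 HP) !(W'X0 HP) !(W'W'0 HP) ih g'g.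
by rewrite (fC HV (vsval (g a))) g'g -(fC HV).
Qed.

Lemma triple_inv m g h g' : triple m g h g' ->
  triple (m^-1)%VF (g^-1)%VF (h^-1)%VF (g'^-1)%VF.
Proof.
case=> im gE hE g'E gb hb g'b.
have mb : bijective m by apply: inj_bij => //; apply/lker0P/(isometry_bij HV).
split; try exact: inv_bij.
- by move=> u v; rewrite -im !bij_invr.
- by move=> w; apply: (bij_inj mb); rewrite bij_invr // gE bij_invr.
- by move=> w; apply: (bij_inj mb); rewrite bij_invr // hE bij_invr.
by move=> w; apply: (bij_inj mb); rewrite bij_invr // g'E bij_invr.
Qed.

Lemma conj_invK (m f : 'End(V)) : bijective m -> conj_lfun m (conj_lfun (m^-1)%VF f) = f.
Proof.
move=> mb; apply/lfunP => x; rewrite /conj_lfun !comp_lfunE bij_invK //.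
by rewrite !bij_invr.
Qed.

Lemma triple_bij m g h g' : triple m g h g' -> bijective m.
Proof. by move=> t; apply: inj_bij => //; apply/lker0P/(isometry_bij HV); apply: (tr_iso t). Qed.

Section AdNMap.
Variables (m : 'End(V)) (g : 'End(Wt)) (h : 'End(Xt)) (g' : 'End(W't)).
Hypothesis tr : triple m g h g'.
Variables (xi : 'Hom(Xt, Wt)) (eta : 'Hom(W't, Wt)).
Local Notation xi2 := (g \o xi \o h^-1)%VF.
Local Notation eta2 := (g \o eta \o g'^-1)%VF.

Lemma tr_hiso : isom Phi X h.
Proof. by move=> x y; rewrite -!(tr_h tr) (tr_iso tr). Qed.

Lemma Ad_xs c : adj_xi Phi W' xi2 c = h (adj_xi Phi W' xi ((g'^-1)%VF c)).
Proof.
suff -> : adj_xi Phi W' xi2 = (h \o adj_xi Phi W' xi \o g'^-1)%VF by rewrite !comp_lfunE.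
apply/esym/(adj_xi_uniq HP) => d a; rewrite !comp_lfunE.
rewrite -{1}[a](bij_invr (tr_hb tr)) tr_hiso (adj_xiE HP).
rewrite -{2}[d](bij_invr (tr_g'b tr)).
by rewrite -(tr_g' tr) -(tr_g tr) (tr_iso tr).
Qed.

Lemma Ad_es c : adj_eta Phi eta2 c = g (adj_eta Phi eta ((g'^-1)%VF c)).
Proof.
suff -> : adj_eta Phi eta2 = (g \o adj_eta Phi eta \o g'^-1)%VF by rewrite !comp_lfunE.
apply/esym/(adj_eta_uniq HP) => d a; rewrite !comp_lfunE.
rewrite -{1}[a](bij_invr (tr_g'b tr)) -(tr_g' tr) -[in LHS](tr_g tr) (tr_iso tr) (adj_etaE HP).
rewrite -{2}[d](bij_invr (tr_g'b tr)).
by rewrite -(tr_g' tr) -(tr_g tr) (tr_iso tr).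
Qed.

Lemma Ad_nmap : conj_lfun m (nmap Phi xi eta) = nmap Phi xi2 eta2.
Proof.
have mb := triple_bij tr; have ti := triple_inv tr.
apply: (polar_eq HP) => w; rewrite /conj_lfun !comp_lfunE.
- by rewrite (tr_g ti) !(nmap_W HP) (tr_g tr) bij_invr //; apply: (tr_gb tr).
- rewrite (tr_h ti) !(nmap_X HP) linearD /= (tr_h tr) (tr_g tr) bij_invr; last exact: (tr_hb tr).
  by rewrite !comp_lfunE.
rewrite (tr_g' ti) !(nmap_W' HP) linearD linearB /= (tr_g' tr) (tr_g tr) (tr_h tr).
rewrite bij_invr; last exact: (tr_g'b tr).
by rewrite !comp_lfunE Ad_xs.
Qed.

Lemma Ad_Nrel : Nrel Phi xi eta -> Nrel Phi xi2 eta2.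
Proof.
rewrite /Nrel => /lfunP e; apply/lfunP => c; have := e ((g'^-1)%VF c).
rewrite !add_lfunE !comp_lfunE !zero_lfunE Ad_es Ad_xs bij_invl; last exact: (tr_hb tr).
by rewrite -!linearD /= => ->; rewrite linear0.
Qed.

Lemma Ad_bij : bijective eta -> bijective eta2.
Proof.
move=> be; apply: inj_bij; first by rewrite !dim_subvs (dimWW' HP).
move=> x y; rewrite !comp_lfunE => /(bij_inj (tr_gb tr)) /(bij_inj be).
exact: (bij_inj (inv_bij (tr_g'b tr))).
Qed.

Lemma Ad_Norm : bijective eta -> Norm Phi xi2 eta2 = conj_lfun h (Norm Phi xi eta).
Proof.
move=> be; apply/lfunP => x; rewrite /conj_lfun !comp_lfunE !NormE linearD /=.
rewrite bij_invr; last exact: (tr_hb tr).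
rewrite Ad_xs; congr (_ + h (adj_xi _ _ _ _)).
apply: (bij_inj (inv_bij (inv_bij (tr_g'b tr)))); rewrite bij_invK; last exact: (tr_g'b tr).
rewrite bij_invr; last exact: (tr_g'b tr).
apply: (bij_inj (Ad_bij be)); rewrite bij_invr; last exact: Ad_bij.
rewrite !comp_lfunE bij_invl; last exact: (tr_g'b tr).
by rewrite bij_invr.
Qed.
End AdNMap.

(** What is used of an element gamma of S_r and a map xi with kernel E: E is the fixed
    space of gamma, of codimension k, and no nonzero vector of the image of gamma - 1 is
    fixed. *)
Record compatible (xi : 'Hom(Xt, Wt)) (gamma : 'End(Xt)) : Prop := IsCompatible {
  gd_iso : isom Phi X gamma;
  gd_ker : forall x, xi x = 0 <-> gamma x = x;
  gd_dim : \dim (limg (gamma - \1)%VF%R) = \dim W;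
  gd_cap : forall x, gamma (gamma x - x) = gamma x - x -> gamma x = x }.

Section NS.
Variables (xi : 'Hom(Xt, Wt)) (gamma : 'End(Xt)).
Hypothesis Hg : compatible xi gamma.
Local Notation xs := (adj_xi Phi W' xi).
Local Notation d := (gamma - \1)%VF%R.

Lemma gd_dE x : d x = gamma x - x.
Proof. by rewrite add_lfunE opp_lfunE id_lfunE. Qed.

Lemma gd_dker x : xi x = 0 <-> d x = 0.
Proof.
rewrite gd_dE; split=> [/(gd_ker Hg) ->|/subr0_eq/(gd_ker Hg) //]; exact: subrr.
Qed.

Lemma gd_kerE : lker d = lker xi.
Proof.
apply/eqP; rewrite eqEsubv; apply/andP; split; apply/subvP => x; rewrite !memv_ker => /eqP h;
  by apply/eqP/gd_dker.
Qed.

Lemma gd_surj : limg xi = fullv.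
Proof.
apply/eqP; rewrite eqEdim subvf /= dim_subvs -(gd_dim Hg).
have := limg_ker_dim xi fullv; have := limg_ker_dim d fullv.
by rewrite !capfv gd_kerE => <- /eqP; rewrite eqn_add2l => /eqP ->.
Qed.

Lemma gd_pre w : exists x, xi x = w.
Proof.
have : w \in limg xi by rewrite gd_surj memvf.
by move=> /memv_imgP [x _ ->]; exists x.
Qed.

(** gamma is an isometry and fixes y. *)
Lemma gd_perp x y : xi y = 0 -> <<d x, y>> = 0.
Proof.
move=> /(gd_ker Hg) gy; rewrite gd_dE linearB (fBl HV) -{1}gy (gd_iso Hg) subrr //.
Qed.

Lemma gd_decomp x : exists y z, [/\ xi y = 0 & x = y + d z].
Proof.
have : x \in (lker d + limg d)%VS.
  rewrite (_ : (_ + _)%VS = fullv) ?memvf //; apply/eqP.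
  rewrite eqEdim subvf /= dimv_disjoint_sum.
    by have := limg_ker_dim d fullv; rewrite capfv => ->.
  apply/eqP; rewrite -subv0; apply/subvP => v; rewrite memv_cap memv_ker => /andP [/eqP dv /memv_imgP [u _ e]].
  rewrite memv0 e gd_dE; apply/eqP; rewrite (gd_cap Hg) ?subrr //.
  by apply/eqP; rewrite -subr_eq0 -gd_dE -gd_dE -e dv.
move=> /memv_addP [y yk [_ /memv_imgP [z _ ->] ->]]; exists y, z; split=> //.
by apply/gd_dker/eqP; rewrite -memv_ker.
Qed.

(** X is the orthogonal sum of the fixed space, which is the kernel of xi, and of the
    image of gamma - 1; hence the form is nondegenerate on the fixed space. *)
Lemma gd_perp0 x : xi x = 0 -> (forall y, xi y = 0 -> <<x, y>> = 0) -> x = 0.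
Proof.
move=> x0 h; apply: (X_nd HP) => y; have [u [z [u0 ->]]] := gd_decomp y.
rewrite linearD (fDr HV) h // add0r (fC HV) gd_perp // mulr0 //.
Qed.

Lemma gd_xs_perp c y : xi y = 0 -> <<xs c, y>> = 0.
Proof. by move=> y0; rewrite (adj_xiE HP) y0 linear0 (f0r HV). Qed.

Lemma gd_xxs_bij : bijective (xi \o xs)%VF.
Proof.
apply: inj_bij; first by rewrite !dim_subvs (dimWW' HP).
apply/lker0P; rewrite -subv0; apply/subvP => c; rewrite memv_ker comp_lfunE => /eqP c0.
rewrite memv0; apply/eqP; apply: (W'_nd HP) => w; have [x <-] := gd_pre w.
by rewrite -(adj_xiE HP) (gd_perp0 c0) ?linear0 ?(f0l HV) // => y; apply: gd_xs_perp.
Qed.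

Local Notation ups := (upsilon Phi W' xi).
Local Notation D := (xi \o d \o xi_plus Phi W' xi)%VF.

Lemma upsK w : xi (xs (ups w)) = w.
Proof. by rewrite -[xi (xs _)]comp_lfunE /upsilon bij_invr //; apply: gd_xxs_bij. Qed.

Lemma gd_D_bij : bijective D.
Proof.
apply: inj_bij => //; apply/lker0P; rewrite -subv0; apply/subvP => w; rewrite memv_ker !comp_lfunE => /eqP w0.
rewrite memv0; apply/eqP; rewrite -[w]upsK; apply/gd_dker/gd_perp0 => // y; exact: gd_perp.
Qed.

Local Notation eta := (gammaG Phi W' xi gamma \o (upsilon Phi W' xi)^-1)%VF.

Lemma nS_etaE c : eta c = (D^-1)%VF (xi (xs c)).
Proof.
rewrite comp_lfunE /upsilon bij_invK ?comp_lfunE //; exact: gd_xxs_bij.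
Qed.

Lemma nS_bij : bijective eta.
Proof.
apply: inj_bij; first by rewrite !dim_subvs (dimWW' HP).
move=> x y; rewrite !nS_etaE => /(bij_inj (inv_bij gd_D_bij)).
by rewrite -!comp_lfunE => /(bij_inj gd_xxs_bij).
Qed.

(** The image of xi^* is the image of gamma - 1, both being the complement of the kernel
    of xi, and xi^+ xi is the projection onto it. *)
Lemma nS_Norm : Norm Phi xi eta = gamma.
Proof.
have P x : xi (x - xs (ups (xi x))) = 0 by rewrite linearB /= upsK subrr.
apply/lfunP => x; rewrite NormE.
have -> : (eta^-1)%VF (xi x) = ups (D (xi x)).
  apply: (bij_inj nS_bij); rewrite bij_invr; last exact: nS_bij.
  by rewrite nS_etaE upsK bij_invl //; apply: gd_D_bij.
rewrite !comp_lfunE.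
have -> : d (xs (ups (xi x))) = d x.
  have /gd_dker := P x; rewrite linearB /= => /subr0_eq ->.
  by [].
have -> : xs (ups (xi (d x))) = d x.
  apply/esym/subr0_eq/gd_perp0 => // y y0.
  by rewrite linearB (fBl HV) gd_perp // gd_xs_perp // subrr.
by rewrite gd_dE addrC subrK.
Qed.

(** The converse reading of Norm_form: gamma = Norm preserves the form, and eta^-1 xi is
    surjective. *)
Lemma nS_Nrel : Nrel Phi xi eta.
Proof.
apply/lfunP => c; rewrite zero_lfunE; apply: (W_injr HP) => a; rewrite linear0 (f0r HV).
have [x xE] := gd_pre (eta a); have [y yE] := gd_pre (eta c).
rewrite -[a](bij_invl nS_bij) -[c](bij_invl nS_bij) -xE -yE -(Norm_form HP) ?nS_Norm; last exact: nS_bij.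
by rewrite (gd_iso Hg) subrr.
Qed.

Lemma nS_uniq (eta' : 'Hom(W't, Wt)) : bijective eta' -> Norm Phi xi eta' = gamma -> eta' = eta.
Proof.
move=> be N; apply/lfunP => c; rewrite nS_etaE; apply: (bij_inj gd_D_bij).
rewrite bij_invr; last exact: gd_D_bij.
rewrite !comp_lfunE gd_dE -N NormE addrC addKr upsK bij_invl //.
Qed.
End NS.

(** Conjugating by an element of H, one may assume Norm(n) = gamma. Then the kernel of
    the first component xi' is the fixed space of gamma, for dimension reasons, so xi' =
    g xi for some g in GL(W), and the second component is determined by nS_uniq. *)
Lemma NS_eq (A : set 'End(Xt)) (xi : 'Hom(Xt, Wt)) : (forall gamma, A gamma -> compatible xi gamma) ->
  Norm_preim Phi W W' (conjugates (isom Phi X) A) =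
  [set conj_lfun m (nS Phi W' xi gamma) | m in Mset Phi W X W' & gamma in A].
Proof.
move=> gA; apply/seteqP; split=> [n [xi' [eta [nr be nE [h ih [gamma Ag hE]]]]]|_ [m Mm [gamma Ag <-]]]; last first.
  have Hg := gA _ Ag; have [g [h [g' tr]]] := Mset_triple Mm.
  have be := nS_bij Hg.
  exists (g \o xi \o h^-1)%VF, (g \o (gammaG Phi W' xi gamma \o (upsilon Phi W' xi)^-1) \o g'^-1)%VF; split.
  - exact: (Ad_Nrel tr (nS_Nrel Hg)).
  - exact: (Ad_bij tr be).
  - exact: (Ad_nmap tr).
  exists h; first exact: (tr_hiso tr).
  by exists gamma => //; rewrite (Ad_Norm tr) // nS_Norm.
have Hg := gA _ Ag; have hb := isom_bij ih.
have ihV : isom Phi X (h^-1)%VF by move=> x y; rewrite -ih !bij_invr.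
pose xi1 := (xi' \o h)%VF.
have Ngam : forall x, (h^-1)%VF (Norm Phi xi' eta (h x)) = gamma x.
  by move=> x; rewrite -hE /conj_lfun !comp_lfunE !bij_invl.
have dk x : xi1 x = 0 -> gamma x = x.
  by rewrite comp_lfunE => x0; rewrite -Ngam NormE x0 !linear0 addr0 bij_invl.
have kE : lker xi1 = lker (gamma - \1)%VF%R.
  apply/eqP; rewrite eqEdim; apply/andP; split.
    by apply/subvP => x; rewrite !memv_ker => /eqP /dk gx; rewrite gd_dE gx subrr.
  rewrite -(leq_add2r (\dim (limg (gamma - \1)%VF%R))).
  have := limg_ker_dim (gamma - \1)%VF%R fullv; rewrite capfv => ->.
  have := limg_ker_dim xi1 fullv; rewrite capfv => <-.
  by rewrite leq_add2l (gd_dim Hg) -(dim_subvs W) dimvS // subvf.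
have k1 x : xi1 x = 0 <-> xi x = 0.
  have -> : (xi1 x = 0) <-> (x \in lker xi1) by rewrite memv_ker; split=> /eqP.
  by rewrite kE (gd_kerE Hg) memv_ker; split=> /eqP.
pose g := (xi \o xi1^-1)%VF.
have s1 : limg xi1 = fullv.
  apply/eqP; rewrite eqEdim subvf /= dim_subvs -(gd_dim Hg).
  have := limg_ker_dim xi1 fullv; have := limg_ker_dim (gamma - \1)%VF%R fullv.
  by rewrite !capfv kE => <- /eqP; rewrite eqn_add2l => /eqP ->.
have gxi x : g (xi1 x) = xi x.
  rewrite comp_lfunE; apply/subr0_eq; rewrite -linearB; apply/k1.
  by rewrite linearB /= limg_lfunVK ?subrr // s1 memvf.
have gb : bijective g.
  apply: inj_bij => //; apply/lker0P; rewrite -subv0; apply/subvP => w; rewrite memv_ker memv0.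
  have : w \in limg xi1 by rewrite s1 memvf.
  by move=> /memv_imgP [x _ ->]; rewrite gxi => /eqP /k1 ->.
have [m [g' tr]] := triple_exists gb ihV.
have xiE : (g \o xi' \o ((h^-1)^-1))%VF = xi.
  by apply/lfunP => x; rewrite (bij_invK hb) -[RHS]gxi /xi1 !comp_lfunE.
have N2 := Ad_Norm tr xi' be.
rewrite xiE in N2.
have be2 := Ad_bij tr be.
have eE : (g \o eta \o g'^-1)%VF = (gammaG Phi W' xi gamma \o (upsilon Phi W' xi)^-1)%VF.
  apply: (nS_uniq Hg) => //; rewrite N2; apply/lfunP => x.
  by rewrite /conj_lfun !comp_lfunE bij_invK // Ngam.
exists (m^-1)%VF; first exact: triple_Mset (triple_inv tr).
exists gamma => //; rewrite /nS -eE -{1}xiE -(Ad_nmap tr) -nE.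
have mb := triple_bij tr.
by have := conj_invK n (inv_bij mb); rewrite (bij_invK mb).
Qed.
End Adjoint.

(** * The k-maximal tori are frame tori *)

Section TorusFacts.
Variables (F : fieldType) (K : closedFieldType) (iota : {rmorphism F -> K}).
Variables (V : vectType F) (eps : bool) (Phi : V -> V -> F) (W X W' : {vspace V}).
Hypothesis HP : polar eps Phi W X W'.
Hypothesis two : 2%:R != 0 :> K.
Local Notation XK := (ext_space iota X).
Local Notation PhiK := (ext_form iota Phi).
Local Notation extX := (ext_sub iota X).
Local Notation B := (subform PhiK XK).
Local Notation cX := (coords extX).

Lemma subformK_isform : isform eps B.
Proof. exact: (subform_isform (polar_ext iota HP)). Qed.
Let HB := subformK_isform.

(** Rank at most k on a torus of dimension k / 2 is the hypothesis of the structure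
    theorem. *)
Lemma kmax_frame S : ~~ odd (\dim W) -> kmax_torus iota Phi W X S ->
  exists e f : 'I_(\dim W)./2 -> subvs_of XK, frame B e f /\ S = tor B e f @` @Gm K (\dim W)./2.
Proof.
move=> ev [[_ [phi [phiS phiM phiP phiQ]]] Sle _].
have Sphi t : Gm t -> HKle Phi (\dim W) (phi t) by move=> tm; apply: Sle; rewrite -phiS; exists t.
have [cE cEE] := coords_rec (ext_sub_bchange iota X).
have := torus_is_frame_torus HB two (@coords_lin _ _ _ _ extX) cEE phiM phiP phiQ.
case=> [t /Sphi [ih _] x y|t /Sphi [_ rk]|e [f [He SE]]].
- exact: ih.
- by rewrite -[X in (_ <= X)%N](odd_double_half (\dim W)) (negbTE ev) in rk.
by exists e, f; rewrite -phiS.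
Qed.

Lemma conj_tor (I : finType) (e f : I -> subvs_of XK) (g : 'End(subvs_of XK)) t :
  frame B e f -> (forall x y, B (g x) (g y) = B x y) ->
  frame B (g \o e) (g \o f) /\ conj_lfun g (tor B e f t) = tor B (g \o e) (g \o f) t.
Proof.
move=> He ig; have Hg : frame B (g \o e) (g \o f).
  by split=> i j; rewrite /= ig; [apply: fr_ee He _ _|apply: fr_ff He _ _|apply: fr_ef He _ _].
have gb : bijective g by apply: inj_bij => //; apply/lker0P/(isometry_bij HB).
split=> //; apply: (frame_ext HB Hg) => [i|i|x px]; rewrite /conj_lfun !comp_lfunE.
- rewrite (tor_e HB Hg t i) -[(g \o e) i]/(g (e i)) (bij_invl gb (e i)) (tor_e HB He t i).
  exact: linearZ.
- rewrite (tor_f HB Hg t i) -[(g \o f) i]/(g (f i)) (bij_invl gb (f i)) (tor_f HB He t i).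
  exact: linearZ.
have pgx : perp B e f ((g^-1)%VF x).
  move=> i; have [h1 h2] := px i; split; rewrite -ig (bij_invr gb x); [exact: h1|exact: h2].
by rewrite (tor_perp HB t px) (tor_perp HB t pgx) (bij_invr gb x).
Qed.

Section HSKFrame.
Variables (r : nat) (e f : 'I_r -> subvs_of XK).
Hypothesis He : frame B e f.

(** By Witt's theorem, conjugation by isometries moves a frame to any other frame of the
    same size. In particular the right-hand side does not depend on the torus. *)
Lemma HSK_frameP h : HSK Phi (tor B e f @` @Gm K r) h <->
  exists (e' f' : 'I_r -> subvs_of XK) (t : 'I_r -> K),
    [/\ frame B e' f', Gm t, regular eps t & h = tor B e' f' t].
Proof.
split=> [[g ig [s /(SrK_regular (fun _ _ => erefl) HB two He) [t [tm tr] ->] <-]]|].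
  have [Hg ->] := conj_tor t He ig.
  by exists (g \o e), (g \o f), t.
move=> [e' [f' [t [He' tm tr ->]]]].
have [g [ig ge gf]] := witt HB two He He'.
exists g => //; exists (tor B e f t); first exact: (regular_SrK (fun _ _ => erefl) HB two He tm tr).
have [_ ->] := conj_tor t He ig.
have -> : g \o e = e' by apply/funext => i; apply: ge.
by have -> : g \o f = f' by apply/funext => i; apply: gf.
Qed.

(** Regularity excludes finitely many nontrivial characters, t i ^ 2 among them. *)
Lemma exists_regular : exists2 t : 'I_r -> K, Gm t & regular eps t.
Proof.
pose a (i : 'I_r) : 'rV[int]_r := delta_mx 0 i.
have a0 (i : 'I_r) : a i != 0 by apply/eqP => /rowP /(_ i); rewrite !mxE !eqxx.
pose L := [seq a u.1 + a u.2 | u <- enum {: 'I_r * 'I_r}] ++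
          [seq a u.1 - a u.2 | u <- [seq u <- enum {: 'I_r * 'I_r} | u.1 != u.2]].
have [|t tm tL] := @chi_generic K r L.
  rewrite mem_cat; apply/norP; split; apply/mapP => -[[i j]]; rewrite ?mem_filter /=.
    move=> _ /rowP /(_ i); rewrite !mxE !eqxx /=; by case: (i == j).
  move=> /andP [ij _] /rowP /(_ i); rewrite !mxE !eqxx (negbTE ij) //.
exists t => //.
have tij i j : t i * t j != 1.
  have /tL : a i + a j \in L by rewrite mem_cat; apply/orP; left; apply/mapP; exists (i, j); rewrite ?mem_enum.
  by rewrite chiD // !delta_chi.
split=> [i|i j /eqP ij|_ i].
- by apply: contraNneq (tij i i) => ->; rewrite mulr1.
- split=> //; have /tL : a i - a j \in L.
    by rewrite mem_cat; apply/orP; right; apply/mapP; exists (i, j); rewrite // mem_filter ij mem_enum.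
  by rewrite chiD // chiN // !delta_chi //; apply: contraNneq => ->; rewrite mulfV.
by apply: contraNneq (tij i i) => ->; rewrite mulrNN mulr1.
Qed.
End HSKFrame.

Lemma frame_kmax (e f : 'I_(\dim W)./2 -> subvs_of XK) : ~~ odd (\dim W) -> frame B e f ->
  defined_over iota cX (tor B e f @` @Gm K (\dim W)./2) ->
  kmax_torus iota Phi W X (tor B e f @` @Gm K (\dim W)./2).
Proof.
move=> ev He def; have [cE cEE] := coords_rec (ext_sub_bchange iota X).
split=> //; first exact: (frame_torus_is_torus HB (@coords_lin _ _ _ _ extX) cEE He).
move=> _ [t tm <-]; split; first exact: (tor_isom HB He tm).
have := tor_rank HB He t; rewrite card_ord.
by rewrite -[X in _ -> (_ <= X)%N](odd_double_half (\dim W)) (negbTE ev).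
Qed.
End TorusFacts.

(** * A polynomial criterion for regular spectrum *)

Section CharPoly.
Variable K : closedFieldType.

Lemma poly_eqP (p q : {poly K}) : (forall x, p.[x] = q.[x]) -> p = q.
Proof.
move=> h; apply/eqP; rewrite -subr_eq0; apply: contraT => /closed_nonrootP [x].
by rewrite /root hornerD hornerN h subrr eqxx.
Qed.

Lemma char_poly_eval n (A : 'M[K]_n) x : (char_poly A).[x] = \det (x%:M - A).
Proof.
rewrite /char_poly /char_poly_mx -[LHS]/(horner_eval x _) -det_map_mx; congr (\det _).
by apply/matrixP => i j; rewrite !mxE /= /horner_eval hornerD hornerN hornerC hornerMn hornerX.
Qed.

(** det p(A) is the product of p over the eigenvalues of A: factor p instead of
    triangularizing A. *)
Lemma det_horner n (A : 'M[K]_n.+1) (L : seq K) (p : {poly K}) :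
  char_poly A = \prod_(x <- L) ('X - x%:P) ->
  \det (horner_mx A p) = \prod_(x <- L) p.[x].
Proof.
move=> AL.
have sL : size L = n.+1 by have := size_char_poly A; rewrite AL size_prod_XsubC => -[].
have E b : \det (A - b%:M) = \prod_(x <- L) (x - b).
  rewrite -opprB -scaleN1r detZ -char_poly_eval AL horner_prod -sL.
  elim: (L) => [|x s IH]; first by rewrite !big_nil expr0 mulr1.
  rewrite /= !big_cons hornerXsubC -IH exprS; ring.
have [bs pE] := closed_field_poly_normal p.
rewrite pE horner_mxZ rmorph_prod /= detZ.
have -> : \det (\prod_(b <- bs) horner_mx A ('X - b%:P)) = \prod_(b <- bs) \prod_(x <- L) (x - b).
  elim: bs {pE} => [|b bs IH]; first by rewrite !big_nil det1.
  by rewrite !big_cons det_mulmx IH rmorphB /= horner_mx_X horner_mx_C E.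
rewrite exchange_big /= -sL.
elim: (L) => [|x s IH]; first by rewrite !big_nil mulr1.
rewrite /= !big_cons -IH hornerZ horner_prod exprS.
under [X in _ = _ * X * _]eq_bigr do rewrite hornerXsubC.
by ring.
Qed.

Lemma char_poly_horner n (A : 'M[K]_n.+1) (L : seq K) (p : {poly K}) :
  char_poly A = \prod_(x <- L) ('X - x%:P) ->
  char_poly (horner_mx A p) = \prod_(x <- L) ('X - (p.[x])%:P).
Proof.
move=> AL; apply: poly_eqP => y; rewrite char_poly_eval -(horner_mx_C A) -rmorphB /= (det_horner _ AL).
rewrite horner_prod; apply: eq_bigr => x _.
by rewrite hornerXsubC hornerD hornerN hornerC.
Qed.

(** Pairs x, 1 - x are removed until every remaining entry is 1 / 2, which is then
    repeated an even number of times. *)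
Lemma pair_up (L : seq K) : 2%:R != 0 :> K -> ~~ odd (size L) -> perm_eq L (map (fun x => 1 - x) L) ->
  exists s : seq K, perm_eq L (flatten [seq [:: x; 1 - x] | x <- s]).
Proof.
move=> two; have [m] := ubnP (size L); elim: m L => // m IHm L lm ev inv.
have [/hasP [x xL xx]|/hasPn h] := boolP (has (fun x => 1 - x != x) L).
  have /perm_to_rem L1 := xL.
  have x1L : 1 - x \in rem x L.
    have : 1 - x \in L by rewrite (perm_mem inv); exact: (map_f (fun x => 1 - x) xL).
    by rewrite (perm_mem L1) inE (negbTE xx).
  have /perm_to_rem L2 := x1L; set L' := rem (1 - x) (rem x L) in L2.
  have LE : perm_eq L (x :: 1 - x :: L') by rewrite (perm_trans L1) // perm_cons.
  have sL : size L = (size L').+2 by rewrite (perm_size LE).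
  have [||| s sE] := IHm L'.
  - by rewrite sL in lm; rewrite -ltnS ltnW.
  - by rewrite sL /= negbK in ev.
  - have := inv; rewrite (permPl LE) (permPr (perm_map _ LE)) /= subKr.
    set M := map _ L' => e; rewrite -(perm_cons (1 - x)) -(perm_cons x); apply: (perm_trans e).
    by rewrite (perm_catCA [:: 1 - x] [:: x] M).
  exists (x :: s); rewrite /= (permPl LE) !perm_cons //.
exists (nseq (size L)./2 (2%:R^-1)).
have L2 : L = nseq (size L) (2%:R^-1).
  apply/all_pred1P/allP => x /h; rewrite negbK => /eqP e /=.
  apply/eqP/(mulfI two); rewrite mulfV // mulr_natl mulr2n -{1}e subrK //.
(* No entry differs from its partner 1 - x, so all entries are 1 / 2. *)
have h2 : 1 - 2%:R^-1 = 2%:R^-1 :> K by field.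
rewrite {1}L2 -{1}(odd_double_half (size L)) (negbTE ev) add0n.
by elim: (_./2) => //= k IH; rewrite h2 !perm_cons.
Qed.
End CharPoly.

Section Crit.
Variable eps : bool.

Definition gramQ (R : comNzRingType) n (M : 'M[R]_n) : 'M[R]_n := M + (-1) ^+ eps *: M^T.
(** det Q times the operator A = sg M^T Q^-1, where Q is gramQ M. The adjugate replaces
    the inverse, so that the entries are polynomials in those of M. *)
Definition scaledA (R : comNzRingType) n (M : 'M[R]_n) : 'M[R]_n :=
  (-1) ^+ eps *: M^T *m \adj (gramQ M).
(** (det Q)^2 times A (1 - A): this operator does not distinguish the paired eigenvalues
    a and 1 - a. *)
Definition scaledZ (R : comNzRingType) n (M : 'M[R]_n) : 'M[R]_n :=
  scaledA M *m ((\det (gramQ M))%:M - scaledA M).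
(** Every eigenvalue of A (1 - A) has even multiplicity, so its discriminant is 0. If
    the characteristic polynomial is the square of R, then at a root z of R its second
    derivative is 2 R'(z)^2: it detects whether z is a simple root of R. *)
Definition discr (R : comNzRingType) n : 'M[R]_n -> R :=
  if n is n'.+1 then fun M => \det (horner_mx (scaledZ M) (char_poly (scaledZ M))^`()^`()) else fun=> 1.
(** The four factors say, in turn, that eta is invertible, that its symmetrized form is
    nondegenerate, that 1 / 2 is not an eigenvalue of A (antisymmetric case), and that
    the pairs of eigenvalues are distinct. *)
Definition crit (R : comNzRingType) n (M : 'M[R]_n) : R :=
  \det M * \det (gramQ M) * (if eps then \det (M - (-1) ^+ eps *: M^T) else 1) * discr M.

(** Naturality makes crit of a matrix of polynomials specialize to crit at each point.
    *)
Lemma crit_map (R S : comNzRingType) (f : {rmorphism R -> S}) n (M : 'M[R]_n) :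
  crit (map_mx f M) = f (crit M).
Proof.
have Q : gramQ (map_mx f M) = map_mx f (gramQ M).
  by rewrite /gramQ map_mxD map_mxZ rmorph_sign map_trmx.
have A : scaledA (map_mx f M) = map_mx f (scaledA M).
  by rewrite /scaledA Q map_mxM map_mxZ rmorph_sign map_trmx map_mx_adj.
have Z : scaledZ (map_mx f M) = map_mx f (scaledZ M).
  by rewrite /scaledZ A Q map_mxM map_mxB map_scalar_mx det_map_mx.
rewrite /crit !rmorphM Q !det_map_mx; congr (_ * _ * _ * _).
  by case: (eps); rewrite ?rmorph1 // -det_map_mx map_mxB map_mxZ rmorph_sign map_trmx.
case: n M Q A Z => [|n] M Q A Z; first by rewrite rmorph1.
rewrite /discr Z -det_map_mx -map_char_poly !deriv_map; congr (\det _).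
by rewrite map_horner_mx.
Qed.
End Crit.

Lemma discrE (K : closedFieldType) (eps : bool) r n (M : 'M[K]_n) (a : 'I_r -> K) :
  2%:R != 0 :> K -> n = r.*2 -> \det (gramQ eps M) != 0 ->
  char_poly ((-1) ^+ eps *: M^T *m invmx (gramQ eps M)) =
    \prod_i (('X - (a i)%:P) * ('X - (1 - a i)%:P)) ->
  discr eps M != 0 <-> (forall i j, i != j -> a i * (1 - a i) != a j * (1 - a j)).
Proof.
move=> two nr d0 cA; case: n M nr d0 cA => [|n] M nr d0 cA.
  split=> [_ i|_]; last exact: oner_neq0.
  have r0 : r = 0%N by lia.
  by have := leq_ltn_trans (leq0n _) (ltn_ord i); rewrite [X in (_ < X)%N]r0.
set A := _ *m invmx _ in cA; set d := \det _ in d0.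
have uQ : gramQ eps M \in unitmx by rewrite unitmxE unitfE.
have ZE : scaledZ eps M = horner_mx A (d ^+ 2 *: ('X * (1 - 'X))).
  have sA : scaledA eps M = d *: A.
    by rewrite /scaledA /A /invmx uQ -/d scalerAr scalerA mulfV // scale1r.
  rewrite /scaledZ sA -/d horner_mxZ rmorphM rmorphB /= horner_mx_X rmorph1.
  have -> : d%:M - d *: A = d *: (1 - A) by rewrite scalerBr -scalemx1.
  by rewrite -scalemxAl -scalemxAr scalerA expr2.
pose L := flatten [seq [:: a i; 1 - a i] | i <- enum 'I_r].
have LE (T : comNzRingType) (F : K -> T) : \prod_(x <- L) F x = \prod_i (F (a i) * F (1 - a i)).
  rewrite big_flatten big_map /= big_enum; apply: eq_bigr => i _.
  by rewrite !big_cons big_nil mulr1.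
rewrite -(LE _ (fun x => 'X - x%:P)) in cA.
pose y i := d ^+ 2 * (a i * (1 - a i)).
have yE i : (d ^+ 2 *: ('X * (1 - 'X))).[a i] = y i.
  by rewrite hornerZ hornerM hornerD hornerN hornerX hornerC.
have yE' i : (d ^+ 2 *: ('X * (1 - 'X))).[1 - a i] = y i.
  by rewrite hornerZ hornerM hornerD hornerN hornerX hornerC /y; ring.
pose R := \prod_i ('X - (y i)%:P).
have cZ : char_poly (scaledZ eps M) = R * R.
  rewrite ZE (char_poly_horner _ cA) LE -big_split.
  by apply: eq_bigr => i _; rewrite yE yE'.
have -> : discr eps M = \prod_i (2%:R * R^`().[y i] ^+ 2) ^+ 2.
  rewrite /discr cZ ZE.
  have := char_poly_horner (d ^+ 2 *: ('X * (1 - 'X))) cA.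
  rewrite -(big_map (fun x => (d ^+ 2 *: ('X * (1 - 'X))).[x]) predT (fun x => 'X - x%:P)).
  move=> cc; rewrite (det_horner _ cc) big_map LE; apply: eq_bigr => i _; rewrite yE yE' -expr2.
  congr (_ ^+ 2); rewrite !derivM !derivD !derivM !hornerD !hornerM.
  have -> : R.[y i] = 0 by rewrite horner_prod (bigD1 i) //= hornerXsubC subrr mul0r.
  by ring.
have RE i : R^`().[y i] = \prod_(j | j != i) (y i - y j).
  rewrite /R (bigD1 i) //= derivM derivXsubC mul1r hornerD hornerM hornerXsubC subrr mul0r addr0.
  by rewrite horner_prod; apply: eq_bigr => j _; rewrite hornerXsubC.
have dy i j : (y i == y j) = (a i * (1 - a i) == a j * (1 - a j)).
  by rewrite (inj_eq (mulfI _)) // expf_neq0.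
split=> [/prodf_neq0 h i j ij|h].
  have := h i isT; rewrite expf_eq0 /= mulf_eq0 negb_or expf_eq0 /= RE => /andP [_ /prodf_neq0 /(_ j)].
  by rewrite eq_sym => /(_ ij); rewrite subr_eq0 dy.
apply/prodf_neq0 => i _; rewrite expf_neq0 // mulf_neq0 // expf_neq0 // RE.
by apply/prodf_neq0 => j ji; rewrite subr_eq0 dy h // eq_sym.
Qed.

Lemma gram_poly (K : fieldType) (eps : bool) m (N : 'M[K]_m.+1) (b : 'rV[K]_m.+1 -> 'rV[K]_m.+1 -> K) u x s (q : {poly K}) :
  isform eps b -> (forall x, b u (x *m N) = s * b u x) ->
  b u (x *m horner_mx N q) = q.[s] * b u x.
Proof.
move=> Hb bs; elim/poly_ind: q x => [|q c IH] x.
  by rewrite rmorph0 mulmx0 (f0r Hb) horner0 mul0r.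
rewrite rmorphD rmorphM /= horner_mx_X horner_mx_C mulmxDr mulmxA (fDr Hb) bs IH.
by rewrite mul_mx_scalar (fZr Hb) hornerD hornerM hornerX hornerC; ring.
Qed.

(** If s is a simple root, q(N) has values in the eigenspace of s, and B u sees this map
    as multiplication by q(s). *)
Lemma eigen_dual (K : fieldType) (eps : bool) n (N : 'M[K]_n) (b : 'rV[K]_n -> 'rV[K]_n -> K)
    (u x : 'rV[K]_n) (s : K) (q : {poly K}) :
  isform eps b -> char_poly N = ('X - s%:P) * q -> (forall x, b u (x *m N) = s * b u x) ->
  q.[s] != 0 -> b u x != 0 -> exists2 w, w *m N = s *: w & b u w != 0.
Proof.
case: n N b u x => [|m] N b u x Hb cA uB q0 xu.
  by move: xu; rewrite (_ : x = 0) ?(f0r Hb) ?eqxx //; apply/rowP => -[].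
exists (x *m horner_mx N q); last by rewrite (gram_poly _ _ Hb uB) mulf_neq0.
have := Cayley_Hamilton N; rewrite cA mulrC rmorphM rmorphB /= horner_mx_X horner_mx_C => /(congr1 (mulmx x)).
by rewrite mulmx0 mulmxA mulmxBr mul_mx_scalar => /eqP; rewrite subr_eq0 => /eqP.
Qed.

Section Diagonalization.
Variables (K : closedFieldType) (eps : bool) (r n : nat) (M : 'M[K]_n).
Hypothesis two : 2%:R != 0 :> K.
Hypothesis nr : n = r.*2.
Local Notation sg := ((-1) ^+ eps : K).
Local Notation Q := (gramQ eps M).
Hypothesis Q0 : \det Q != 0.

(** The operator with B (x A) y = (x sg M^T) y, written on row vectors; in terms of eta
    it is the inverse of eta + eta^* composed with eta. *)
Definition skewA : 'M[K]_n := sg *: M^T *m invmx Q.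
Local Notation A := skewA.
Definition gramB (x y : 'rV[K]_n) : K := (x *m Q *m y^T) 0 0.
Local Notation B := gramB.

Lemma Q_unit : Q \in unitmx.
Proof. by rewrite unitmxE unitfE. Qed.
Lemma Q_tr : Q^T = sg *: Q.
Proof. by rewrite linearD linearZ /= trmxK scalerDr scalerA -expr2 sqrr_sign scale1r addrC. Qed.
Lemma AQ : A *m Q = sg *: M^T.
Proof. by rewrite -mulmxA mulVmx ?Q_unit // mulmx1. Qed.

Lemma gramB_isform : isform eps B.
Proof.
split=> [a x y z|x y|x h].
- by rewrite /B !mulmxDl -!scalemxAl !mxE.
- rewrite /B -[LHS]/((x *m Q *m y^T) 0 0) -[RHS]/(sg * (y *m Q *m x^T) 0 0).
  have -> : y *m Q *m x^T = (x *m (sg *: Q) *m y^T)^T.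
    by rewrite !trmx_mul trmxK linearZ /= Q_tr scalerA -expr2 sqrr_sign scale1r mulmxA.
  by rewrite [in RHS]mxE -scalemxAr -scalemxAl [in RHS]mxE mulrA -expr2 sqrr_sign mul1r.
have : x *m Q = 0.
  apply/rowP => i; rewrite [RHS]mxE; have := h (delta_mx 0 i); rewrite /B trmx_delta => <-.
  by rewrite -colE [RHS]mxE.
by move/(congr1 (mulmx^~ (invmx Q))); rewrite mulmxK ?Q_unit // mul0mx.
Qed.
Let HB := gramB_isform.

(** The adjoint of A is 1 - A. Hence its eigenvalues come in pairs a, 1 - a. *)
Lemma gramB_A x y : B (x *m A) y = B x (y - y *m A).
Proof.
rewrite /B -(mulmxA x) AQ -!(mulmxA x); congr ((x *m _) 0 0).
have -> : (y - y *m A)^T = (1%:M - A^T) *m y^T by rewrite linearB /= trmx_mul mulmxBl mul1mx.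
rewrite mulmxA; congr (_ *m _); rewrite mulmxBr mulmx1.
have -> : Q *m A^T = M.
  have : (A *m Q)^T = sg *: M by rewrite AQ linearZ /= trmxK.
  rewrite trmx_mul Q_tr -scalemxAl => /(congr1 (fun N => sg *: N)).
  by rewrite !scalerA -expr2 sqrr_sign !scale1r.
by rewrite /gramQ addrC addKr.
Qed.

Lemma gramB_Ar x y : B x (y *m A) = B (x - x *m A) y.
Proof. by rewrite (fBl HB) gramB_A (fBr HB) opprB addrCA subrr addr0. Qed.

Lemma gram_orth x y s t : x *m A = s *: x -> y *m A = t *: y -> s + t != 1 -> B x y = 0.
Proof.
move=> xs yt st; have := gramB_A x y; rewrite xs yt (fZl HB) (fBr HB) (fZr HB) => /eqP.
rewrite -subr_eq0 (_ : _ - _ = (s + t - 1) * B x y); last by ring.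
by rewrite mulf_eq0 subr_eq0 (negbTE st) => /eqP.
Qed.

Lemma dim_rV : \dim {: 'rV[K]_n} = n.
Proof. by rewrite dimvf dim_matrix; apply: mul1n. Qed.

Record diagframe (e f : 'I_r -> 'rV[K]_n) (a : 'I_r -> K) : Prop := IsDiagFrame {
  df_frame : frame B e f;
  df_e : forall i, e i *m A = a i *: e i;
  df_f : forall i, f i *m A = (1 - a i) *: f i }.

(** The frame vectors form a basis of eigenvectors. *)
Lemma diag_charpoly e f a : diagframe e f a ->
  char_poly A = \prod_i (('X - (a i)%:P) * ('X - (1 - a i)%:P)).
Proof.
case=> He eA fA; apply: poly_eqP => x; rewrite char_poly_eval.
pose ev := [seq (if u.2 then a u.1 else 1 - a u.1) | u <- enum {: 'I_r * bool}].
have szf : size (frseq e f) = n by rewrite (size_frseq e f) card_ord.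
have sze : size ev = n by rewrite size_map -cardE card_prod card_bool card_ord muln2.
pose P := \matrix_(k < n) nth 0 (frseq e f) k.
pose D := diag_mx (\row_(k < n) nth 0 ev k).
have PA : P *m A = D *m P.
  apply/row_matrixP => k; rewrite row_mul rowK row_mul row_diag_mx -scalemxAl -rowE rowK mxE.
  have ks : (k < size (enum {: 'I_r * bool}))%N by rewrite -cardE card_prod card_bool card_ord muln2 -nr.
  have r0 : (0 < r)%N.
    by have := leq_ltn_trans (leq0n _) (ltn_ord k); rewrite [X in (_ < X)%N]nr double_gt0.
  pose u0 : 'I_r * bool := (Ordinal r0, true).
  rewrite /frseq /ev 2!(nth_map u0 _ _ ks).
  move: (nth u0 (enum {: 'I_r * bool}) k) => [i []] /=; [exact: eA|exact: fA].
have uP : P \in unitmx.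
  rewrite -row_free_unit; apply/inj_row_free => v vP.
  pose T : n.-tuple 'rV[K]_n := Tuple (introT eqP szf).
  have fT : free T by exact: (frseq_free HB He).
  apply/rowP => k; rewrite mxE; move/freeP: fT => /(_ (fun k => v 0 k)); apply.
  by rewrite -[RHS]vP mulmx_sum_row; apply: eq_bigr => l _; rewrite rowK.
have : \det (P *m (x%:M - A)) = \det ((x%:M - D) *m P).
  by rewrite mulmxBr mulmxBl PA scalar_mxC.
rewrite !det_mulmx mulrC => /mulIf -> //; last by rewrite -unitfE -unitmxE.
rewrite -diag_const_mx -linearB det_diag horner_prod.
transitivity (\prod_(y <- ev) (x - y)).
  rewrite (big_nth 0) sze big_mkord; apply: eq_bigr => k _; by rewrite !mxE.
rewrite /ev big_map big_enum /= -(pair_big xpredT xpredT (fun i b => x - (if b then a i else 1 - a i))) /=.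
by apply: eq_bigr => i _; rewrite big_bool /= hornerM !hornerXsubC.
Qed.

(** The substitution x |-> 1 - x preserves the characteristic polynomial, as A and 1 - A
    are adjoint. *)
Lemma roots_pair : exists a : 'I_r -> K,
  char_poly A = \prod_i (('X - (a i)%:P) * ('X - (1 - a i)%:P)).
Proof.
have sym x : (char_poly A).[1 - x] = (char_poly A).[x].
  rewrite !char_poly_eval; apply: (mulIf Q0); rewrite -!det_mulmx !mulmxBl AQ !mul_scalar_mx.
  have -> : (1 - x) *: Q - sg *: M^T = - (x *: Q - M).
    by rewrite scalerBl scale1r /gramQ -!/(gramQ eps M) opprB addrAC addrK.
  have -> : x *: Q - sg *: M^T = sg *: (x *: Q - M)^T.
    have -> : (x *: Q - M)^T = x *: Q^T - M^T by rewrite linearB /= linearZ.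
    by rewrite Q_tr scalerBr !scalerA mulrAC -expr2 sqrr_sign mul1r.
  rewrite detZ det_tr -scaleN1r detZ; congr (_ * _).
  by rewrite nr -mul2n [LHS]exprM [RHS]exprM sqrr_sign sqrrN !expr1n.
have [L LE] := closed_field_poly_normal (char_poly A).
rewrite (monicP (char_poly_monic A)) scale1r in LE.
have sL : size L = n by have := size_char_poly A; rewrite LE size_prod_XsubC => -[].
have inv : perm_eq L (map (fun x => 1 - x) L).
  apply: prod_XsubC_eq; rewrite -LE; apply: poly_eqP => x; rewrite -sym LE.
  rewrite big_map !horner_prod.
  have -> : \prod_(y <- L) ('X - y%:P).[1 - x] = (-1) ^+ size L * \prod_(y <- L) ('X - (1 - y)%:P).[x].
    elim: (L) => [|y s IH]; first by rewrite !big_nil expr0 mulr1.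
    by rewrite !big_cons IH !hornerXsubC exprS; ring.
  by rewrite sL nr -signr_odd odd_double mul1r.
have ev : ~~ odd (size L) by rewrite sL nr odd_double.
have [s sE] := pair_up two ev inv.
have szs : size s = r.
  have := perm_size sE; rewrite sL nr => e; apply: double_inj; rewrite e.
  by elim: (s) => [//|y s' IH]; apply: (congr1 (fun m => m.+2) IH).
exists (fun i => nth 0 s i); rewrite LE.
transitivity (\prod_(x <- flatten [seq [:: x; 1 - x] | x <- s]) ('X - x%:P)); first exact: perm_big.
rewrite big_flatten big_map (big_nth 0) szs big_mkord.
by apply: eq_bigr => i _ /=; rewrite !big_cons big_nil /= mulr1.
Qed.

(** An eigenvector for 1 - a pairing nontrivially with the eigenvector u exists because
    1 - a is a simple eigenvalue. *)
Lemma gram_pair (a : K) (q : {poly K}) : char_poly A = ('X - (1 - a)%:P) * q ->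
  q.[1 - a] != 0 -> root (char_poly A) a ->
  exists u w, [/\ u *m A = a *: u, w *m A = (1 - a) *: w & B u w = 1].
Proof.
move=> cA q0 ra.
have [u u0 uA] : exists2 u : 'rV[K]_n, u != 0 & u *m A = a *: u.
  move: ra; rewrite /root char_poly_eval => /det0P [u u0 uA]; exists u => //.
  by move/eqP: uA; rewrite mulmxBr mul_mx_scalar subr_eq0 => /eqP.
have uB x : B u (x *m A) = (1 - a) * B u x.
  by rewrite gramB_Ar uA (fBl HB) (fZl HB) mulrBl mul1r.
have [x xu] : exists x, B u x != 0.
  apply: contrapT => h; case/negP: u0; apply/eqP/(form_nondeg HB) => x.
  by apply/eqP/negPn/negP => xu; apply: h; exists x.
suff [w wA uw] : exists2 w, w *m A = (1 - a) *: w & B u w != 0.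
  exists u, ((B u w)^-1 *: w); split=> //; last by rewrite (fZr HB) mulVf.
  by rewrite -scalemxAl wA !scalerA mulrC.
exact: (eigen_dual HB cA uB q0 xu).
Qed.
End Diagonalization.

Section Diagonalize.
Variables (K : closedFieldType) (eps : bool) (r n : nat) (M : 'M[K]_n).
Hypothesis two : 2%:R != 0 :> K.
Hypothesis nr : n = r.*2.
Local Notation sg := ((-1) ^+ eps : K).
Local Notation Q := (gramQ eps M).
Hypothesis Q0 : \det Q != 0.
Local Notation A := (skewA eps M).
Local Notation B := (gramB eps M).
Let HB := gramB_isform Q0.

(** Pairs of distinct eigenvalues give the frame directly. In the symmetric case one
    pair may have a = 1 - a = 1 / 2, a double root; then the complement of the other
    vectors is a plane, and the two isotropic lines of this plane are eigenspaces
    because B (x A) x = B x x / 2. *)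
Lemma diagonalize (a : 'I_r -> K) :
  char_poly A = \prod_i (('X - (a i)%:P) * ('X - (1 - a i)%:P)) ->
  (forall i j, i != j -> a i * (1 - a i) != a j * (1 - a j)) ->
  (eps -> forall i, a i != 1 - a i) ->
  exists e f a', diagframe eps M e f (a' : 'I_r -> K).
Proof.
move=> cA zd aeps.
have hd i j : i != j -> a i != a j /\ a i + a j != 1.
  move=> ij; have := zd i j ij; split; first by apply: contraNneq H => ->.
  by apply: contraNneq H => h; apply/eqP; rewrite (_ : a j = 1 - a i) ?subKr 1?mulrC // -h addrC addKr.
have pair i : a i != 1 - a i -> exists uw : 'rV[K]_n * 'rV[K]_n,
    [/\ uw.1 *m A = a i *: uw.1, uw.2 *m A = (1 - a i) *: uw.2 & B uw.1 uw.2 = 1].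
  move=> ai; pose q := ('X - (a i)%:P) * \prod_(j | j != i) (('X - (a j)%:P) * ('X - (1 - a j)%:P)).
  have cq : char_poly A = ('X - (1 - a i)%:P) * q.
    by rewrite cA (bigD1 i) //= /q mulrA (mulrC ('X - (1 - a i)%:P)).
  have [||u [w [h1 h2 h3]]] := @gram_pair _ _ _ _ Q0 (a i) q cq.
  - rewrite hornerM hornerXsubC horner_prod mulf_neq0 //; first by rewrite subr_eq0 eq_sym.
    apply/prodf_neq0 => j ji; rewrite hornerM !hornerXsubC mulf_neq0 // subr_eq0.
      by have [_] := hd _ _ ji; apply: contraNneq => <-; rewrite subrK.
    have [h _] := hd _ _ ji; by apply: contra h => /eqP /(congr1 (fun z => 1 - z)); rewrite !subKr => ->.
  - by rewrite cA /root horner_prod (bigD1 i) //= hornerM hornerXsubC subrr !mul0r.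
  by exists (u, w).
have frame_of (I : finType) (g : I -> 'I_r) (e f : I -> 'rV[K]_n) : injective g ->
   (forall i, e i *m A = a (g i) *: e i) -> (forall i, f i *m A = (1 - a (g i)) *: f i) ->
   (forall i, a (g i) != 1 - a (g i)) -> (forall i, B (e i) (f i) = 1) -> frame B e f.
  move=> gI eA fA ga ef; split=> i j.
  - apply: (gram_orth Q0 (eA i) (eA j)); have [->|ne] := eqVneq i j.
      apply: contra (ga j) => /eqP h; rewrite -[X in _ == X - _]h addrK //.
    by have [] := hd (g i) (g j) _; rewrite ?(inj_eq gI).
  - apply: (gram_orth Q0 (fA i) (fA j)); have [->|ne] := eqVneq i j.
      apply: contra (ga j) => /eqP h.
      rewrite eq_sym -(inj_eq (addIr (1 - a (g j)))) h addrC subrK //.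
    have [_] : a (g i) != a (g j) /\ a (g i) + a (g j) != 1 by apply: hd; rewrite (inj_eq gI).
    apply: contra => /eqP h; rewrite (_ : a (g i) + a (g j) = 1 + 1 - (1 - a (g i) + (1 - a (g j)))).
      by rewrite h addrK.
    by ring.
  have [->|ne] := eqVneq i j; first exact: ef.
  apply: (gram_orth Q0 (eA i) (fA j)).
  have [h _] : a (g i) != a (g j) /\ a (g i) + a (g j) != 1 by apply: hd; rewrite (inj_eq gI).
  by rewrite addrA (addrC (a (g i))) -addrA -subr_eq0 addrC addrK subr_eq0.
have [/existsP [i0 /eqP a0]|/existsPn h] := boolP [exists i, a i == 1 - a i]; last first.
  have /choice [uw uwP] := fun i => pair i (h i).
  exists (fun i => (uw i).1), (fun i => (uw i).2), a.
  split; [|by move=> i; have [] := uwP i|by move=> i; have [] := uwP i].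
  by apply: (frame_of _ id) => // i; have [] := uwP i.
have ne : eps = false by apply/negbTE/negP => /aeps /(_ i0); rewrite -a0 eqxx.
have a2 : a i0 + a i0 = 1 by rewrite {2}a0 addrC subrK.
have ai i : i != i0 -> a i != 1 - a i.
  move=> ii; have [h _] := hd _ _ ii; apply: contra h => /eqP h.
  have a1 : a i + a i = 1 by rewrite {2}h addrC subrK.
  by apply/eqP/(mulfI two); rewrite !mulr_natl !mulr2n a1 a2.
pose J : finType := {i : 'I_r | i != i0}.
have /choice [uw uwP] := fun i : J => pair (val i) (ai _ (valP i)).
pose e (i : J) := (uw i).1; pose f (i : J) := (uw i).2.
have eA i : e i *m A = a (val i) *: e i by have [] := uwP i.
have fA i : f i *m A = (1 - a (val i)) *: f i by have [] := uwP i.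
have He : frame B e f.
  apply: (frame_of _ val) => //; first exact: val_inj.
    by move=> i; exact: (ai _ (valP i)).
  by move=> i; have [] := uwP i.
have cJ : (#|J|.+1 = r)%N.
  rewrite card_sig -[RHS](card_ord r) [in RHS](cardD1 i0) inE add1n; congr _.+1.
  by apply: eq_card => i; rewrite !inE andbT.
have [u [v [pu pv uu vv uv]]] : exists u v, [/\ perp B e f u, perp B e f v, B u u = 0, B v v = 0 & B u v = 1].
  by apply: (hyperbolic_pair HB two He); rewrite dim_rV [X in (_ <= X)%N]nr -cJ doubleS addn2.
have Hx := frame_oext HB He pu pv uu vv uv.
have perpx y : perp B (oext u e) (oext v f) y -> y = 0.
  move=> py; have := dim_pspace HB Hx; rewrite card_option cJ dim_rV [X in _ = X]nr => /eqP.
  rewrite -[X in _ == X]add0n eqn_add2r dimv_eq0 => /eqP p0.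
  by have := introT (mem_pspace HB Hx y) py; rewrite p0 memv0 => /eqP.
have st x : perp B e f x -> perp B e f (x *m A).
  move=> px i; have [h1 h2] := px i; split.
    by rewrite (gramB_Ar Q0) eA (fBl HB) (fZl HB) h1 mulr0 subrr.
  by rewrite (gramB_A Q0) fA (fBr HB) (fZr HB) h2 mulr0 subrr.
have sg1 : sg = 1 by rewrite ne expr0.
have vu : B v u = 1 by rewrite (fC HB) sg1 mul1r.
have self x : B x x = 0 -> B (x *m A) x = 0.
  move=> xx; have := gramB_A Q0 x x; rewrite (fBr HB) xx sub0r [B x (_ *m _)](fC HB) sg1 mul1r.
  by move/eqP; rewrite -subr_eq0 opprK -mulr2n -mulr_natl mulf_eq0 (negbTE two) => /eqP.
pose c := B (u *m A) v.
have uA : u *m A = c *: u.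
  apply/eqP; rewrite -subr_eq0; apply/eqP.
  apply: (frame_eq0 HB Hx) => [[i|]|[i|]|y /perpx -> /=]; rewrite /oext ?(f0r HB) // (fBl HB) (fZl HB).
  - have [_ h1 _ _] := perpC HB (st u pu) i; have [_ h2 _ _] := perpC HB pu i.
    by rewrite h1 h2 mulr0 subrr.
  - by rewrite self // uu mulr0 subrr.
  - have [_ _ _ h1] := perpC HB (st u pu) i; have [_ _ _ h2] := perpC HB pu i.
    by rewrite h1 h2 mulr0 subrr.
  by rewrite uv mulr1 subrr.
have vA : v *m A = (1 - c) *: v.
  apply/eqP; rewrite -subr_eq0; apply/eqP.
  apply: (frame_eq0 HB Hx) => [[i|]|[i|]|y /perpx -> /=]; rewrite /oext ?(f0r HB) // (fBl HB) (fZl HB).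
  - have [_ h1 _ _] := perpC HB (st v pv) i; have [_ h2 _ _] := perpC HB pv i.
    by rewrite h1 h2 mulr0 subrr.
  - by rewrite (gramB_A Q0) uA (fBr HB) (fZr HB) vu !mulr1 subrr.
  - have [_ _ _ h1] := perpC HB (st v pv) i; have [_ _ _ h2] := perpC HB pv i.
    by rewrite h1 h2 mulr0 subrr.
  by rewrite self // vv mulr0 subrr.
pose s (i : 'I_r) : option J := insub i.
have sI : injective s.
  move=> i j; rewrite /s; case: insubP => [x _ xi|/negPn /eqP ->]; case: insubP => [y _ yj|/negPn /eqP -> //] //.
  by rewrite -xi -yj => -[->].
exists (oext u e \o s), (oext v f \o s), (fun i => if s i is Some j then a (val j) else c).
split=> [|i|i] /=; try by case: (s i) => [j|] /=.
by split=> i j /=; rewrite ?(fr_ee Hx) ?(fr_ff Hx) // (fr_ef Hx) (inj_eq sI).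
Qed.

Lemma det_skew : \det (M - sg *: M^T) = (2%:R ^+ n) * (char_poly A).[2%:R^-1] * \det Q.
Proof.
rewrite char_poly_eval -[2%:R ^+ n * _]detZ -det_mulmx; congr (\det _).
rewrite scalerBr mulmxBl scale_scalar_mx mulfV // mul1mx -scalemxAl (AQ Q0) /gramQ.
by rewrite scaler_nat mulr2n opprD addrA addrK.
Qed.

Lemma char_poly_root0 : \det M != 0 -> ~~ root (char_poly A) 0.
Proof.
move=> M0; rewrite /root char_poly_eval raddf0 sub0r -scaleN1r detZ.
rewrite mulf_neq0 ?expf_neq0 ?oppr_eq0 ?oner_eq0 //.
have : \det (A *m Q) != 0 by rewrite (AQ Q0) detZ det_tr mulf_neq0 // expf_neq0 // signr_eq0.
by rewrite det_mulmx mulf_eq0 negb_or => /andP [].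
Qed.

Definition regular_spectrum (a : 'I_r -> K) :=
  [/\ forall i, a i != 0 /\ a i != 1,
      forall i j, i != j -> a i * (1 - a i) != a j * (1 - a j) &
      eps -> forall i, a i != 1 - a i].

(** (1/2 - a) (1/2 - (1 - a)) is minus the square of (1 - 2 a) / 2. *)
Lemma char_poly_half (a : 'I_r -> K) :
  char_poly A = \prod_i (('X - (a i)%:P) * ('X - (1 - a i)%:P)) ->
  (char_poly A).[2%:R^-1] != 0 <-> (forall i, a i != 1 - a i).
Proof.
move=> ->; rewrite horner_prod.
have E i : ('X - (a i)%:P).[2%:R^-1] * ('X - (1 - a i)%:P).[2%:R^-1] != 0 = (a i != 1 - a i).
  rewrite !hornerXsubC.
  have -> : (2%:R^-1 - a i) * (2%:R^-1 - (1 - a i)) = - (2%:R^-1 * (1 - a i - a i)) ^+ 2.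
    by field.
  by rewrite oppr_eq0 expf_eq0 /= mulf_eq0 invr_eq0 (negbTE two) subr_eq0 eq_sym.
split=> [/prodf_neq0 h i|h]; first by rewrite -E -hornerM h.
by apply/prodf_neq0 => i _; rewrite hornerM E.
Qed.

End Diagonalize.

Section Criterion.
Variables (K : closedFieldType) (eps : bool) (r n : nat) (M : 'M[K]_n).
Hypothesis two : 2%:R != 0 :> K.
Hypothesis nr : n = r.*2.
Local Notation Q := (gramQ eps M).
Local Notation A := (skewA eps M).

Theorem crit_diag : crit eps M != 0 -> [/\ \det M != 0, \det Q != 0 &
  exists (e f : 'I_r -> 'rV[K]_n) a, diagframe eps M e f a /\ regular_spectrum eps a].
Proof.
rewrite /crit !mulf_eq0 !negb_or => /andP [/andP [/andP [M0 Q0] ep] dM].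
split=> //; have [a cA] := roots_pair two nr Q0.
have zd := (discrE two nr Q0 cA).1 dM.
have aeps : eps -> forall i, a i != 1 - a i.
  move=> he; apply/(char_poly_half two cA); move: ep; rewrite he.
  have := det_skew two Q0; rewrite he => ->.
  by rewrite !mulf_eq0 !negb_or => /andP [/andP []].
have [e [f [a' df]]] := diagonalize two nr Q0 cA zd aeps.
have cA' := diag_charpoly nr Q0 df.
exists e, f, a'; split=> //.
have r0 := char_poly_root0 Q0 M0.
split.
- move=> i; split; apply: contraNneq r0 => ai; rewrite cA' /root horner_prod (bigD1 i) //= hornerM !hornerXsubC ai.
    by rewrite subrr !mul0r.
  by rewrite subrr subr0 mulr0 mul0r.
- exact: (discrE two nr Q0 cA').1.
move=> he; apply/(char_poly_half two cA'); move: ep; rewrite he.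
have := det_skew two Q0; rewrite he => ->.
by rewrite !mulf_eq0 !negb_or => /andP [/andP []].
Qed.

Theorem diag_crit (e f : 'I_r -> 'rV[K]_n) a : \det M != 0 -> \det Q != 0 ->
  diagframe eps M e f a -> regular_spectrum eps a -> crit eps M != 0.
Proof.
move=> M0 Q0 df [_ zd aeps]; have cA := diag_charpoly nr Q0 df.
rewrite /crit; apply: mulf_neq0; last exact: (discrE two nr Q0 cA).2.
apply: mulf_neq0; first exact: mulf_neq0.
case: ifP => he; last exact: oner_neq0.
rewrite (det_skew two Q0) mulf_neq0 // mulf_neq0 ?expf_neq0 //.
by apply/(char_poly_half two cA)/aeps.
Qed.
End Criterion.

(** * The criterion for the norm to be regular *)

Section Transport.
Variables (K : closedFieldType) (V : vectType K) (eps : bool) (Phi : V -> V -> K).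
Variables (W X W' : {vspace V}) (r : nat).
Hypothesis HP : polar eps Phi W X W'.
Hypothesis two : 2%:R != 0 :> K.
Let HV := pl_form HP.
Local Notation sg := ((-1) ^+ eps : K).
Local Notation "<< u , v >>" := (Phi (vsval u) (vsval v)).
Local Notation Wt := (subvs_of W).
Local Notation Xt := (subvs_of X).
Local Notation W't := (subvs_of W').
Local Notation m := (\dim {:W't}).
Hypothesis mr : m = r.*2.
Local Notation b := (vbasis {:W't}).
Local Notation B := (subform Phi X).
Let HB := subform_isform HP.

(** For f = n(xi, eta) only the component eta w' pairs nontrivially with W'; so this is
    the matrix of eta, while its entries are linear in f. *)
Definition gramM (f : V -> V) : 'M[K]_m := \matrix_(i, j) Phi (vsval b`_i) (f (vsval b`_j)).

Definition vec_of_row (x : 'rV[K]_m) : W't := \sum_i x 0 i *: b`_i.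

Lemma vec_of_row_lin : linear vec_of_row.
Proof.
move=> a x y; rewrite /vec_of_row scaler_sumr -big_split; apply: eq_bigr => i _ /=.
by rewrite !mxE scalerDl scalerA.
Qed.
Lemma vec_of_rowZ a x : vec_of_row (a *: x) = a *: vec_of_row x.
Proof. by rewrite /vec_of_row scaler_sumr; apply: eq_bigr => i _; rewrite mxE scalerA. Qed.
Lemma vec_of_rowN x : vec_of_row (- x) = - vec_of_row x.
Proof. by rewrite -scaleN1r vec_of_rowZ scaleN1r. Qed.
Lemma vec_of_row_surj c : exists x, vec_of_row x = c.
Proof.
exists (\row_i coord b i c); rewrite [RHS](coord_basis (vbasisP fullv) (memvf c)).
by apply: eq_bigr => i _; rewrite mxE.
Qed.
Lemma vec_of_row0 x : vec_of_row x = 0 -> x = 0.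
Proof.
move=> h; apply/rowP => i; rewrite mxE.
by move/freeP: (basis_free (vbasisP {:W't})) => /(_ (fun i => x 0 i) h i).
Qed.

Section Pair.
Variables (xi : 'Hom(Xt, Wt)) (eta : 'Hom(W't, Wt)).
Hypothesis nr : Nrel Phi xi eta.
Local Notation xs := (adj_xi Phi W' xi).
Local Notation es := (adj_eta Phi eta).
Local Notation h := (Norm Phi xi eta).
Local Notation M := (gramM (nmap Phi xi eta)).
Local Notation Q := (gramQ eps M).
Local Notation A := (skewA eps M).

Lemma gramME i j : M i j = <<b`_i, eta b`_j>>.
Proof.
rewrite mxE (nmap_W' HP) (fDr HV) (fBr HV) (W'W'0 HP) (W'X0 HP) subr0 add0r //.
Qed.

Lemma pair_eta x y : <<vec_of_row x, eta (vec_of_row y)>> = (x *m M *m y^T) 0 0.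
Proof.
rewrite /vec_of_row !linear_sum (fsuml HV) -mulmxA mxE; apply: eq_bigr => i _.
rewrite linearZ (fZl HV) mxE; congr (_ * _); rewrite (fsumr HV); apply: eq_bigr => j _.
by rewrite !linearZ (fZr HV) gramME [in RHS]mxE mulrC.
Qed.

Lemma pair_es x y : <<vec_of_row x, es (vec_of_row y)>> = (x *m (sg *: M^T) *m y^T) 0 0.
Proof.
rewrite (pairC HP) (adj_etaE HP) pair_eta -scalemxAr -scalemxAl [in RHS]mxE; congr (_ * _).
by rewrite -[x in RHS]trmxK -trmx_mul -trmx_mul mulmxA [in RHS]mxE.
Qed.

(** This is the defining relation of N. *)
Lemma xxs c : xi (xs c) = - (eta c + es c).
Proof.
have /lfunP /(_ c) := nr; rewrite !add_lfunE comp_lfunE zero_lfunE => /eqP.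
by rewrite addr_eq0 => /eqP ->; rewrite opprK.
Qed.

Lemma pair_Q x y : <<vec_of_row x, eta (vec_of_row y) + es (vec_of_row y)>> = gramB eps M x y.
Proof.
by rewrite linearD (fDr HV) pair_eta pair_es /gramB mulmxDr mulmxDl [in RHS]mxE.
Qed.

(** So the image of xi^* carries minus the form of eta + eta^*, with matrix gramQ. *)
Lemma B_xs x y : B (xs (vec_of_row x)) (xs (vec_of_row y)) = - gramB eps M x y.
Proof. by rewrite /subform (adj_xiE HP) xxs linearN (fNr HV) pair_Q. Qed.

Lemma vec_of_row_eq (u v : Wt) : (forall x, <<vec_of_row x, u>> = <<vec_of_row x, v>>) -> u = v.
Proof.
by move=> e; apply: (W_injr HP) => c; have [x <-] := vec_of_row_surj c.
Qed.

Lemma mx_pair (y : 'rV[K]_m) (N N' : 'M[K]_m) :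
  (forall x : 'rV[K]_m, (x *m N *m y^T) 0 0 = (x *m N' *m y^T) 0 0) -> N *m y^T = N' *m y^T.
Proof.
move=> e; apply/colP => i; have := e (delta_mx 0 i).
by rewrite -!mulmxA -!rowE ![row _ _ 0 0]mxE.
Qed.

Lemma eta_bij_det : bijective eta -> \det M != 0.
Proof.
move=> be; rewrite -det_tr; apply/det0P => -[y y0 yM]; case/negP: y0; apply/eqP/vec_of_row0.
apply: (bij_inj be); rewrite linear0; apply: vec_of_row_eq => x.
rewrite pair_eta linear0 (f0r HV) -mulmxA (_ : M *m y^T = 0) ?mulmx0 ?mxE //.
by apply: trmx_inj; rewrite trmx_mul trmxK yM trmx0.
Qed.

Lemma det_eta_bij : \det M != 0 -> bijective eta.
Proof.
move=> M0; apply: inj_bij; first by rewrite !dim_subvs (dimWW' HP).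
apply/lker0P; rewrite -subv0; apply/subvP => c; rewrite memv_ker memv0 => /eqP c0.
have [y cE] := vec_of_row_surj c; rewrite -cE in c0 *; apply/eqP.
suff -> : y = 0 by apply/esym; rewrite -(scale0r (0 : 'rV[K]_m)) vec_of_rowZ scale0r.
have : M *m y^T = 0 *m y^T.
  by apply: mx_pair => x; rewrite -pair_eta c0 linear0 (f0r HV) mulmx0 mul0mx mxE.
rewrite mul0mx => /(congr1 (mulmx (invmx M))); rewrite mulKmx ?mulmx0 ?unitmxE ?unitfE //.
by move/(congr1 trmx); rewrite trmxK trmx0.
Qed.

(** The eigenvalue equation of A, freed of the inverse of Q. *)
Lemma eigen_A (x : 'rV[K]_m) a : \det Q != 0 -> x *m A = a *: x <-> eta (vec_of_row x) = a *: (eta (vec_of_row x) + es (vec_of_row x)).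
Proof.
move=> Q0; have uQ := Q_unit Q0; have trQ := Q_tr eps M.
have step : x *m A = a *: x <-> M *m x^T = (a *: Q) *m x^T.
  have E1 : (M *m x^T)^T = sg *: (x *m A *m Q).
    rewrite trmx_mul trmxK -mulmxA (AQ Q0) -scalemxAr scalerA -expr2 sqrr_sign scale1r //.
  have E2 : ((a *: Q) *m x^T)^T = sg *: ((a *: x) *m Q).
    by rewrite trmx_mul trmxK linearZ /= trQ -!scalemxAr -scalemxAl scalerA mulrC -scalerA.
  have sgI (N N' : 'rV[K]_m) : sg *: N = sg *: N' -> N = N'.
    by move/(congr1 (fun z => sg *: z)); rewrite !scalerA -expr2 sqrr_sign !scale1r.
  split=> [e|/(congr1 trmx)]; first by apply: trmx_inj; rewrite E1 E2 e.
  by rewrite E1 E2 => /sgI /(congr1 (mulmx^~ (invmx Q))); rewrite !mulmxK.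
rewrite step; split=> e.
  apply: vec_of_row_eq => z; rewrite pair_eta linearZ (fZr HV) pair_Q /gramB.
  by rewrite -!mulmxA e -scalemxAl -scalemxAr [in LHS]mxE.
apply: mx_pair => z; rewrite -pair_eta e linearZ (fZr HV) pair_Q /gramB.
by rewrite -scalemxAr -scalemxAl [in RHS]mxE.
Qed.

(** On the image of xi^*, Norm acts through c |-> c + eta^-1 xi xi^* c, which is -
    eta^-1 eta^* c. *)
Lemma h_xs c : h (xs c) = xs (c + (eta^-1)%VF (xi (xs c))).
Proof. by rewrite NormE linearD. Qed.

(** An eigenvector of A for a gives an eigenvector of Norm for t = 1 - 1 / a. The pair
    a, 1 - a corresponds to t, t^-1, and the equality of a (1 - a) for two indices to t
    i = t j or t i t j = 1. The sign in - f i compensates the sign in B_xs. *)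
Theorem crit_Norm : bijective eta -> crit eps M != 0 ->
  exists (e f : 'I_r -> Xt) t, [/\ frame B e f, Gm t, regular eps t & h = tor B e f t].
Proof.
move=> be /(crit_diag two mr) [M0 Q0 [e [f [a [[He eA fA] [a01 zd aeps]]]]]].
have HQ := gramB_isform Q0.
pose E i := xs (vec_of_row (e i)); pose G i := xs (vec_of_row (- f i)).
have HE : frame B E G.
  split=> i j; rewrite /E /G B_xs ?(fNr HQ) ?(fNl HQ) ?opprK.
  - by rewrite (fr_ee He) oppr0.
  - by rewrite (fr_ff He) oppr0.
  exact: (fr_ef He).
have hx x c : c != 0 -> x *m A = c *: x -> h (xs (vec_of_row x)) = (1 - c^-1) *: xs (vec_of_row x).
  move=> c0 /(eigen_A _ _ Q0) ex; rewrite h_xs xxs -linearZ; congr (xs _).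
  rewrite scalerBl scale1r; congr (_ + _); rewrite -scaleNr.
  apply: (bij_inj be); rewrite (bij_invr be) linearZ /= [in RHS]ex scalerA mulNr mulVf //.
  by rewrite scaleN1r.
pose t i := 1 - (a i)^-1.
have tE i : t i = (a i - 1) / a i by have [a0 _] := a01 i; rewrite /t mulrBl mulfV // mul1r.
have tV i : (t i)^-1 = 1 - (1 - a i)^-1.
  have [a0 a1] := a01 i; have a1' : 1 - a i != 0 by rewrite subr_eq0 eq_sym.
  have a1'' : a i - 1 != 0 by rewrite subr_eq0.
  by rewrite tE invf_div; field; rewrite a1' a1''.
have tm : Gm t.
  by move=> i; have [a0 a1] := a01 i; rewrite tE mulf_neq0 ?invr_eq0 // subr_eq0.
exists E, G, t; split=> //.
- split=> [i|i j /eqP ij|he i].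
  + by have [a0 _] := a01 i; rewrite /t -subr_eq0 addrAC subrr add0r oppr_eq0 invr_eq0.
  + have aij : a i != a j by apply: contraNneq (zd i j ij) => ->.
    split; first by apply: contra aij => /eqP /addrI /oppr_inj /invr_inj ->.
    apply: contra (zd i j ij) => /eqP tt.
    have : t i = (t j)^-1 by apply: (mulIf (tm j)); rewrite tt mulVf.
    rewrite tV => /addrI /oppr_inj /invr_inj ->; rewrite subKr mulrC //.
  apply: contra (aeps he i); have [a0 _] := a01 i; rewrite tE => /eqP tt.
  have : a i - 1 = - a i by rewrite -[LHS](divfK a0) tt mulN1r.
  by move=> e1; apply/eqP/(addIr (- 1)); rewrite e1 addrAC subrr add0r.
apply: (frame_ext HB HE) => [i|i|x px].
- by rewrite (tor_e HB HE); have [a0 _] := a01 i; apply: hx.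
- rewrite (tor_f HB HE) tV; have [_ a1] := a01 i; apply: hx.
    by rewrite subr_eq0 eq_sym.
  by rewrite mulNmx fA scalerN.
rewrite (tor_perp HB _ px) NormE.
suff -> : xi x = 0 by rewrite !linear0 addr0.
apply: vec_of_row_eq => y; rewrite linear0 (f0r HV) -(adj_xiE HP).
have -> : y = dgf (gramB eps M) e f (fun=> 1) (fun=> 1) y.
  apply/subr0_eq; have := introT (mem_pspace HQ He _) (perp_sub HQ He y).
  suff /eqP -> : pspace (gramB eps M) e f == 0%VS by rewrite memv0 => /eqP.
  have := dim_pspace HQ He; rewrite card_ord dim_rV [X in _ = X]mr => /eqP.
  by rewrite -[X in _ == X]add0n eqn_add2r dimv_eq0.
rewrite -[LHS]/(B (xs (vec_of_row _)) x).
rewrite (dgE HQ) -[vec_of_row _](linfun_linE vec_of_row_lin) linearD !linear_sum linearD !linear_sum /=.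
rewrite (fDl HB) !(fsuml HB) !big1 ?addr0 // => i _; rewrite linearZ /= linearZ (fZl HB) (linfun_linE vec_of_row_lin);
  have [h1 h2 h3 h4] := perpC HB px i.
  by move: h3; rewrite /G vec_of_rowN linearN (fNl HB) => /eqP; rewrite oppr_eq0 => /eqP ->; rewrite mulr0.
by move: h1; rewrite /E => ->; rewrite mulr0.
Qed.

(** If Norm is regular its eigenvectors fill the image of xi^*, so xi^* is injective and
    the frame can be lifted to eigenvectors of A. *)
Theorem Norm_crit (e f : 'I_r -> Xt) t : bijective eta -> frame B e f -> Gm t -> regular eps t ->
  h = tor B e f t -> crit eps M != 0.
Proof.
move=> be He tm [t1 tij teps] hE.
have imE : limg (h - \1)%VF%R = <<frseq e f>>%VS by rewrite hE (tor_limg HB He).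
have hd x : (h - \1)%VF%R x = xs ((eta^-1)%VF (xi x)).
  by rewrite add_lfunE opp_lfunE id_lfunE NormE addrC addKr.
have sub : (<<frseq e f>> <= limg xs)%VS.
  by rewrite -imE; apply/subvP => _ /memv_imgP [x _ ->]; rewrite hd memv_img ?memvf.
have dimE : \dim <<frseq e f>>%VS = m by rewrite (dim_span_frseq HB He) card_ord mr.
have le : (\dim (limg xs) <= m)%N.
  by have := limg_ker_dim xs fullv; rewrite capfv => <-; apply: leq_addl.
have imx : limg xs = <<frseq e f>>%VS.
  by apply/eqP; rewrite eq_sym eqEdim sub dimE.
have xinj : injective xs.
  apply/lker0P; rewrite -dimv_eq0; have := limg_ker_dim xs fullv.
  by rewrite capfv imx dimE => /eqP; rewrite -[X in _ == X]add0n eqn_add2r.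
have Q0 : \det (gramQ eps M) != 0.
  rewrite -det_tr; apply/det0P => -[y y0 yQ]; case/negP: y0; apply/eqP/vec_of_row0/xinj.
  rewrite linear0; have : xi (xs (vec_of_row y)) = 0.
    rewrite xxs; apply/eqP; rewrite oppr_eq0; apply/eqP/vec_of_row_eq => x.
    rewrite pair_Q linear0 (f0r HV) /gramB -mulmxA (_ : gramQ eps M *m y^T = 0) ?mulmx0 ?mxE //.
    by apply: trmx_inj; rewrite trmx_mul trmxK yQ trmx0.
  move=> x0; have px : perp B e f (xs (vec_of_row y)).
    by apply: (perp_fixed HB He t1); rewrite -hE NormE x0 !linear0 addr0.
  have : xs (vec_of_row y) \in limg xs by rewrite memv_img ?memvf.
  rewrite imx -(limg_dg1 HB He) => /memv_imgP [u _ uE]; rewrite uE in px *.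
  have := dg_perp HB (fun=> 1) (fun=> 1) px; rewrite -comp_lfunE (dg_comp HB He).
  by under eq_fun do rewrite mulr1.
have lift v : v \in <<frseq e f>>%VS -> exists x, xs (vec_of_row x) = v.
  rewrite -imx => /memv_imgP [c _ ->]; have [x <-] := vec_of_row_surj c.
  by exists x.
have /choice [x xE] := fun i => lift _ (memv_span (mem_frseq_e e f i)).
have /choice [y yE] := fun i => lift _ (memv_span (mem_frseq_f e f i)).
have eig z c : c != 1 -> h (xs (vec_of_row z)) = c *: xs (vec_of_row z) -> z *m A = (1 - c)^-1 *: z.
  move=> c1; rewrite h_xs -linearZ => /xinj e1; apply/(eigen_A _ _ Q0).
  have c1' : 1 - c != 0 by rewrite subr_eq0 eq_sym.
  have : (eta^-1)%VF (xi (xs (vec_of_row z))) = (c - 1) *: vec_of_row z.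
    by rewrite scalerBl scale1r -e1 addrC addKr.
  move/(congr1 eta); rewrite (bij_invr be) xxs linearZ /= => e2.
  have -> : eta (vec_of_row z) + es (vec_of_row z) = (1 - c) *: eta (vec_of_row z).
    by rewrite -[LHS]opprK e2 -scaleNr opprB.
  by rewrite scalerA mulVf // scale1r.
pose a i := (1 - t i)^-1.
have t1' i : 1 - t i != 0 by rewrite subr_eq0 eq_sym.
have t1'' i : t i - 1 != 0 by rewrite subr_eq0.
have aN i : 1 - a i = (1 - (t i)^-1)^-1.
  by rewrite /a; field; rewrite t1' (tm i) t1''.
apply: (@diag_crit _ _ _ _ _ two mr x (fun i => - y i) a) => //.
- exact: eta_bij_det.
- have HQ := gramB_isform Q0.
  have BQ u v : gramB eps M u v = - B (xs (vec_of_row u)) (xs (vec_of_row v)) by rewrite B_xs opprK.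
  split=> [|i|i].
  + split=> i j; rewrite ?(fNr HQ) ?(fNl HQ) BQ ?opprK ?xE ?yE.
    * by rewrite (fr_ee He) oppr0.
    * by rewrite (fr_ff He) oppr0.
    exact: (fr_ef He).
  + by apply: eig => //; rewrite xE hE (tor_e HB He).
  rewrite mulNmx scalerN aN; congr (- _); apply: eig; first by rewrite invr_eq1.
  by rewrite yE hE (tor_f HB He).
split=> [i|i j ij|he i].
- split; first by rewrite invr_eq0.
  rewrite /a invr_eq1 -subr_eq0 addrAC subrr add0r oppr_eq0; exact: tm.
- have [h1 h2] := tij i j (elimN eqP ij).
  have -> : (a i * (1 - a i) != a j * (1 - a j)) = ((a i - a j) * (1 - a j - a i) != 0).
    by rewrite -subr_eq0; congr (_ != 0); ring.
  rewrite mulf_neq0 // subr_eq0.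
    by apply: contra h1 => /eqP /invr_inj /addrI /oppr_inj ->.
  rewrite aN; apply: contra h2 => /eqP /invr_inj /addrI /oppr_inj <-.
  by rewrite mulVf.
rewrite aN; apply: contra (teps he i) => /eqP /invr_inj /addrI /oppr_inj e1.
have : t i * t i = 1 by rewrite {2}e1 mulfV.
by move/eqP; rewrite -expr2 sqrf_eq1 (negbTE (t1 i)).
Qed.
End Pair.
End Transport.

(** * Tori defined over the base field *)

Section Descent.
Variables (F K : fieldType) (iota : {rmorphism F -> K}).
Variables (T : Type) (N : nat) (c : T -> 'I_N -> K).

Definition lin_indep n (u : 'I_n -> K) :=
  forall a : 'I_n -> F, \sum_l u l * iota (a l) = 0 -> forall l, a l = 0.

(** An expression of a polynomial as a K-combination of F-polynomials with the least
    number of terms has independent coefficients. So it suffices to show that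
    independent coefficients cannot cancel on A. *)
Lemma descent (A : set T) : zclosed c A ->
  (forall n (u : 'I_n -> K) (P : 'I_n -> {mpoly F[N]}), lin_indep u ->
     (forall x, A x -> \sum_l u l * (map_mpoly iota (P l)).@[c x] = 0) ->
     forall l x, A x -> (map_mpoly iota (P l)).@[c x] = 0) ->
  defined_over iota c A.
Proof.
move=> zA H; split=> // p pA.
suff key n (u : 'I_n -> K) (P : 'I_n -> {mpoly F[N]}) : p = \sum_l u l *: map_mpoly iota (P l) ->
   exists s : seq (K * {mpoly F[N]}),
      (forall v, v \in s -> ideal_of c A (map_mpoly iota v.2)) /\
      p = \sum_(v <- s) v.1 *: map_mpoly iota v.2.
  pose s := msupp p.
  apply: (key (size s) (fun l => p@_(tnth (in_tuple s) l)) (fun l => 'X_[tnth (in_tuple s) l])).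
  rewrite {1}[p]mpolyE (big_tnth _ _ (msupp p)); apply: eq_bigr => l _.
  by rewrite map_mpolyX.
elim: n u P => [|n IH] u P pE.
  by exists [::]; split=> //; rewrite big_nil pE big_ord0.
have [ind|/existsNP [a /not_implyP [a0 /existsNP [k /eqP ak]]]] := pselect (lin_indep u).
  exists [seq (u l, P l) | l <- enum 'I_n.+1]; split; last by rewrite big_map big_enum.
  move=> _ /mapP [l _ ->] x Ax; apply: (H _ u P ind _ l x Ax) => y Ay.
  have := pA y Ay; rewrite pE (big_morph (meval _) (mevalD _) (meval0 _)) => e.
  by rewrite -[RHS]e; apply: eq_bigr => i _; rewrite mevalZ.
apply: (IH (fun l => u (lift k l)) (fun l => P (lift k l) - (a (lift k l) / a k) *: P k)).
have uk : u k = - \sum_(l < n) u (lift k l) * iota (a (lift k l) / a k).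
  have ik : iota (a k) != 0 by rewrite fmorph_eq0.
  apply: (mulIf ik); move: a0; rewrite (bigD1_ord k) //= => /eqP; rewrite addr_eq0 => /eqP ->.
  rewrite mulNr mulr_suml; congr (- _); apply: eq_bigr => l _.
  by rewrite -mulrA -rmorphM divfK.
rewrite pE (bigD1_ord k) //= uk scaleNr scaler_suml -sumrN -big_split; apply: eq_bigr => l _ /=.
by rewrite rmorphB /= map_mpolyZ scalerBr scalerA addrC.
Qed.
End Descent.

Section Fraction.
Variables (F K : fieldType) (iota : {rmorphism F -> K}).
Variables (T : Type) (N : nat) (c : T -> 'I_N -> K) (d : T -> K).
Hypothesis pd : polyfn iota c d.

Definition fracfn (g : T -> K) := exists n, polyfn iota c (fun x => d x ^+ n * g x).

Lemma fracfn_poly g : polyfn iota c g -> fracfn g.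
Proof. by move=> pg; exists 0%N; apply: eq_polyfn pg => x; rewrite mul1r. Qed.
Lemma fracfnM g h : fracfn g -> fracfn h -> fracfn (fun x => g x * h x).
Proof.
move=> [n pn] [m pm]; exists (n + m)%N; apply: eq_polyfn (polyfnM pn pm) => x.
by rewrite exprD mulrACA.
Qed.
Lemma fracfnD g h : fracfn g -> fracfn h -> fracfn (fun x => g x + h x).
Proof.
move=> [n pn] [m pm]; exists (n + m)%N.
apply: eq_polyfn (polyfnD (polyfnM (polyfnX m pd) pn) (polyfnM (polyfnX n pd) pm)) => x.
by rewrite mulrDr exprD !mulrA [_ ^+ m * _]mulrC.
Qed.
Lemma eq_fracfn g h : g =1 h -> fracfn g -> fracfn h.
Proof. by move=> e [n pn]; exists n; apply: eq_polyfn pn => x; rewrite e. Qed.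
Lemma fracfn_div g : polyfn iota c g -> fracfn (fun x => (d x)^-1 * g x).
Proof.
move=> pg; exists 2%N; apply: eq_polyfn (polyfnM pd pg) => x.
rewrite mulrA expr2; have [->|d0] := eqVneq (d x) 0; first by rewrite !mul0r.
by rewrite mulfK.
Qed.
Lemma fracfnX g n : fracfn g -> fracfn (fun x => g x ^+ n).
Proof.
move=> fg; elim: n => [|n IH].
  by apply: eq_fracfn (fracfn_poly (polyfnC iota c 1)) => x; rewrite rmorph1 expr0.
by apply: eq_fracfn (fracfnM fg IH) => x; rewrite exprS.
Qed.
Lemma fracfn_prod (J : Type) (s : seq J) (g : J -> T -> K) :
  (forall j, fracfn (g j)) -> fracfn (fun x => \prod_(j <- s) g j x).
Proof.
move=> fg; elim: s => [|j s IH].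
  by apply: eq_fracfn (fracfn_poly (polyfnC iota c 1)) => x; rewrite big_nil rmorph1.
by apply: eq_fracfn (fracfnM (fg j) IH) => x; rewrite big_cons.
Qed.
Lemma fracfn_sum (J : Type) (s : seq J) (g : J -> T -> K) :
  (forall j, fracfn (g j)) -> fracfn (fun x => \sum_(j <- s) g j x).
Proof.
move=> fg; elim: s => [|j s IH].
  by apply: eq_fracfn (fracfn_poly (polyfnC iota c 0)) => x; rewrite big_nil rmorph0.
by apply: eq_fracfn (fracfnD (fg j) IH) => x; rewrite big_cons.
Qed.
Lemma fracfn_meval M (p : {mpoly F[M]}) (g : T -> 'I_M -> K) :
  (forall l, fracfn (g^~ l)) -> fracfn (fun x => (map_mpoly iota p).@[g x]).
Proof.
move=> fg; apply: (@eq_fracfn (fun x => \sum_(m <- msupp p) iota p@_m * \prod_i g x i ^+ m i)).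
  move=> x; rewrite [p in RHS]mpolyE (raddf_sum (map_mpoly iota)) (raddf_sum (meval (g x))); apply: eq_bigr => m _.
  by rewrite -[RHS]/(meval (g x) (map_mpoly iota _)) map_mpolyZ map_mpolyX mevalZ mevalX.
apply: fracfn_sum => m; apply: fracfnM; first exact/fracfn_poly/polyfnC.
by apply: fracfn_prod => i; apply: fracfnX.
Qed.
End Fraction.

(** The coefficients of the polynomial that vanishes identically are combinations, with
    coefficients u l, of elements of F. *)
Lemma polyfn_indep (F : fieldType) (K : closedFieldType) (iota : {rmorphism F -> K}) m n
    (u : 'I_n -> K) (R : 'I_n -> ('I_m -> K) -> K) :
  lin_indep iota u -> (forall l, polyfn iota id (R l)) ->
  (forall x, \sum_l u l * R l x = 0) -> forall l x, R l x = 0.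
Proof.
move=> ind /choice [p pE] uR l x.
pose q := \sum_l u l *: map_mpoly iota (p l).
have q0 : q = 0.
  apply/eqP; apply: contraT => /mpoly_nonroot [v _]; rewrite /q.
  rewrite (big_morph (meval _) (mevalD _) (meval0 _)) => /eqP; case.
  by rewrite -[RHS](uR v); apply: eq_bigr => i _; rewrite mevalZ pE.
rewrite pE (_ : p l = 0) ?raddf0 ?meval0 //; apply/mpolyP => k; rewrite mcoeff0.
apply: (ind (fun l => (p l)@_k)); transitivity q@_k; last by rewrite q0 mcoeff0.
by rewrite /q raddf_sum; apply: eq_bigr => i _ /=; rewrite mcoeffZ mcoeff_map_mpoly.
Qed.

(** A finite family from P with the largest possible span. *)
Lemma span_max (F : fieldType) (U : vectType F) (P : U -> Prop) :
  exists s : seq U, (forall x, x \in s -> P x) /\ (forall x, P x -> x \in <<s>>%VS).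
Proof.
suff: forall n (s : seq U), (forall x, x \in s -> P x) -> (\dim {:U} - \dim <<s>> < n)%N ->
   exists s : seq U, (forall x, x \in s -> P x) /\ (forall x, P x -> x \in <<s>>%VS).
  by move=> /(_ (\dim {:U} - \dim <<([::] : seq U)>>).+1 [::]); apply.
elim=> // n IH s sP sn.
have [h|/existsNP [x /not_implyP [Px /negP xs]]] := pselect (forall x, P x -> x \in <<s>>%VS); first by exists s.
apply: (IH (x :: s)) => [y|]; first by rewrite inE => /orP [/eqP ->|/sP].
have lt : (\dim <<s>> < \dim <<x :: s>>)%N.
  have sub : (<<s>> <= <<x :: s>>)%VS by rewrite span_cons addvSr.
  rewrite (ltn_neqAle) dimvS // andbT; apply: contra xs => /eqP e.
  have : <<s>>%VS == <<x :: s>>%VS by rewrite eqEdim sub e leqnn.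
  by move=> /eqP ->; rewrite memv_span // mem_head.
have := dimvS (subvf <<x :: s>>%VS); have := dimvS (subvf <<s>>%VS).
by lia.
Qed.

Section RationalFrame.
Variables (F : fieldType) (K : closedFieldType) (iota : {rmorphism F -> K}).
Variables (U : vectType F) (UK : vectType K) (j : U -> UK).
Hypothesis Hj : bchange iota j.
Variables (eps : bool) (B0 : U -> U -> F) (B : UK -> UK -> K).
Hypothesis HB0 : isform eps B0.
Hypothesis HB : isform eps B.
Hypothesis jB : forall u v, B (j u) (j v) = iota (B0 u v).
Local Notation bK := (map_tuple j (vbasis {:U})).
Local Notation c := (coords j).

(** Matrices with entries in coordinates on a rational basis, acting on row vectors;
    composition is therefore reversed. *)
Definition mat (g : 'End(UK)) : 'M[K]_(\dim {:U}) := \matrix_(i, k) coord bK k (g bK`_i).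
Definition rv (v : UK) : 'rV[K]_(\dim {:U}) := \row_i coord bK i v.

Lemma rv_inj v : rv v = 0 -> v = 0.
Proof.
move=> h; rewrite (basis_expand Hj v) big1 // => i _.
by move/rowP/(_ i): h; rewrite !mxE => ->; rewrite scale0r.
Qed.

Lemma rv_mat (g : 'End(UK)) v : rv (g v) = rv v *m mat g.
Proof.
apply/rowP => i; rewrite !mxE {1}(basis_expand Hj v) !linear_sum; apply: eq_bigr => k _.
by rewrite !linearZ !mxE (bc_nth Hj).
Qed.

Lemma mat_comp (g h : 'End(UK)) : mat (g \o h)%VF = mat h *m mat g.
Proof.
apply/row_matrixP => i; rewrite row_mul.
have E k : row i (mat k) = rv (k bK`_i) by apply/rowP => l; rewrite !mxE.
by rewrite !E comp_lfunE rv_mat.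
Qed.

Lemma mat1 : mat \1%VF = 1%:M.
Proof.
apply/matrixP => i k; rewrite !mxE id_lfunE (coord_free _ _ (basis_free (bchange_basis Hj))).
by rewrite eq_sym.
Qed.

Lemma mat_bcf (a : 'End(U)) i k : mat (bcf j j a) i k = iota (coord (vbasis {:U}) k (a (vbasis {:U})`_i)).
Proof. by rewrite mxE (bc_nth Hj) (bcfE Hj Hj) (bc_coord Hj). Qed.

(** The adjoint of a rational operator is rational, since the form is. *)
Lemma bc_adj (a : 'End(U)) : exists a' : 'End(U),
  forall x y, B (bcf j j a' x) y = B x (bcf j j a y).
Proof.
have [a' a'E] : exists g : 'Hom(U, U), forall u v, B0 (g u) v = B0 u (a v).
  apply: (@pairing_adj _ _ _ _ B0 (fun u v => B0 u (a v))) => //.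
  - by move=> y b u v; rewrite (form_linl HB0).
  - by move=> x b u v; rewrite (fDr HB0) (fZr HB0).
  - by move=> y b u v; rewrite (form_linl HB0).
  - by move=> x b u v; rewrite linearP (fDr HB0) (fZr HB0).
  exact: (form_nondeg HB0).
exists a' => x y; rewrite (basis_expand Hj x) linear_sum !(fsuml HB); apply: eq_bigr => i _.
rewrite linearZ /= !(fZl HB) (basis_expand Hj y) linear_sum !(fsumr HB); congr (_ * _).
apply: eq_bigr => k _.
by rewrite linearZ /= !(fZr HB) !(bcfE Hj Hj) !jB a'E.
Qed.

Section Frame.
Variables (r : nat) (e f : 'I_r -> UK).
Hypothesis He : frame B e f.
Local Notation dg := (dgf B e f).
Local Notation S := (tor B e f @` @Gm K r).

(** The diagonal operator with eigenvalues a and b, normalized to be the identity on the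
    complement; tor e f t is dia t t^-1. *)
Definition dia (a b : 'I_r -> K) : 'End(UK) :=
  (\1 + dg (fun i => a i - 1)%R (fun i => b i - 1)%R)%VF.

Lemma dia_e a b i : dia a b (e i) = a i *: e i.
Proof. by rewrite add_lfunE id_lfunE (dg_e HB He) scalerBl scale1r addrC subrK. Qed.
Lemma dia_f a b i : dia a b (f i) = b i *: f i.
Proof. by rewrite add_lfunE id_lfunE (dg_f HB He) scalerBl scale1r addrC subrK. Qed.
Lemma dia_comp a b a' b' :
  (dia a b \o dia a' b')%VF = dia (fun i => a i * a' i) (fun i => b i * b' i).
Proof.
apply: (frame_ext HB He) => [i|i|x px]; rewrite comp_lfunE.
- by rewrite !dia_e linearZ /= dia_e scalerA mulrC.
- by rewrite !dia_f linearZ /= dia_f scalerA mulrC.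
by rewrite /dia !add_lfunE !id_lfunE !(dg_perp HB _ _ px) !addr0 (dg_perp HB _ _ px) addr0.
Qed.
Lemma dia1 a b : (forall i, a i = 1) -> (forall i, b i = 1) -> dia a b = \1%VF.
Proof.
move=> a1 b1; apply/lfunP => x; rewrite add_lfunE (dgE HB) !big1 ?addr0 // => i _.
  by rewrite b1 subrr mul0r scale0r.
by rewrite a1 subrr mul0r scale0r.
Qed.

Lemma e_nz i : e i != 0.
Proof.
apply/eqP => e0; have := fr_ef He i i; rewrite e0 (f0l HB) eqxx => /eqP.
by rewrite eq_sym oner_eq0.
Qed.
Lemma f_nz i : f i != 0.
Proof.
apply/eqP => e0; have := fr_ef He i i; rewrite e0 (f0r HB) eqxx => /eqP.
by rewrite eq_sym oner_eq0.
Qed.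

Definition rational (D : 'End(UK)) := exists a p q, D = bcf j j a /\ D = dg p q.

Lemma dg_adj p q x y : B (dg p q x) y = B x (dg q p y).
Proof.
rewrite !(dgE HB) (fDl HB) (fDr HB) addrC !(fsuml HB) !(fsumr HB).
congr (_ + _); apply: eq_bigr => i _; rewrite !(fZl HB) !(fZr HB); last by ring.
rewrite [B (e i) x](fC HB) [B (f i) y](fC HB).
have E (s u v w : K) : s * s = 1 -> u * (s * v) * (s * w) = u * w * v.
  by move=> h; rewrite -[RHS]mul1r -h; ring.
exact/E/sgK.
Qed.

Lemma rational_adj a p q : bcf j j a = dg p q -> exists a', bcf j j a' = dg q p.
Proof.
move=> ap; have [a' a'E] := bc_adj a; exists a'; apply/lfunP => x; apply: (form_inj HB) => y.
by rewrite a'E ap dg_adj.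
Qed.

(** Fix rational operators A_l that span the diagonal ones. For x in K^m put b x = 1 +
    \sum_l x_l A_l; where b x and its adjoint are invertible, b x composed with the
    inverse of the adjoint lies in the torus, with coordinates that are fractions over F
    in x with denominator d x. Every element tor t is obtained, from the b with
    eigenvalues t on e and 1 on f. A K-linear relation with F-independent coefficients
    between F-polynomials on the torus thus becomes one between F-polynomials in x,
    where it decomposes. *)
Theorem rational_frame_def :
  (forall L : {vspace 'End(UK)}, (forall D, rational D -> D \in L) -> forall p q, dg p q \in L) ->
  defined_over iota c S.
Proof.
move=> spans; have [cE cEE] := coords_rec Hj.
apply: descent; first exact: (frame_torus_zclosed HB cEE He).
move=> n u P ind PS.
have [s [sP sL]] := span_max rational.
pose m := size s.
have /choice [a] : forall i : 'I_m, exists apq : 'End(U) * (('I_r -> K) * ('I_r -> K)),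
    s`_i = bcf j j apq.1 /\ s`_i = dg apq.2.1 apq.2.2.
  by move=> i; have [b [p [q h]]] := sP s`_i (mem_nth 0 (ltn_ord i)); exists (b, (p, q)).
move=> aP.
pose p i := (a i).2.1; pose q i := (a i).2.2.
have /choice [a' a'P] : forall i : 'I_m, exists a', bcf j j a' = dg (q i) (p i).
  by move=> i; have [h1 h2] := aP i; apply: (@rational_adj (a i).1); rewrite -h1 -h2.
pose pp (x : 'I_m -> K) k := 1 + \sum_l x l * p l k.
pose qq (x : 'I_m -> K) k := 1 + \sum_l x l * q l k.
have dsum (x : 'I_m -> K) (g h : 'I_m -> 'I_r -> K) : (\1 + \sum_l x l *: dg (g l) (h l))%VF =
   dia (fun k => 1 + \sum_l x l * g l k) (fun k => 1 + \sum_l x l * h l k).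
  apply: (frame_ext HB He) => [i|i|y py].
  - rewrite dia_e add_lfunE sum_lfunE id_lfunE scalerDl scale1r scaler_suml; congr (_ + _).
    by apply: eq_bigr => l _; rewrite scale_lfunE (dg_e HB He) scalerA.
  - rewrite dia_f add_lfunE sum_lfunE id_lfunE scalerDl scale1r scaler_suml; congr (_ + _).
    by apply: eq_bigr => l _; rewrite scale_lfunE (dg_f HB He) scalerA.
  rewrite /dia !add_lfunE sum_lfunE big1 ?(dg_perp HB _ _ py) // => l _.
  by rewrite scale_lfunE (dg_perp HB _ _ py) scaler0.
have pmat (al : 'I_m -> 'End(U)) (g h : 'I_m -> 'I_r -> K) : (forall l, bcf j j (al l) = dg (g l) (h l)) ->
   forall i k, polyfn iota id (fun x : 'I_m -> K => mat (dia (fun k => 1 + \sum_l x l * g l k) (fun k => 1 + \sum_l x l * h l k)) i k).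
  move=> alE i k; apply: (@eq_polyfn _ _ iota _ _ id (fun x : 'I_m -> K => iota (i == k)%:R + \sum_l x l *
      iota (coord (vbasis {:U}) k ((al l) (vbasis {:U})`_i)))).
    move=> x; rewrite -dsum [in RHS]mxE add_lfunE id_lfunE linearD /= sum_lfunE linear_sum; congr (_ + _).
      by rewrite (coord_free _ _ (basis_free (bchange_basis Hj))) rmorph_nat eq_sym.
    by apply: eq_bigr => l _; rewrite scale_lfunE linearZ /= -alE -mat_bcf mxE.
  apply: polyfnD; first exact: polyfnC.
  by apply: polyfn_sum => l; apply: polyfnM; [exact: polyfn_coord|exact: polyfnC].
pose M x := mat (dia (pp x) (qq x)); pose M' x := mat (dia (qq x) (pp x)).
have pM : forall i k, polyfn iota id (fun x => M x i k).
  by apply: (pmat (fun l => (a l).1)) => l; have [h1 h2] := aP l; rewrite -h1 h2.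
have pM' : forall i k, polyfn iota id (fun x => M' x i k) by apply: (pmat a').
(* The determinant of the adjoint of b x: the common denominator of the parametrization. *)
pose d x := \det (M' x).
have pd : polyfn iota id d by apply: polyfn_det.
pose G x := \adj (M' x) *m M x.
have pG : forall i k, polyfn iota id (fun x => G x i k) by apply: polyfn_mulmx => //; apply: polyfn_adj.
pose g x l := (d x)^-1 * mxvec (G x) 0 l.
have fg l : fracfn iota id d (g^~ l).
  apply: fracfn_div => //; case/mxvec_indexP: l => i k.
  by apply: eq_polyfn (pG i k) => x; rewrite mxvecE.
have gE x (t : 'I_r -> K) : (forall i, pp x i = t i * qq x i) -> (forall i, qq x i = (t i)^-1 * pp x i) ->
    d x != 0 -> g x = c (tor B e f t).
  move=> h1 h2 d0; apply/funext => l; rewrite /g /coords -/(mat (tor B e f t)).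
  rewrite (_ : mat _ = (d x)^-1 *: G x) ?linearZ ?mxE //.
  have : mat (tor B e f t \o dia (qq x) (pp x))%VF = M x.
    rewrite /M (_ : tor B e f t = dia t (fun i => (t i)^-1)) // dia_comp; congr (mat (dia _ _)).
      by apply/funext => i; rewrite h1.
    by apply/funext => i; rewrite h2.
  rewrite mat_comp -/(M' x) => MM; rewrite /G -MM mulmxA mul_adj_mx -/(d x) mul_scalar_mx scalerA.
  by rewrite mulVf // scale1r.
have d_nz x : d x != 0 -> forall i, pp x i != 0 /\ qq x i != 0.
  move=> d0 i.
  have inj v : dia (qq x) (pp x) v = 0 -> v = 0.
    move=> v0; apply: rv_inj; have : rv v *m M' x = 0.
      by rewrite -rv_mat v0; apply/rowP => k; rewrite !mxE linear0.
    move/(congr1 (mulmx^~ (invmx (M' x)))); rewrite mulmxK ?mul0mx //.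
    by rewrite unitmxE unitfE.
  split; apply/eqP => z; [have := f_nz i|have := e_nz i]; case/negP; apply/eqP/inj.
    by rewrite dia_f z scale0r.
  by rewrite dia_e z scale0r.
move=> l y Sy.
have /choice [D DP] := fun l => fracfn_meval pd (P l) fg.
(* One exponent for all k; the extra factor d x makes the relation hold also where d x = 0. *)
pose R k (x : 'I_m -> K) := d x ^+ (\sum_k D k).+1 * (map_mpoly iota (P k)).@[g x].
have pR k : polyfn iota id (R k).
  apply: eq_polyfn (polyfnM (polyfnX ((\sum_(i | i != k) D i).+1) pd) (DP k)) => x.
  by rewrite /R [in RHS](bigD1 k) //= mulrA -exprD addSn addnC.
have R0 : forall k x, R k x = 0.
  apply: (polyfn_indep ind pR) => x; under eq_bigr do rewrite /R mulrCA.
  rewrite -mulr_sumr; have [d0|d0] := eqVneq (d x) 0; first by rewrite d0 exprS !mul0r.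
  have nz := d_nz x d0.
  pose t i := pp x i / qq x i.
  rewrite (gE x t) //; last 2 first.
  - by move=> i; have [h1 h2] := nz i; rewrite divfK.
  - by move=> i; have [h1 h2] := nz i; rewrite invf_div divfK.
  by rewrite PS ?mulr0 //; exists t => // i; have [h1 h2] := nz i; rewrite mulf_neq0 ?invr_eq0.
case: Sy => t tm <-.
have [x xE] : exists x : 'I_m -> K, dg (fun i => t i - 1) (fun=> 0) = \sum_l x l *: dg (p l) (q l).
  exists (fun l => coord (in_tuple s) l (dg (fun i => t i - 1) (fun=> 0))).
  have sp : dg (fun i => t i - 1) (fun=> 0) \in <<in_tuple s>>%VS.
    exact: (spans <<s>>%VS sL).
  rewrite {1}(coord_span sp) /=.
  by apply: eq_bigr => k _; have [_ <-] := aP k.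
have xd : dia (pp x) (qq x) = dia t (fun=> 1).
  rewrite -dsum -xE; congr (_ + _)%VF; congr (dg _ _).
  by apply/funext => i; rewrite subrr.
have ppE i : pp x i = t i.
  have := congr1 (fun h : 'End(UK) => h (e i)) xd; rewrite /= !dia_e => /eqP.
  by rewrite -subr_eq0 -scalerBl scaler_eq0 (negbTE (e_nz i)) orbF subr_eq0 => /eqP.
have qqE i : qq x i = 1.
  have := congr1 (fun h : 'End(UK) => h (f i)) xd; rewrite /= !dia_f => /eqP.
  by rewrite -subr_eq0 -scalerBl scaler_eq0 (negbTE (f_nz i)) orbF subr_eq0 => /eqP.
have d0 : d x != 0.
  have : mat (dia (fun=> 1%R) (fun i => (t i)^-1)%R \o dia (qq x) (pp x))%VF = 1%:M.
    rewrite dia_comp dia1 ?mat1 // => i; first by rewrite qqE mulr1.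
    by rewrite ppE mulVf.
  rewrite mat_comp => /(congr1 determinant); rewrite det_mulmx det1 => h.
  by apply/eqP => d0; move/eqP: h; rewrite -/(d x) d0 mul0r eq_sym oner_eq0.
have := R0 l x; rewrite /R => /eqP; rewrite mulf_eq0 expf_eq0 (negbTE d0) andbF /= => /eqP.
rewrite (gE x t) // => i; first by rewrite ppE qqE mulr1.
by rewrite ppE qqE mulVf.
Qed.
End Frame.
End RationalFrame.

(** * Rational operators that are diagonal in a frame *)

(** The kernel of an extended map is spanned by rational vectors, because ranks do not
    change. *)
Lemma bc_ker (F K : fieldType) (iota : {rmorphism F -> K}) (U1 U2 : vectType F) (UK1 UK2 : vectType K)
    (j1 : U1 -> UK1) (j2 : U2 -> UK2) (f : 'Hom(U1, U2)) x :
  bchange iota j1 -> bchange iota j2 ->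
  bcf j1 j2 f x = 0 -> x \in <<map j1 (vbasis (lker f))>>%VS.
Proof.
move=> H1 H2 fx.
have dimE : \dim {:UK1} = \dim {:U1}.
  exact: (vector.size_basis (X := map_tuple j1 (vbasis {:U1})) (bchange_basis H1)).
suff -> : <<map j1 (vbasis (lker f))>>%VS = lker (bcf j1 j2 f) by rewrite memv_ker fx.
apply/eqP; rewrite eqEdim; apply/andP; split.
  apply/span_subvP => _ /mapP [u /vbasis_mem uk ->]; rewrite memv_ker (bcfE H1 H2).
  by move: uk; rewrite memv_ker => /eqP ->; rewrite (bc0 H2).
have fr : free (map j1 (vbasis (lker f))) by rewrite (bc_free H1) (basis_free (vbasisP _)).
rewrite (eqP fr) size_map size_tuple.
have := limg_ker_dim f fullv; have := limg_ker_dim (bcf j1 j2 f) fullv.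
by rewrite !capfv (bcf_dim H1 H2) dimE; lia.
Qed.

Section Spans.
Variables (F : fieldType) (K : closedFieldType) (iota : {rmorphism F -> K}).
Variables (U : vectType F) (UK : vectType K) (j : U -> UK).
Hypothesis Hj : bchange iota j.
Variables (eps : bool) (B0 : U -> U -> F) (B : UK -> UK -> K).
Hypothesis HB0 : isform eps B0.
Hypothesis HB : isform eps B.
Hypothesis jB : forall u v, B (j u) (j v) = iota (B0 u v).
Hypothesis two : 2%:R != 0 :> K.
Local Notation sg := ((-1) ^+ eps : K).

Lemma bcf_wedge u v : bcf j j (wedge eps B0 u v) = wedge eps B (j u) (j v).
Proof.
apply: (bc_eq Hj) => x; rewrite (bcfE Hj Hj) (wedgeE HB0) (wedgeE HB) (bcB Hj) !(bchangeZ Hj) !jB.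
by rewrite rmorphM rmorph_sign.
Qed.

Section Frame.
Variables (r : nat) (e f : 'I_r -> UK).
Hypothesis He : frame B e f.
Local Notation dg := (dgf B e f).
Local Notation S := (tor B e f @` @Gm K r).
Local Notation rational := (rational j B e f).
Local Notation dl i := (fun k : 'I_r => (i == k)%:R : K).

Lemma dg_lin a p q p' q' :
  a *: dg p q + dg p' q' = dg (fun k => a * p k + p' k) (fun k => a * q k + q' k).
Proof.
apply: (frame_ext HB He) => [i|i|x px]; rewrite add_lfunE scale_lfunE.
- by rewrite !(dg_e HB He) scalerA -scalerDl.
- by rewrite !(dg_f HB He) scalerA -scalerDl.
by rewrite !(dg_perp HB _ _ px) scaler0 addr0.
Qed.

Lemma dgZ a p q : a *: dg p q = dg (fun k => a * p k) (fun k => a * q k).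
Proof.
apply: (frame_ext HB He) => [i|i|x px]; rewrite scale_lfunE.
- by rewrite !(dg_e HB He) scalerA.
- by rewrite !(dg_f HB He) scalerA.
by rewrite !(dg_perp HB _ _ px) scaler0.
Qed.

Lemma dg_deltas (L : {vspace 'End(UK)}) :
  (forall i, dg (dl i) (fun=> 0) \in L /\ dg (fun=> 0) (dl i) \in L) ->
  forall p q, dg p q \in L.
Proof.
move=> dL p q.
have -> : dg p q = \sum_i (p i *: dg (dl i) (fun=> 0) + q i *: dg (fun=> 0) (dl i)).
  apply: (frame_ext HB He) => [i|i|x px]; rewrite sum_lfunE.
  - rewrite (dg_e HB He) (bigD1 i) //= big1 ?addr0 => [|k ki]; rewrite add_lfunE !scale_lfunE !(dg_e HB He).
      by rewrite eqxx scale1r scale0r scaler0 addr0.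
    by rewrite (negbTE ki) !scale0r !scaler0 addr0.
  - rewrite (dg_f HB He) (bigD1 i) //= big1 ?addr0 => [|k ki]; rewrite add_lfunE !scale_lfunE !(dg_f HB He).
      by rewrite eqxx scale1r scale0r scaler0 add0r.
    by rewrite (negbTE ki) !scale0r !scaler0 addr0.
  rewrite (dg_perp HB _ _ px) big1 // => i _.
  by rewrite add_lfunE !scale_lfunE !(dg_perp HB _ _ px) !scaler0 addr0.
by apply: rpred_sum => i _; have [h1 h2] := dL i; rewrite rpredD ?rpredZ.
Qed.

(** With the operators a (1, -1) and b (1, 1) on the pair of lines e i, f i, halves of
    their sum and difference are the two projections. *)
Lemma dg_pm (L : {vspace 'End(UK)}) i a b : a != 0 -> b != 0 ->
  dg (fun k => a * dl i k) (fun k => - a * dl i k) \in L ->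
  dg (fun k => b * dl i k) (fun k => b * dl i k) \in L ->
  dg (dl i) (fun=> 0) \in L /\ dg (fun=> 0) (dl i) \in L.
Proof.
move=> a0 b0 h1 h2.
have E s : ((2%:R * a)^-1 * s) *: dg (fun k => a * dl i k) (fun k => - a * dl i k) +
    (2%:R * b)^-1 *: dg (fun k => b * dl i k) (fun k => b * dl i k) =
    dg (fun k => 2%:R^-1 * (1 + s) * dl i k) (fun k => 2%:R^-1 * (1 - s) * dl i k).
  rewrite [X in _ + X]dgZ dg_lin; congr (dg _ _); apply/funext => k.
    by field; rewrite two a0 b0.
  by field; rewrite two a0 b0.
have mem s : dg (fun k => 2%:R^-1 * (1 + s) * dl i k) (fun k => 2%:R^-1 * (1 - s) * dl i k) \in L.
  by rewrite -E rpredD ?rpredZ.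
split.
  have := mem 1; rewrite (_ : dg _ _ = dg (dl i) (fun=> 0)) //; congr (dg _ _); apply/funext => k.
    by field.
  by rewrite subrr mulr0 mul0r.
have := mem (-1); rewrite (_ : dg _ _ = dg (fun=> 0) (dl i)) //; congr (dg _ _); apply/funext => k.
  by rewrite subrr mulr0 mul0r.
by field.
Qed.

(** On the plane of e i and f i, a wedge is diagonal with opposite eigenvalues; it
    distinguishes e i from f i. *)
Lemma wedge_frame i : wedge eps B (e i) (f i) =
  dg (fun k => - sg * dl i k) (fun k => - - sg * dl i k).
Proof.
apply: (frame_ext HB He) => [k|k|x px]; rewrite (wedgeE HB).
- rewrite (dg_e HB He) (fr_ee He) (fr_ef He) scale0r add0r eq_sym.
  by have [->|_] := eqVneq i k; rewrite ?mulr1 ?scaleNr // !mulr0 !scale0r oppr0.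
- rewrite (dg_f HB He) (fr_fe HB He) (fr_ff He) mulr0 scale0r subr0 opprK.
  by have [->|_] := eqVneq i k; rewrite // !mulr0 !scale0r.
have [_ h1 _ h2] := perpC HB px i.
by rewrite h1 h2 mulr0 !scale0r subrr (dg_perp HB _ _ px).
Qed.

Lemma rational_comp D D' : rational D -> rational D' -> rational (D \o D')%VF.
Proof.
move=> [a [p [q [h1 h2]]]] [a' [p' [q' [h1' h2']]]].
exists (a \o a')%VF, (fun i => p i * p' i), (fun i => q i * q' i).
by rewrite (bcf_comp _ _ Hj Hj Hj) -h1 -h1' h2 h2' (dg_comp HB He).
Qed.

(** The square of a wedge has equal eigenvalues on e i and f i, so a wedge and its
    square span the two projections. *)
Lemma planes_span (u v : 'I_r -> U) (kap : 'I_r -> K) : (forall i, kap i != 0) ->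
  (forall i, wedge eps B (j (u i)) (j (v i)) = kap i *: wedge eps B (e i) (f i)) ->
  forall L : {vspace 'End(UK)}, (forall D, rational D -> D \in L) -> forall p q, dg p q \in L.
Proof.
move=> kap0 uv L rL; apply: dg_deltas => i.
have s0 : - (kap i * sg) != 0 by rewrite oppr_eq0 mulf_neq0 ?signr_eq0.
pose D := dg (fun k => - (kap i * sg) * dl i k) (fun k => - - (kap i * sg) * dl i k).
have rD : rational D.
  exists (wedge eps B0 (u i) (v i)), (fun k => - (kap i * sg) * dl i k), (fun k => - - (kap i * sg) * dl i k).
  split=> //; rewrite bcf_wedge uv wedge_frame dgZ /D; congr (dg _ _); apply/funext => k.
    by rewrite mulrA mulrN.
  by rewrite mulrA !mulrN.
apply: (dg_pm s0 (mulf_neq0 s0 s0)); first exact: rL.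
suff <- : (D \o D)%VF = dg (fun k => - (kap i * sg) * - (kap i * sg) * dl i k)
    (fun k => - (kap i * sg) * - (kap i * sg) * dl i k) by apply: rL; apply: rational_comp.
by rewrite (dg_comp HB He); congr (dg _ _); apply/funext => k; case: (i == k); rewrite ?mulr0 ?mulr1 ?mulrNN //.
Qed.

Section Isometry.
Variables (h : 'End(U)) (t : 'I_r -> K).
Hypothesis tm : Gm t.
Hypothesis treg : regular eps t.
Hypothesis hE : bcf j j h = tor B e f t.

(** The factor t - 1 makes the operators vanish on the complement of the frame, as
    rational requires. *)
Lemma isometry_poly (L : {vspace 'End(UK)}) : (forall D, rational D -> D \in L) ->
  forall p : {poly K}, dg (fun k => (t k - 1) * p.[t k]) (fun k => ((t k)^-1 - 1) * p.[(t k)^-1]) \in L.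
Proof.
move=> rL p.
have mon n : dg (fun k => (t k - 1) * t k ^+ n) (fun k => ((t k)^-1 - 1) * (t k)^-1 ^+ n) \in L.
  apply: rL; elim: n => [|n [a [p' [q' [h1 h2]]]]].
    exists (h - \1)%VF, (fun k => (t k - 1)), (fun k => ((t k)^-1 - 1)).
    have -> : dg (fun k => (t k - 1) * t k ^+ 0) (fun k => ((t k)^-1 - 1) * (t k)^-1 ^+ 0) =
       dg (fun k => (t k - 1)) (fun k => ((t k)^-1 - 1)).
      by congr (dg _ _); apply/funext => k; rewrite mulr1.
    split=> //; rewrite -(tor_sub1 B e f) -hE; apply: (bc_eq Hj) => u.
    by rewrite (bcfE Hj Hj) !add_lfunE !opp_lfunE !id_lfunE (bcfE Hj Hj) (bcB Hj).
  exists (h \o a)%VF, (fun k => (t k - 1) * t k ^+ n.+1), (fun k => ((t k)^-1 - 1) * (t k)^-1 ^+ n.+1).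
  split=> //; rewrite (bcf_comp _ _ Hj Hj Hj) -h1 hE.
  apply: (frame_ext HB He) => [i|i|x px]; rewrite comp_lfunE.
  - by rewrite !(dg_e HB He) linearZ /= (tor_e HB He) scalerA exprSr mulrA.
  - by rewrite !(dg_f HB He) linearZ /= (tor_f HB He) scalerA exprSr mulrA.
  by rewrite !(dg_perp HB _ _ px) linear0.
have -> : dg (fun k => (t k - 1) * p.[t k]) (fun k => ((t k)^-1 - 1) * p.[(t k)^-1]) =
   \sum_(n < size p) p`_n *: dg (fun k => (t k - 1) * t k ^+ n) (fun k => ((t k)^-1 - 1) * (t k)^-1 ^+ n).
  apply: (frame_ext HB He) => [i|i|x px]; rewrite sum_lfunE.
  - rewrite (dg_e HB He) horner_coef mulr_sumr scaler_suml; apply: eq_bigr => n _.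
    by rewrite scale_lfunE (dg_e HB He) scalerA mulrCA.
  - rewrite (dg_f HB He) horner_coef mulr_sumr scaler_suml; apply: eq_bigr => n _.
    by rewrite scale_lfunE (dg_f HB He) scalerA mulrCA.
  by rewrite (dg_perp HB _ _ px) big1 // => n _; rewrite scale_lfunE (dg_perp HB _ _ px) scaler0.
by apply: rpred_sum => n _; rewrite rpredZ.
Qed.

(** In the symmetric case at most one t i is -1; eigenvectors of an isometry for
    eigenvalues with product different from 1 are orthogonal, so the (-1)-eigenspace is
    the plane of e i and f i. *)
Lemma minus_one_plane i x : t i = -1 -> bcf j j h x = - x ->
  x = B x (f i) *: e i + B (e i) x *: f i.
Proof.
move=> ti hx; have [t1 tij teps] := treg.
have e0 : eps = false by apply/negbTE/negP => /teps /(_ i); rewrite ti eqxx.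
have s1 : sg = 1 by rewrite e0 expr0.
have orth c y : bcf j j h y = c *: y -> c != -1 -> B x y = 0.
  move=> hy c1; have := tor_isom HB He tm x y; rewrite -hE hx hy (fNl HB) (fZr HB) => /eqP.
  rewrite -subr_eq0 (_ : _ - _ = - (c + 1) * B x y); last by ring.
  by rewrite mulf_eq0 oppr_eq0 addr_eq0 (negbTE c1) => /eqP.
have tk k : i <> k -> t k != -1 by move=> ik; have [h1 _] := tij i k ik; rewrite -ti eq_sym.
apply/eqP; rewrite -subr_eq0; apply/eqP.
apply: (frame_eq0 HB He) => [k|k|y py]; rewrite (fBl HB) (fDl HB) !(fZl HB).
- rewrite (fr_ee He) (fr_fe HB He) s1 mul1r mulr0 add0r; have [<-|/eqP ki] := eqVneq i k.
    by rewrite mulr1 (fC HB) s1 mul1r subrr.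
  rewrite mulr0 subr0.
  by apply: (orth (t k)); rewrite ?hE ?(tor_e HB He) ?tk.
- rewrite (fr_ff He) (fr_ef He) mulr0 addr0; have [<-|/eqP ki] := eqVneq i k; first by rewrite mulr1 subrr.
  rewrite mulr0 subr0.
  apply: (orth (t k)^-1); rewrite ?hE ?(tor_f HB He) //.
  by apply: contra (tk k ki) => /eqP h1; rewrite -[t k]invrK h1 invrN invr1.
have [h1 h2 h3 h4] := perpC HB py i; rewrite h1 h3 !mulr0 addr0 subr0.
apply: (orth 1); first by rewrite hE (tor_perp HB _ py) scale1r.
by rewrite -subr_eq0 opprK.
Qed.

(** Lagrange interpolation isolates each eigenvalue, since the t i and their inverses
    are distinct except for t i = t i ^ -1 = -1. In the exceptional case interpolation
    gives the projection on the plane of e i and f i, and a wedge of two rational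
    vectors of this plane separates the two lines. *)
Lemma isometry_span (L : {vspace 'End(UK)}) : (forall D, rational D -> D \in L) ->
  forall p q, dg p q \in L.
Proof.
move=> rL; have pL := isometry_poly rL; have [t1 tij teps] := treg.
have tinv1 k : (t k)^-1 - 1 != 0 by rewrite subr_eq0 invr_eq1.
have tt1 k : t k - 1 != 0 by rewrite subr_eq0.
(* R i vanishes at all eigenvalues except t i and its inverse. *)
pose R i : {poly K} := \prod_(k | k != i) (('X - (t k)%:P) * ('X - ((t k)^-1)%:P)).
have R0 i k : k != i -> (R i).[t k] = 0 /\ (R i).[(t k)^-1] = 0.
  move=> ki; rewrite /R (bigD1 k) //=; split; rewrite !hornerM !hornerXsubC subrr.
    by rewrite !mul0r.
  by rewrite mulr0 mul0r.
have R1 i : (R i).[t i] != 0 /\ (R i).[(t i)^-1] != 0.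
  split; rewrite horner_prod; apply/prodf_neq0 => k ki; rewrite hornerM !hornerXsubC;
    have [h1 h2] := tij i k (fun h => elimN eqP ki (esym h)); rewrite mulf_neq0 ?subr_eq0 //.
  - by apply: contra h2 => /eqP ->; rewrite mulVf.
  - by apply: contra h2 => /eqP <-; rewrite mulfV.
  by apply: contra h1 => /eqP /invr_inj ->.
apply: dg_deltas => i; have [R1e R1f] := R1 i.
have dZ a p q : dg p q \in L -> dg (fun k => a * p k) (fun k => a * q k) \in L.
  by move=> h0; rewrite -dgZ rpredZ.
have [ti|ti] := eqVneq (t i) (-1); last first.
  have tti : t i - (t i)^-1 != 0.
    rewrite subr_eq0; apply: contra ti => /eqP h1.
    have : t i ^+ 2 == 1 by rewrite expr2 {1}h1 mulVf.
    by rewrite sqrf_eq1 (negbTE (t1 i)).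
  split.
    set a := (t i - 1) * (R i * ('X - ((t i)^-1)%:P)).[t i].
    have a0 : a != 0 by rewrite mulf_neq0 // hornerM hornerXsubC mulf_neq0.
    have := dZ a^-1 _ _ (pL (R i * ('X - ((t i)^-1)%:P))).
    rewrite (_ : dg _ _ = dg (dl i) (fun=> 0)) //; congr (dg _ _); apply/funext => k.
      have [<-|ki] := eqVneq i k; first by rewrite mulVf.
      by have [h1 h2] := R0 i k (contra_neq (@esym _ _ _) ki); rewrite hornerM h1 mul0r !mulr0.
    have [<-|ki] := eqVneq i k; first by rewrite hornerM hornerXsubC subrr !mulr0.
    by have [h1 h2] := R0 i k (contra_neq (@esym _ _ _) ki); rewrite hornerM h2 mul0r !mulr0.
  set a := ((t i)^-1 - 1) * (R i * ('X - (t i)%:P)).[(t i)^-1].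
  have a0 : a != 0 by rewrite mulf_neq0 // hornerM hornerXsubC mulf_neq0 // -opprB oppr_eq0.
  have := dZ a^-1 _ _ (pL (R i * ('X - (t i)%:P))).
  rewrite (_ : dg _ _ = dg (fun=> 0) (dl i)) //; congr (dg _ _); apply/funext => k.
    have [<-|ki] := eqVneq i k; first by rewrite hornerM hornerXsubC subrr !mulr0.
    by have [h1 h2] := R0 i k (contra_neq (@esym _ _ _) ki); rewrite hornerM h1 mul0r !mulr0.
  have [<-|ki] := eqVneq i k; first by rewrite mulVf.
  by have [h1 h2] := R0 i k (contra_neq (@esym _ _ _) ki); rewrite hornerM h2 mul0r !mulr0.
have e0 : eps = false by apply/negbTE/negP => /teps /(_ i); rewrite ti eqxx.
have s1 : sg = 1 by rewrite e0 expr0.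
set b := (t i - 1) * (R i).[t i].
have b0 : b != 0 by rewrite mulf_neq0.
apply: (@dg_pm L i (- sg) b _ b0) => //; first by rewrite oppr_eq0 signr_eq0.
  rewrite -wedge_frame.
  pose s := vbasis (lker (h + \1)%VF).
  have hs u : u \in s -> bcf j j h (j u) = - j u.
    move/vbasis_mem; rewrite memv_ker add_lfunE id_lfunE addr_eq0 => /eqP hu.
    by rewrite (bcfE Hj Hj) hu (bcN Hj).
  have mem x : bcf j j h x = - x -> x \in <<map_tuple j s>>%VS.
    move=> hx; apply: (bc_ker Hj Hj (f := (h + \1)%VF)).
    by rewrite (bcfD _ _ Hj Hj) (bcf1 Hj) add_lfunE id_lfunE hx addNr.
  have ein : bcf j j h (e i) = - e i by rewrite hE (tor_e HB He) ti scaleN1r.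
  have fin : bcf j j h (f i) = - f i by rewrite hE (tor_f HB He) ti invrN invr1 scaleN1r.
  have wsumr u (k : nat) (c : 'I_k -> K) (w : 'I_k -> UK) :
     wedge eps B u (\sum_l c l *: w l) = \sum_l c l *: wedge eps B u (w l).
    apply/lfunP => x; rewrite sum_lfunE (wedgeE HB) (fsumr HB) scaler_sumr mulr_sumr scaler_suml -sumrB.
    apply: eq_bigr => l _; rewrite scale_lfunE (wedgeE HB) (fZr HB) scalerBr !scalerA.
    by congr (_ *: _ - _ *: _); ring.
  have wC u v : wedge eps B u v = - wedge eps B v u.
    by apply/lfunP => x; rewrite opp_lfunE !(wedgeE HB) s1 !mul1r opprB.
  rewrite (coord_span (mem _ fin)) wsumr; apply: rpred_sum => l _; rewrite rpredZ //.
  rewrite wC (coord_span (mem _ ein)) wsumr rpredN; apply: rpred_sum => l' _; rewrite rpredZ //.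
  rewrite !(nth_map 0) ?size_tuple ?ltn_ord //; apply: rL.
  set u := s`_l; set v := s`_l'.
  have us : u \in s by rewrite mem_nth // size_tuple.
  have vs : v \in s by rewrite mem_nth // size_tuple.
  have uE := minus_one_plane ti (hs u us); have vE := minus_one_plane ti (hs v vs).
  pose D := B (j u) (f i) * B (e i) (j v) - B (e i) (j u) * B (j v) (f i).
  exists (wedge eps B0 u v), (fun k => D * (- sg * dl i k)), (fun k => D * (- - sg * dl i k)).
  split; first by rewrite bcf_wedge.
  have <- : D *: wedge eps B (e i) (f i) = dg (fun k => D * (- sg * dl i k)) (fun k => D * (- - sg * dl i k)).
    by rewrite wedge_frame dgZ.
  rewrite {1}uE {1}vE /D; move: (B (j u) _) (B _ (j u)) (B (j v) _) (B _ (j v)) => a1 a2 b1 b2.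
  apply/lfunP => x; rewrite scale_lfunE !(wedgeE HB) s1 !(fDr HB) !(fZr HB) !mul1r.
  move: (B x (e i)) (B x (f i)) => y1 y2.
  rewrite !scalerDr scalerN !scalerA opprD addrACA -!scaleNr -!scalerDl addrC.
  by congr (_ *: _ + _ *: _); ring.
suff -> : dg (fun k => b * dl i k) (fun k => b * dl i k) =
   dg (fun k => (t k - 1) * (R i).[t k]) (fun k => ((t k)^-1 - 1) * (R i).[(t k)^-1]) by apply: pL.
congr (dg _ _); apply/funext => k.
  have [<-|ki] := eqVneq i k; first by rewrite mulr1.
  by have [h1 h2] := R0 i k (contra_neq (@esym _ _ _) ki); rewrite h1 !mulr0.
have [<-|ki] := eqVneq i k; first by rewrite mulr1 /b ti invrN invr1.
by have [h1 h2] := R0 i k (contra_neq (@esym _ _ _) ki); rewrite h2 !mulr0.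
Qed.
End Isometry.
End Frame.
End Spans.

(** * Existence of tori over the base field *)

Section Planes.
Variables (F : fieldType) (U : vectType F) (eps : bool) (B : U -> U -> F).
Hypothesis HB : isform eps B.
Hypothesis two : 2%:R != 0 :> F.
Implicit Types Y : {vspace U}.

Definition nondeg Y := forall x, x \in Y -> (forall y, y \in Y -> B x y = 0) -> x = 0.
Definition orth_of (u : U) : {vspace U} := lker (linfun (fun x => B x u : F^o)).
(** Bases of nondegenerate planes: hyperbolic in the antisymmetric case, orthogonal and
    anisotropic in the symmetric case. *)
Definition standard_pair u v := if eps then B u v = 1 else [/\ B u v = 0, B u u != 0 & B v v != 0].

Lemma mem_orth_of u x : (x \in orth_of u) = (B x u == 0).
Proof. by rewrite memv_ker linfun_linE // => a y z; apply: (form_linl HB). Qed.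

Lemma dim_orth_of Y u : (\dim Y <= (\dim (Y :&: orth_of u)).+1)%N.
Proof.
rewrite -(limg_ker_dim (linfun (fun x => B x u : F^o)) Y) -addn1 leq_add2l.
by rewrite (leq_trans (dimvS (subvf _))) // dimvf.
Qed.

(** Gram-Schmidt: the hypothesis gives the projection of y on the orthogonal complement
    of u and v. *)
Lemma nondeg_split Y u v : u \in Y -> v \in Y -> nondeg Y ->
  (forall y, y \in Y -> exists a b, B (y - a *: u - b *: v) u = 0 /\ B (y - a *: u - b *: v) v = 0) ->
  nondeg (Y :&: orth_of u :&: orth_of v)%VS.
Proof.
move=> uY vY nY dec x; rewrite !memv_cap !mem_orth_of => /andP [/andP [xY /eqP xu] /eqP xv] h.
apply: nY => // y yY; have [a [b [h1 h2]]] := dec y yY.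
have := h (y - a *: u - b *: v); rewrite !memv_cap !mem_orth_of h1 h2 !eqxx !andbT.
rewrite !rpredB ?rpredZ // => /(_ isT).
by rewrite !(fBr HB) !(fZr HB) xu xv !mulr0 !subr0.
Qed.

(** Polarization: a symmetric form with B x x = 0 for all x is 0 in characteristic not
    two. *)
Lemma anisotropic Y : ~~ eps -> nondeg Y -> (0 < \dim Y)%N -> exists2 u, u \in Y & B u u != 0.
Proof.
move=> ne nY dY; apply: contrapT => h.
have iso u : u \in Y -> B u u = 0.
  by move=> uY; apply/eqP/negPn/negP => uu; apply: h; exists u.
have /eqP : vpick Y = 0.
  apply: nY (memv_pick Y) _ => y yY; apply: (mulfI two); rewrite mulr0.
  have := iso _ (rpredD (memv_pick Y) yY); rewrite (fDl HB) !(fDr HB) !iso ?memv_pick // add0r addr0.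
  by rewrite [B y _](fC HB) (negbTE ne) expr0 mul1r mulr_natl mulr2n.
by rewrite vpick0 -dimv_eq0 -leqn0 leqNgt dY.
Qed.

(** In the symmetric case two anisotropic vectors are split off one after the other, the
    first one by nondeg_split with u = v. *)
Lemma split_plane Y : nondeg Y -> (2 <= \dim Y)%N ->
  exists u v, [/\ u \in Y, v \in Y, standard_pair u v & nondeg (Y :&: orth_of u :&: orth_of v)%VS].
Proof.
move=> nY dY; have [he|ne] := boolP eps.
  have [y yY uy] : exists2 y, y \in Y & B (vpick Y) y != 0.
    apply: contrapT => h; have /eqP : vpick Y = 0.
      apply: nY (memv_pick Y) _ => y yY; apply/eqP/negPn/negP => uy; apply: h; by exists y.
    by rewrite vpick0 -dimv_eq0 => /eqP d0; rewrite d0 in dY.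
  have [v vY uv] : exists2 v, v \in Y & B (vpick Y) v = 1.
    by exists ((B (vpick Y) y)^-1 *: y); rewrite ?rpredZ // (fZr HB) mulVf.
  have uY := memv_pick Y; set u := vpick Y in uv uY *.
  have vu : B v u = -1 by rewrite (fC HB) uv he expr1 mulr1.
  exists u, v.
  split=> //; first by rewrite /standard_pair he.
  apply: nondeg_split => // z zY; exists (B z v), (- B z u).
  by rewrite !(fBl HB) !(fZl HB) !(alt0 HB two) // uv vu; split; ring.
have [|u uY uu] := anisotropic ne nY; first by rewrite (leq_trans _ dY).
have n1 : nondeg (Y :&: orth_of u)%VS.
  rewrite -[(Y :&: orth_of u)%VS]capvv capvA -[X in nondeg (X :&: _)%VS]capvA [(orth_of u :&: Y)%VS]capvC capvA capvv.
  apply: nondeg_split => // z zY; exists (B z u / B u u), 0.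
  by rewrite scale0r subr0 (fBl HB) (fZl HB) divfK // subrr.
have [|v] := anisotropic ne n1; first by rewrite -ltnS (leq_trans dY (dim_orth_of Y u)).
rewrite memv_cap mem_orth_of => /andP [vY /eqP vu] vv.
have uv : B u v = 0 by rewrite (fC HB) vu mulr0.
exists u, v; split=> //; first by rewrite /standard_pair (negbTE ne).
apply: nondeg_split => // z zY; exists (B z u / B u u), (B z v / B v v).
by rewrite !(fBl HB) !(fZl HB) uv vu !divfK // !mulr0 !subr0 !subrr.
Qed.

Lemma orthogonal_planes r Y : nondeg Y -> (r.*2 <= \dim Y)%N ->
  exists u v : nat -> U, [/\ forall i, (i < r)%N -> u i \in Y /\ v i \in Y,
    forall i, (i < r)%N -> standard_pair (u i) (v i) &
    forall i k, (i < r)%N -> (k < r)%N -> i != k ->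
      [/\ B (u i) (u k) = 0, B (u i) (v k) = 0, B (v i) (u k) = 0 & B (v i) (v k) = 0]].
Proof.
elim: r Y => [|r IH] Y nY dY; first by exists (fun=> 0), (fun=> 0).
have [|u0 [v0 [u0Y v0Y nuv n']]] := split_plane nY; first by rewrite (leq_trans _ dY).
have [|u [v [uvY uvn uvo]]] := IH _ n'.
  have := dim_orth_of Y u0; have := dim_orth_of (Y :&: orth_of u0) v0; move: dY; rewrite doubleS.
  by lia.
have perp0 i : (i < r)%N -> [/\ B (u i) u0 = 0, B (u i) v0 = 0, B (v i) u0 = 0 & B (v i) v0 = 0].
  move=> ir; have [] := uvY i ir; rewrite !memv_cap !mem_orth_of.
  by move=> /andP [/andP [_ /eqP ->] /eqP ->] /andP [/andP [_ /eqP ->] /eqP ->].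
exists (fun i => if i is i'.+1 then u i' else u0), (fun i => if i is i'.+1 then v i' else v0).
split=> [[|i] ir //|[|i] ir|[|i] [|k] // ir kr ik].
- have [] := uvY i ir; rewrite !memv_cap.
  by move=> /andP [/andP [-> _] _] /andP [/andP [-> _] _].
- exact: nuv.
- exact: uvn.
- by have [h1 h2 h3 h4] := perp0 k kr; split; rewrite (fC HB) ?h1 ?h2 ?h3 ?h4 mulr0.
- exact: perp0.
exact: uvo.
Qed.
End Planes.

Section RationalFrames.
Variables (F : fieldType) (K : closedFieldType) (iota : {rmorphism F -> K}).
Variables (U : vectType F) (UK : vectType K) (j : U -> UK).
Hypothesis Hj : bchange iota j.
Variables (eps : bool) (B0 : U -> U -> F) (B : UK -> UK -> K).
Hypothesis HB0 : isform eps B0.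
Hypothesis HB : isform eps B.
Hypothesis jB : forall u v, B (j u) (j v) = iota (B0 u v).
Hypothesis twoF : 2%:R != 0 :> F.
Hypothesis two : 2%:R != 0 :> K.

(** Over K a nondegenerate plane is hyperbolic. The operator wedge u v is a multiple of
    the wedge of an isotropic basis because an alternating function of two vectors of a
    plane is unique up to a scalar. *)
Lemma standard_pair_frame u v : standard_pair eps B0 u v -> exists e f kap,
  [/\ B e e = 0, B f f = 0, B e f = 1, kap != 0 &
      wedge eps B (j u) (j v) = kap *: wedge eps B e f] /\
  exists a b c d, e = a *: j u + b *: j v /\ f = c *: j u + d *: j v.
Proof.
rewrite /standard_pair; have [he uv|ne [uv uu vv]] := boolP eps.
  exists (j u), (j v), 1; split; first split.
  - exact: (alt0 HB two).
  - exact: (alt0 HB two).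
  - by rewrite jB uv rmorph1.
  - exact: oner_neq0.
  - by rewrite scale1r.
  by exists 1, 0, 0, 1; rewrite !scale0r !scale1r addr0 add0r.
have s1 : (-1) ^+ eps = 1 :> K by rewrite (negbTE ne) expr0.
pose al := B (j u) (j u); pose be := B (j v) (j v).
have al0 : al != 0 by rewrite /al jB fmorph_eq0.
have be0 : be != 0 by rewrite /be jB fmorph_eq0.
have juv : B (j u) (j v) = 0 by rewrite jB uv rmorph0.
have jvu : B (j v) (j u) = 0 by rewrite (fC HB) juv mulr0.
have [l l2] := closed_sqrt (- al * be).
have l0 : l != 0.
  apply/eqP => l0; move/eqP: l2; rewrite l0 mul0r eq_sym mulf_eq0 oppr_eq0.
  by rewrite (negbTE al0) (negbTE be0).
(* This is B (l u + al v) (- l u + al v); both vectors are isotropic since l^2 = - al be. *)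
pose n := 2%:R * al * al * be.
have n0 : n != 0 by rewrite !mulf_neq0.
exists (l *: j u + al *: j v), (n^-1 *: (- l *: j u + al *: j v)), (n / (2%:R * l * al)); split; last first.
  exists l, al, (n^-1 * - l), (n^-1 * al); split=> //.
  by rewrite scalerDr !scalerA.
have E (a b c d : K) : B (a *: j u + b *: j v) (c *: j u + d *: j v) = a * c * al + b * d * be.
  rewrite (fDl HB) !(fDr HB) !(fZl HB) !(fZr HB) juv jvu -/al -/be; ring.
split.
- rewrite E l2; ring.
- rewrite (fZl HB) (fZr HB) E mulrNN l2 (_ : _ + _ = 0) ?mulr0 //; ring.
- rewrite (fZr HB) E mulrN l2 (_ : _ + _ = n) ?mulVf // /n; ring.
- by rewrite mulf_neq0 // invr_eq0 !mulf_neq0.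
rewrite -[false](negbTE ne); apply/lfunP => x; rewrite scale_lfunE !(wedgeE HB) s1 !mul1r !(fZr HB) !(fDr HB) !(fZr HB).
move: (B x (j u)) (B x (j v)) => y1 y2.
rewrite scalerDr scalerN !scalerDr !scalerA opprD addrACA -!scaleNr -!scalerDl addrC.
by congr (_ *: _ + _ *: _); field; rewrite n0 al0 l0 two.
Qed.

(** The eigenlines of the operators wedge u v on r orthogonal planes. *)
Theorem exists_rational_frame r : (r.*2 <= \dim {:U})%N ->
  exists e f : 'I_r -> UK, frame B e f /\
    forall L : {vspace 'End(UK)}, (forall D, rational j B e f D -> D \in L) ->
      forall p q, dgf B e f p q \in L.
Proof.
move=> rU; have nU : nondeg B0 fullv by move=> x _ h; apply: (form_nondeg HB0) => y; apply: h; apply: memvf.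
have [u [v [_ uvn uvo]]] := orthogonal_planes HB0 twoF nU rU.
have /choice [ef efP] : forall i : 'I_r, exists x : UK * UK * K,
  [/\ B x.1.1 x.1.1 = 0, B x.1.2 x.1.2 = 0, B x.1.1 x.1.2 = 1, x.2 != 0 &
      wedge eps B (j (u i)) (j (v i)) = x.2 *: wedge eps B x.1.1 x.1.2] /\
  exists a b c d, x.1.1 = a *: j (u i) + b *: j (v i) /\ x.1.2 = c *: j (u i) + d *: j (v i).
  move=> i; have [e [f [kap h]]] := standard_pair_frame (uvn i (ltn_ord i)).
  by exists (e, f, kap).
pose e i := (ef i).1.1; pose f i := (ef i).1.2.
have ort0 i k : i != k -> [/\ B (e i) (e k) = 0, B (f i) (f k) = 0 & B (e i) (f k) = 0].
  move=> ik; have [_ [a [b [c [d [h1 h2]]]]]] := efP i; have [_ [a' [b' [c' [d' [h1' h2']]]]]] := efP k.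
  have [uu uv vu vv] := uvo i k (ltn_ord i) (ltn_ord k) ik.
  rewrite /e /f h1 h2 h1' h2' !(fDl HB) !(fDr HB) !(fZl HB) !(fZr HB) !jB uu uv vu vv.
  by rewrite rmorph0 !mulr0 !addr0.
have He : frame B e f.
  split=> i k; have [<-|ik] := eqVneq i k; have [[h1 h2 h3 h4 h5] _] := efP i => //;
    by have [] := ort0 i k ik.
exists e, f; split=> //.
apply: (planes_span Hj HB0 HB jB two He (u := fun i => u i) (v := fun i => v i) (kap := fun i => (ef i).2)).
  by move=> i; have [[]] := efP i.
by move=> i; have [[]] := efP i.
Qed.
End RationalFrames.

(** * The three parts of the theorem *)

(** The subspace W + W' is nondegenerate, so it has an orthogonal projection, which
    gives V = (W + W') + X. *)
Lemma polar_orthov (F : fieldType) (eps : bool) (V : vectType F) (Phi : {hermitian V for eps & idfun})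
    (W W' X : {vspace V}) :
  nondegenerate Phi -> (W <= orthov Phi W)%VS -> (W' <= orthov Phi W')%VS ->
  ((W + W') :&: orthov Phi (W + W') = 0)%VS -> X = orthov Phi (W + W')%VS ->
  polar eps Phi W X W'.
Proof.
move=> nd /orthovP WW /orthovP W'W' cap XE.
have HPhi : isform eps Phi.
  split=> [a x y z|x y|x h].
  - by rewrite linearPl.
  - exact: hermC.
  by apply/eqP; rewrite -memv0 -(eqP nd); apply/mem_orthovP.
have perpX u v : u \in (W + W')%VS -> v \in X -> Phi u v = 0.
  by rewrite XE => uZ /mem_orthovP /(_ u uZ) h; rewrite (fC HPhi) h mulr0.
split=> //.
- by move=> u v uW; apply: perpX; rewrite (subvP (addvSl _ _)).
- by move=> u v uW; apply: perpX; rewrite (subvP (addvSr _ _)).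
pose Z := (W + W')%VS.
have [g gE] : exists g : 'Hom(V, subvs_of Z), forall c (y : subvs_of Z), Phi (vsval (g c)) (vsval y) = Phi c (vsval y).
  apply: (@pairing_adj F V (subvs_of Z) (subvs_of Z) (fun x y => Phi (vsval x) (vsval y)) (fun c y => Phi c (vsval y))) => //.
  - by move=> y a u v; rewrite [vsval (_ + _)]linearP (form_linl HPhi).
  - by move=> u a x y; rewrite [vsval (_ + _)]linearP (fDr HPhi) (fZr HPhi).
  - by move=> y a u v; rewrite (form_linl HPhi).
  - by move=> u a x y; rewrite [vsval (_ + _)]linearP (fDr HPhi) (fZr HPhi).
  move=> x h; apply: val_inj; apply/eqP; rewrite -memv0 -cap memv_cap subvsP.
  by apply/mem_orthovP => y yZ; have := h (vsproj Z y); rewrite vsprojK.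
apply/eqP; rewrite eqEsubv subvf; apply/subvP => v _.
rewrite -addvA [(X + W')%VS]addvC addvA -[v](subrK (vsval (g v))) addrC memv_add ?subvsP // XE.
apply/mem_orthovP => y yZ; have := gE v (vsproj Z y); rewrite vsprojK // => e.
by rewrite (fBl HPhi) e subrr.
Qed.

Section BilinearExtension.
Variables (F K : fieldType) (iota : {rmorphism F -> K}).

Lemma bc_functional (U : vectType F) (UK : vectType K) (j : U -> UK) (a b : UK -> K) :
  bchange iota j -> linear_for *%R a -> linear_for *%R b -> (forall u, a (j u) = b (j u)) ->
  forall z, a z = b z.
Proof.
move=> Hj al bl ab z.
have aE := linfun_linE (f := a : UK -> K^o) al; have bE := linfun_linE (f := b : UK -> K^o) bl.
suff e : linfun (a : UK -> K^o) = linfun (b : UK -> K^o) by rewrite -[LHS]aE -[RHS]bE e.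
by apply: (bc_eq Hj) => u; rewrite aE bE ab.
Qed.

Lemma bc_bilinear (U1 U2 : vectType F) (UK1 UK2 : vectType K) (j1 : U1 -> UK1) (j2 : U2 -> UK2)
    (p q : UK1 -> UK2 -> K) :
  bchange iota j1 -> bchange iota j2 ->
  (forall y, linear_for *%R (p^~ y)) -> (forall x, linear_for *%R (p x)) ->
  (forall y, linear_for *%R (q^~ y)) -> (forall x, linear_for *%R (q x)) ->
  (forall u v, p (j1 u) (j2 v) = q (j1 u) (j2 v)) -> forall x y, p x y = q x y.
Proof.
move=> H1 H2 pl pr ql qr pq x y.
apply: (bc_functional (a := p^~ y) (b := q^~ y) H1) => // u.
exact: (bc_functional (a := p (j1 u)) (b := q (j1 u)) H2).
Qed.

Lemma bcf_inj (U1 U2 : vectType F) (UK1 UK2 : vectType K) (j1 : U1 -> UK1) (j2 : U2 -> UK2) :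
  bchange iota j1 -> bchange iota j2 -> injective (bcf j1 j2).
Proof.
move=> H1 H2 f g fg; apply/lfunP => u; apply: (bc_inj H2).
by rewrite -!(bcfE H1 H2) fg.
Qed.

Lemma bcf_bij (U1 U2 : vectType F) (UK1 UK2 : vectType K) (j1 : U1 -> UK1) (j2 : U2 -> UK2)
    (f : 'Hom(U1, U2)) :
  bchange iota j1 -> bchange iota j2 -> bijective f ->
  bijective (bcf j1 j2 f) /\ (bcf j1 j2 f)^-1%VF = bcf j2 j1 (f^-1)%VF.
Proof.
move=> H1 H2 bf.
have c1 : cancel (bcf j1 j2 f) (bcf j2 j1 (f^-1)%VF).
  move=> x; rewrite -comp_lfunE -(bcf_comp _ _ H1 H2 H1).
  rewrite (_ : (_ \o _)%VF = \1%VF) ?(bcf1 H1) ?id_lfunE //.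
  by apply/lfunP => y; rewrite comp_lfunE id_lfunE bij_invl.
have c2 : cancel (bcf j2 j1 (f^-1)%VF) (bcf j1 j2 f).
  move=> x; rewrite -comp_lfunE -(bcf_comp _ _ H2 H1 H2).
  rewrite (_ : (_ \o _)%VF = \1%VF) ?(bcf1 H2) ?id_lfunE //.
  by apply/lfunP => y; rewrite comp_lfunE id_lfunE bij_invr.
have b : bijective (bcf j1 j2 f) by exists (bcf j2 j1 (f^-1)%VF).
split=> //; apply/lfunP => x; apply: (bij_inj b).
by rewrite (bij_invr b) c2.
Qed.
End BilinearExtension.

Section NExtension.
Variables (F K : fieldType) (iota : {rmorphism F -> K}).
Variables (V : vectType F) (eps : bool) (Phi : V -> V -> F) (W X W' : {vspace V}).
Hypothesis HP : polar eps Phi W X W'.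
Local Notation PhiK := (ext_form iota Phi).
Local Notation WK := (ext_space iota W).
Local Notation XK := (ext_space iota X).
Local Notation W'K := (ext_space iota W').
Local Notation jW := (ext_sub iota W).
Local Notation jX := (ext_sub iota X).
Local Notation jW' := (ext_sub iota W').
Local Notation ext := (ext iota).
Let HPK := polar_ext iota HP.
Let HV := pl_form HP.
Let HVK := pl_form HPK.
Let jWb := ext_sub_bchange iota W.
Let jXb := ext_sub_bchange iota X.
Let jW'b := ext_sub_bchange iota W'.

Lemma ext_pair (A C : {vspace V}) (u : subvs_of A) (v : subvs_of C) :
  PhiK (vsval (ext_sub iota A u)) (vsval (ext_sub iota C v)) = iota (Phi (vsval u) (vsval v)).
Proof. by rewrite !ext_subE (ext_formE iota HV). Qed.

Section Pair.
Variables (xi : 'Hom(subvs_of X, subvs_of W)) (eta : 'Hom(subvs_of W', subvs_of W)).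
Local Notation xiK := (bcf jX jW xi).
Local Notation etaK := (bcf jW' jW eta).

Lemma adj_xi_bcf : adj_xi PhiK W'K xiK = bcf jW' jX (adj_xi Phi W' xi).
Proof.
apply/esym/(adj_xi_uniq HPK).
apply: (bc_bilinear jW'b jXb) => [y a u v|x a u v|y a u v|x a u v|u v].
- by rewrite !linearP /= (fDl HVK) (fZl HVK).
- by rewrite !linearP /= (fDr HVK) (fZr HVK).
- by rewrite !linearP /= (fDl HVK) (fZl HVK).
- by rewrite !linearP /= (fDr HVK) (fZr HVK).
by rewrite (bcfE jW'b jXb) (bcfE jXb jWb) !ext_pair (adj_xiE HP).
Qed.

Lemma adj_eta_bcf : adj_eta PhiK etaK = bcf jW' jW (adj_eta Phi eta).
Proof.
apply/esym/(adj_eta_uniq HPK).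
apply: (bc_bilinear jW'b jW'b) => [y a u v|x a u v|y a u v|x a u v|u v].
- by rewrite !linearP /= (fDl HVK) (fZl HVK).
- by rewrite !linearP /= (fDr HVK) (fZr HVK).
- by rewrite !linearP /= (fDl HVK) (fZl HVK).
- by rewrite !linearP /= (fDr HVK) (fZr HVK).
by rewrite !(bcfE jW'b jWb) !ext_pair (adj_etaE HP).
Qed.

Lemma Nrel_bcf : Nrel PhiK xiK etaK <-> Nrel Phi xi eta.
Proof.
rewrite /Nrel adj_xi_bcf adj_eta_bcf -(bcf_comp _ _ jW'b jXb jWb) -!(bcfD _ _ jW'b jWb).
have z : bcf jW' jW 0 = 0.
  by apply: (addrI (bcf jW' jW 0)); rewrite -(bcfD _ _ jW'b jWb) !addr0.
split=> [h|->]; last exact: z.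
by apply: (bcf_inj jW'b jWb); rewrite z.
Qed.

Lemma Norm_bcf : bijective eta -> Norm PhiK xiK etaK = bcf jX jX (Norm Phi xi eta).
Proof.
move=> be; rewrite /Norm (bcfD _ _ jXb jXb) (bcf1 jXb) adj_xi_bcf.
have [_ ->] := bcf_bij jW'b jWb be.
by rewrite (bcf_comp _ _ jXb jWb jXb) (bcf_comp _ _ jWb jW'b jXb).
Qed.

Lemma nmap_bcf : nmap PhiK xiK etaK = bcf ext ext (nmap Phi xi eta).
Proof.
have Hj := ext_bchange iota V.
apply: (bc_eq Hj) => v; rewrite (bcfE Hj Hj); have [w [x [w' ->]]] := polar_decomp HP v.
rewrite !(bchangeD Hj) [in LHS]linearD [X in X + _]linearD /= -!ext_subE.
rewrite (nmap_W HPK) (nmap_X HPK) (nmap_W' HPK) adj_xi_bcf (bcfE jXb jWb) (bcfE jW'b jWb) (bcfE jW'b jXb).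
by rewrite !ext_subE -(bcB Hj) -!(bchangeD Hj) !linearD /= (nmap_W HP) (nmap_X HP) (nmap_W' HP).
Qed.
End Pair.

(** The components xi and eta are recovered from n by pairing n v - v with W', which
    makes sense over F. *)
Lemma nmap_descent (n : 'End(V)) (xiK : 'Hom(subvs_of XK, subvs_of WK)) (etaK : 'Hom(subvs_of W'K, subvs_of WK)) :
  (forall v, nmap PhiK xiK etaK (ext v) = ext (n v)) ->
  exists xi eta, [/\ xiK = bcf jX jW xi, etaK = bcf jW' jW eta & n = nmap Phi xi eta].
Proof.
move=> nE; have Hj := ext_bchange iota V.
have desc (A : {vspace V}) : exists g : 'Hom(subvs_of A, subvs_of W),
    forall c (y : subvs_of W'), Phi (vsval (g c)) (vsval y) = Phi (n (vsval c) - vsval c) (vsval y).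
  apply: (@pairing_adj F _ _ _ (fun x y => Phi (vsval x) (vsval y)) (fun c y => Phi (n (vsval c) - vsval c) (vsval y))).
  - exact: (pairing_linl HP).
  - exact: (pairing_linr HP).
  - by move=> y a u v; rewrite !linearP /= !(fBl HV) !(fDl HV) !(fZl HV) !(fNl HV); ring.
  - by move=> c a x y; rewrite !linearP /= (fDr HV) (fZr HV).
  - exact: (W_nd HP).
  by rewrite !dim_subvs (dimWW' HP).
have [xi xiP] := desc X; have [eta etaP] := desc W'.
have pairK (A : {vspace V}) (g : 'Hom(subvs_of A, subvs_of W)) (gK : 'Hom(subvs_of (ext_space iota A), subvs_of WK)) :
  (forall c (y : subvs_of W'), Phi (vsval (g c)) (vsval y) = Phi (n (vsval c) - vsval c) (vsval y)) ->
  (forall c y, PhiK (nmap PhiK xiK etaK (vsval c) - vsval c) (vsval (jW' y)) = PhiK (vsval (gK c)) (vsval (jW' y))) ->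
  gK = bcf (ext_sub iota A) jW g.
  move=> gP gKP; have jA := ext_sub_bchange iota A; apply: (bc_eq jA) => c.
  rewrite (bcfE jA jWb); apply: (W_inj HPK) => z.
  apply: (bc_functional (a := fun z => PhiK (vsval (gK (ext_sub iota A c))) (vsval z))
    (b := fun z => PhiK (vsval (jW (g c))) (vsval z)) jW'b); [exact: (pairing_linr HPK)|exact: (pairing_linr HPK)|move=> y].
  by rewrite -gKP ext_pair gP !ext_subE nE -(bcB Hj) (ext_formE iota HV).
have xE : xiK = bcf jX jW xi.
  apply: pairK => // c y; rewrite (nmap_X HPK) addrC addKr //.
have eE : etaK = bcf jW' jW eta.
  apply: pairK => // c y; rewrite (nmap_W' HPK) addrC addKr (fBl HVK) (XW'0 HPK) subr0 //.
exists xi, eta; split=> //.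
apply: (bcf_inj Hj Hj); rewrite -nmap_bcf -xE -eE; apply: (bc_eq Hj) => v.
by rewrite nE (bcfE Hj Hj).
Qed.
End NExtension.

Section Parts.
Variables (F : fieldType) (K : closedFieldType) (iota : {rmorphism F -> K}).
Variables (V : vectType F) (eps : bool) (Phi : V -> V -> F) (W X W' : {vspace V}).
Hypothesis HP : polar eps Phi W X W'.
Hypothesis twoF : 2%:R != 0 :> F.
Hypothesis two : 2%:R != 0 :> K.
Hypothesis ev : ~~ odd (\dim W).
Local Notation PhiK := (ext_form iota Phi).
Local Notation WK := (ext_space iota W).
Local Notation XK := (ext_space iota X).
Local Notation W'K := (ext_space iota W').
Local Notation jX := (ext_sub iota X).
Local Notation B0 := (subform Phi X).
Local Notation B := (subform PhiK XK).
Local Notation r := (\dim W)./2.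
Local Notation kmax := (kmax_torus iota Phi W X).
Let HPK := polar_ext iota HP.
Let HB0 := subform_isform HP.
Let HB := subform_isform HPK.
Let jXb := ext_sub_bchange iota X.

Lemma jXB u v : B (jX u) (jX v) = iota (B0 u v).
Proof. exact: (ext_pair iota HP). Qed.

Lemma r2 : r.*2 = \dim W.
Proof. by rewrite -[RHS](odd_double_half (\dim W)) (negbTE ev). Qed.

Lemma rational_frame_kmax (e f : 'I_r -> subvs_of XK) : frame B e f ->
  (forall L : {vspace 'End(subvs_of XK)}, (forall D, rational jX B e f D -> D \in L) ->
     forall p q, dgf B e f p q \in L) ->
  kmax (tor B e f @` @Gm K r).
Proof.
move=> He sp; apply: (frame_kmax HP ev He).
exact: (rational_frame_def jXb HB0 HB jXB He sp).
Qed.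

Lemma exists_kmax : (\dim W <= \dim X)%N -> exists S, kmax S.
Proof.
move=> le; have [|e [f [He sp]]] := @exists_rational_frame _ _ _ _ _ _ jXb _ _ _ HB0 HB jXB twoF two r.
  by rewrite r2 dim_subvs.
by exists (tor B e f @` @Gm K r); apply: rational_frame_kmax.
Qed.

Lemma HSK_kmax S S0 : kmax S -> kmax S0 -> HSK Phi S `<=` HSK Phi S0.
Proof.
move=> /(kmax_frame HP two ev) [e [f [He ->]]] /(kmax_frame HP two ev) [e0 [f0 [He0 ->]]] h.
by move/(HSK_frameP HP two He) => hE; apply/(HSK_frameP HP two He0).
Qed.

Lemma Fpoints_bcf (U : vectType F) (UK : vectType K) (j : U -> UK) (A : set 'End(UK)) g :
  bchange iota j -> Fpoints j A g <-> A (bcf j j g).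
Proof.
move=> Hj; split=> [[gK Ag e]|Ag]; last first.
  by exists (bcf j j g) => // u; rewrite (bcfE Hj Hj).
suff -> : bcf j j g = gK by [].
by apply: (bc_eq Hj) => u; rewrite (bcfE Hj Hj) e.
Qed.

Lemma isom_bcf h : isom Phi X h -> HK Phi (bcf jX jX h).
Proof.
move=> ih x y.
apply: (bc_bilinear (p := fun x y => B (bcf jX jX h x) (bcf jX jX h y)) (q := B) jXb jXb) => [v a u w|u a v w|v a u w|u a v w|u v].
- by rewrite !linearP /= (fDl HB) (fZl HB).
- by rewrite !linearP /= (fDr HB) (fZr HB).
- by rewrite (fDl HB) (fZl HB).
- by rewrite (fDr HB) (fZr HB).
by rewrite !(bcfE jXb jXb) !jXB; congr (iota _); apply: ih.
Qed.

(** Over K, gamma is tor e f t with t regular; the three properties are read off the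
    frame and descend to F. *)
Lemma compatible_Sr S (xi : 'Hom(subvs_of X, subvs_of W)) gamma : kmax S -> [set x | xi x = 0] = E iota X S ->
  Sr iota Phi X S gamma -> compatible (W := W) Phi xi gamma.
Proof.
move=> /(kmax_frame HP two ev) [e [f [He SE]]] xiE /(Fpoints_bcf _ _ jXb) Sg.
rewrite SE in Sg; have [t [tm [t1 tij teps]] gE] := SrK_regular (fun _ _ => erefl) HB two He Sg.
have fixP x : gamma x = x <-> perp B e f (jX x).
  split=> [gx|px].
    by apply: (perp_fixed HB He t1); rewrite -gE (bcfE jXb jXb) gx.
  by apply: (bc_inj jXb); rewrite -(bcfE jXb jXb) gE (tor_perp HB _ px).
split.
- move=> x y; apply: (fmorph_inj iota); rewrite -!(ext_pair iota HP).
  rewrite -!(bcfE jXb jXb) gE; exact: (tor_isom HB He tm).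
- move=> x; rewrite fixP -(EK_frame HB He) -SE.
  by rewrite -[xi x = 0]/([set x | xi x = 0] x) xiE.
- rewrite -(bcf_dim jXb jXb) -r2 -[r in RHS](card_ord r) -(dim_span_frseq HB He) -(tor_limg HB He t1).
  rewrite -gE; congr (\dim (limg _)); apply: (bc_eq jXb) => u.
  by rewrite (bcfE jXb jXb) !add_lfunE !opp_lfunE !id_lfunE (bcfE jXb jXb) (bcB jXb).
move=> x /fixP py; apply/fixP => i.
have yE : jX (gamma x - x) = dgf B e f (fun i => t i - 1) (fun i => (t i)^-1 - 1) (jX x).
  by rewrite -(tor_sub1 B e f) -gE add_lfunE opp_lfunE id_lfunE (bcB jXb) (bcfE jXb jXb).
have := py i; rewrite yE (fe_dg HB He) (f_dg_f HB He) => -[/eqP h1 /eqP h2].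
move: h1 h2; rewrite !mulf_eq0 !subr_eq0 invr_eq1 (negbTE (t1 i)) /= => /eqP h1 /eqP h2.
by split.
Qed.

Lemma NS_Ad S (xi : 'Hom(subvs_of X, subvs_of W)) : kmax S -> [set x | xi x = 0] = E iota X S ->
  NS iota Phi W X W' S =
  [set conj_lfun m (nS Phi W' xi gamma) | m in Mset Phi W X W' & gamma in Sr iota Phi X S].
Proof. by move=> kS xiE; apply: (NS_eq HP) => gamma; apply: compatible_Sr. Qed.

Lemma conj_bcf h gamma : isom Phi X h ->
  bcf jX jX (conj_lfun h gamma) = conj_lfun (bcf jX jX h) (bcf jX jX gamma).
Proof.
move=> ih; have bh := isom_bij HP ih.
rewrite /conj_lfun (bcf_comp _ _ jXb jXb jXb) (bcf_comp _ _ jXb jXb jXb).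
by have [_ ->] := bcf_bij jXb jXb bh.
Qed.

Lemma NS_Nr S0 S : kmax S0 -> kmax S -> NS iota Phi W X W' S `<=` Nr iota Phi W X W' S0.
Proof.
move=> k0 kS n [xi [eta [nr be nE [h ih [gamma /(Fpoints_bcf _ _ jXb) Sg hE]]]]].
apply/(Fpoints_bcf _ _ (ext_bchange iota V)).
exists (bcf jX (ext_sub iota W) xi), (bcf (ext_sub iota W') (ext_sub iota W) eta); split.
- exact/(Nrel_bcf iota HP).
- by have [] := bcf_bij (ext_sub_bchange iota W') (ext_sub_bchange iota W) be.
- by rewrite (nmap_bcf iota HP) nE.
apply: (HSK_kmax kS k0); rewrite (Norm_bcf iota HP) // -hE conj_bcf //.
by exists (bcf jX jX h); [exact: isom_bcf|exists (bcf jX jX gamma)].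
Qed.

(** The torus through Norm(n) is the torus of a frame that diagonalizes it over K. *)
Lemma Nr_NS S0 : kmax S0 -> Nr iota Phi W X W' S0 `<=` \bigcup_(S in kmax) NS iota Phi W X W' S.
Proof.
move=> k0 n [g [xiK [etaK [nrK beK gE hK]]] gn].
rewrite gE in gn; have [xi [eta [xE eE nE]]] := nmap_descent HP gn.
rewrite {}xE {}eE in nrK beK gE hK gn.
have jWb := ext_sub_bchange iota W; have jW'b := ext_sub_bchange iota W'.
have nr : Nrel Phi xi eta by apply/(Nrel_bcf iota HP).
have be : bijective eta.
  apply: inj_bij; first by rewrite !dim_subvs (dimWW' HP).
  move=> u v uv; apply: (bc_inj jW'b); apply: (bij_inj beK).
  by rewrite !(bcfE jW'b jWb) uv.
rewrite (Norm_bcf iota HP) // in hK.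
have [e0 [f0 [He0 S0E]]] := kmax_frame HP two ev k0; rewrite S0E in hK.
have [e [f [t [He tm tr hE]]]] := (HSK_frameP HP two He0 _).1 hK.
have sp := isometry_span jXb HB0 HB jXB two He tm tr hE.
exists (tor B e f @` @Gm K r); first exact: rational_frame_kmax.
exists xi, eta; split=> //; exists \1%VF; first by move=> x y; rewrite !id_lfunE.
exists (Norm Phi xi eta).
  apply/(Fpoints_bcf _ _ jXb); rewrite hE.
  exact: (regular_SrK (fun _ _ => erefl) HB two He tm tr).
have b1 : bijective (\1%VF : 'End(subvs_of X)) by exists id => x; rewrite id_lfunE.
apply/lfunP => x; rewrite /conj_lfun !comp_lfunE id_lfunE; congr (Norm _ _ _ _).
by apply: (bij_inj b1); rewrite (bij_invr b1) id_lfunE.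
Qed.

Lemma Nr_union S0 : kmax S0 -> Nr iota Phi W X W' S0 = \bigcup_(S in kmax) NS iota Phi W X W' S.
Proof.
move=> k0; apply/seteqP; split; first exact: Nr_NS.
by move=> n [S kS]; apply: NS_Nr.
Qed.

(** Over K any surjection onto W_K whose kernel is the complement of the frame will do
    for xi; it is built from the 2 r coordinates on the frame. *)
Lemma NrK_nonempty S0 : kmax S0 -> NrK iota Phi W X W' S0 !=set0.
Proof.
move=> /(kmax_frame HP two ev) [e [f [He S0E]]].
have [t tm tr] := @exists_regular K eps r.
have dW : \dim {: subvs_of WK} = #|{: 'I_r * bool}|.
  by rewrite dim_subvs dim_ext card_prod card_ord card_bool muln2 r2.
pose w (u : 'I_r * bool) := (vbasis {: subvs_of WK})`_(enum_rank u).
pose co (u : 'I_r * bool) x := if u.2 then B x (f u.1) else B (e u.1) x.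
pose xi : 'Hom(subvs_of XK, subvs_of WK) := linfun (fun x => \sum_u co u x *: w u).
have xiE x : xi x = \sum_u co u x *: w u.
  apply: linfun_linE => a y z; rewrite scaler_sumr -big_split; apply: eq_bigr => -[i b] _ /=.
  by rewrite scalerA -scalerDl; case: b; rewrite /co /= ?(fDl HB) ?(fDr HB) ?(fZl HB) ?(fZr HB).
have ker x : xi x = 0 <-> perp B e f x.
  split=> [|px]; last first.
    by rewrite xiE big1 // => -[i b] _; have [h1 h2] := px i; case: b; rewrite /co /= ?h1 ?h2 scale0r.
  rewrite xiE => x0.
  have c0 u : co u x = 0.
    have rk (k : 'I_(\dim {: subvs_of WK})) : (k < #|{: 'I_r * bool}|)%N by rewrite -dW.
    move/freeP: (basis_free (vbasisP {: subvs_of WK})) => fr.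
    have := fr (fun k => co (enum_val (Ordinal (rk k))) x).
    have ru : (enum_rank u < \dim {: subvs_of WK})%N by rewrite dW.
    move=> /(_ _ (Ordinal ru)).
    rewrite (_ : Ordinal (rk (Ordinal ru)) = enum_rank u) ?enum_rankK; last exact: val_inj.
    apply; rewrite -[RHS]x0.
    rewrite (reindex_onto (fun k => enum_val (Ordinal (rk k))) (fun u => cast_ord (esym dW) (enum_rank u))) /=; last first.
      by move=> v _; rewrite -[RHS]enum_rankK; congr enum_val; apply: val_inj.
    symmetry; apply: eq_big => [k|k _].
      by apply/eqP/val_inj; rewrite /= enum_valK.
    by rewrite /w enum_valK.
  by move=> i; split; [have := c0 (i, false)|have := c0 (i, true)].
have [t1 tij teps] := tr.
have Hg : compatible (W := WK) PhiK xi (tor B e f t).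
  split.
  - exact: (tor_isom HB He tm).
  - by move=> x; rewrite ker; split=> [/(tor_perp HB) ->|/(perp_fixed HB He t1)].
  - by rewrite (tor_limg HB He t1) (dim_span_frseq HB He) card_ord r2 dim_ext.
  move=> x /(perp_fixed HB He t1) px; apply: (tor_perp HB) => i.
  have := px i; have -> : tor B e f t x - x = dgf B e f (fun i => t i - 1) (fun i => (t i)^-1 - 1) x.
    by rewrite -(tor_sub1 B e f) add_lfunE opp_lfunE id_lfunE.
  rewrite (fe_dg HB He) (f_dg_f HB He) => -[/eqP h1 /eqP h2].
  by move: h1 h2; rewrite !mulf_eq0 !subr_eq0 invr_eq1 (negbTE (t1 i)) /= => /eqP h1 /eqP h2; split.
exists (nS PhiK W'K xi (tor B e f t)), xi, (gammaG PhiK W'K xi (tor B e f t) \o (upsilon PhiK W'K xi)^-1)%VF.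
split=> //; [exact: (nS_Nrel HPK Hg)|exact: (nS_bij HPK Hg)|].
rewrite (nS_Norm HPK Hg) S0E; apply/(HSK_frameP HP two He).
by exists e, f, t.
Qed.

(** The polynomial is crit of the matrix whose entries are the linear forms giving the
    pairings of n w' with W'. *)
Lemma NrK_open S0 : kmax S0 ->
  zopen_in (coords (ext iota)) (NK iota Phi W X W') (NrK iota Phi W X W' S0).
Proof.
move=> /(kmax_frame HP two ev) [e [f [He S0E]]].
have Hj := ext_bchange iota V; have HVK := pl_form HPK.
have [cE cEE] := coords_rec Hj; set c := coords (ext iota) in cEE *.
pose N := (\dim {:V} * \dim {:V})%N.
pose b := vbasis {: subvs_of W'K}; pose m := \dim {: subvs_of W'K}.
have mr : m = r.*2 by rewrite /m dim_subvs dim_ext r2 (dimWW' HP).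
pose M : 'M[{mpoly K[N]}]_m := \matrix_(i, k) \sum_l PhiK (vsval b`_i) (cE l (vsval b`_k)) *: 'X_l.
have ME (g : 'End('rV[K]_(\dim {:V}))) : map_mx (meval (c g)) M = gramM PhiK W'K g.
  apply/matrixP => i k; rewrite !mxE {2}(cEE g) sum_lfunE (fsumr HVK) raddf_sum.
  by apply: eq_bigr => l _ /=; rewrite scale_lfunE (fZr HVK) mevalZ mevalXU mulrC.
have crE (g : 'End('rV[K]_(\dim {:V}))) : (crit eps M).@[c g] = crit eps (gramM PhiK W'K g).
  by rewrite -ME (crit_map eps (meval (c g))).
exists [set p | p = crit eps M]; apply/seteqP; split=> [n [xi [eta [nr be nE]]]|n [[xi [eta [nr nE]]] Zn]].
  rewrite S0E => /(HSK_frameP HP two He) [e' [f' [t [He' tm tr hE]]]].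
  split; first by exists xi, eta.
  move=> /(_ _ erefl); rewrite crE nE; apply/eqP.
  exact: (Norm_crit HPK two mr nr be He' tm tr hE).
have cr : crit eps (gramM PhiK W'K n) != 0.
  by apply/eqP => cr; apply: Zn => p ->; rewrite crE.
rewrite nE in cr; have [dM _ _] := crit_diag two mr cr.
have be := det_eta_bij HPK dM.
exists xi, eta; split=> //; rewrite S0E; apply/(HSK_frameP HP two He).
exact: (crit_Norm HPK two mr nr be cr).
Qed.
End Parts.

Theorem theorem2 (F : fieldType) (K : closedFieldType) (iota : {rmorphism F -> K})
    (eps : bool) (V : vectType F) (Phi : {hermitian V for eps & idfun})
    (W W' X : {vspace V}) :
  (forall z : K, algebraicOver iota z) ->
  2%N \notin [pchar F] ->
  nondegenerate Phi ->
  (W <= orthov Phi W)%VS ->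
  (W' <= orthov Phi W')%VS ->
  \dim W' = \dim W ->
  directv (W + W') ->
  ((W + W') :&: orthov Phi (W + W') = 0)%VS ->
  X = orthov Phi (W + W')%VS ->
  ~~ odd (\dim W) ->
  (\dim W <= \dim X)%N ->
  let kmax := kmax_torus iota Phi W X in
  (exists S, kmax S) /\
  forall S0, kmax S0 ->
  [/\ NrK iota Phi W X W' S0 !=set0 /\
      zopen_in (coords (ext iota)) (NK iota Phi W X W') (NrK iota Phi W X W' S0),
      Nr iota Phi W X W' S0 = \bigcup_(S in kmax) NS iota Phi W X W' S
    & forall xi : set 'End(subvs_of (ext_space iota X)) -> 'Hom(subvs_of X, subvs_of W),
      (forall S, kmax S -> [set x | xi S x = 0] = E iota X S) ->
      Nr iota Phi W X W' S0 =
        \bigcup_(S in kmax)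
          [set conj_lfun m (nS Phi W' (xi S) gamma) |
             m in Mset Phi W X W' & gamma in Sr iota Phi X S]].
Proof.
move=> _ char2 nd WW W'W' _ _ cap XE ev le kmax.
have HP := polar_orthov nd WW W'W' cap XE.
have twoF : 2%:R != 0 :> F by move: char2; rewrite inE /=.
have two : 2%:R != 0 :> K by rewrite -(rmorph_nat iota) fmorph_eq0.
split; first exact: (exists_kmax iota HP).
move=> S0 k0; split.
- split; [exact: (NrK_nonempty HP)|exact: (NrK_open HP)].
- exact: (Nr_union HP).
move=> xi xiE; rewrite (Nr_union HP two ev k0).
by apply: eq_bigcupr => S kS; apply: (NS_Ad HP two ev kS); apply: xiE.
Qed.
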